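(* Let $\dots\xrightarrow{q_1}Y_1\xrightarrow{q_0}Y_0$ be an inverse sequence of uniformly continuous maps between uniform ANRs, and let $Y$ be its inverse limit. Let $f\colon X\to Y$ be a uniformly continuous map, where $X$ is the limit of a convergent inverse sequence $\dots\xrightarrow{p_1}X_1\xrightarrow{p_0}X_0$ of uniformly continuous maps between metrizable uniform spaces. Then there exist an increasing sequence $n=(n_i)$ of natural numbers and a level-preserving uniformly continuous extension $f_n\colon X_{n_{[0,\infty]}}\to Y_{[0,\infty]}$ of $f$. Moreover, given another such extension $f'_n\colon X_{n_{[0,\infty]}}\to Y_{[0,\infty]}$, there exists an increasing subsequence $l=(l_i)$ of $(n_i)$ such that the two compositions $X_{l_{[0,\infty]}}\xrightarrow{p^l_n}X_{n_{[0,\infty]}}\to Y_{[0,\infty]}$ with $f_n$ and with $f'_n$ are uniformly homotopic through level-preserving extensions $X_{l_{[0,\infty]}}\to Y_{[0,\infty]}$ of $f$.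
   Context: A uniform ANR is a metrizable uniform space $Y$ such that for every uniform embedding $i$ of $Y$ onto a closed subspace of a metrizable uniform space $Z$ there exists a uniformly continuous retraction onto $i(Y)$ of some uniform neighborhood of $i(Y)$ in $Z$. A uniform neighborhood of a subset $S$ of a metrizable uniform space is a set containing an $\varepsilon$-neighborhood of $S$ for some $\varepsilon>0$. Composite bonding maps are denoted $p^j_i\colon X_j\to X_i$ and projections $p^\infty_i\colon X\to X_i$. Let $X_{\mathbb{N}\cup\infty}$ be the inverse limit of the finite disjoint unions $X_n\sqcup\dots\sqcup X_0$ with bonding maps equal to $p_n$ on $X_{n+1}$ and to the identity on $X_n\sqcup\dots\sqcup X_0$. The inverse sequence is convergent if every uniform neighborhood of its limit $X$ in $X_{\mathbb{N}\cup\infty}$ contains all but finitely many of the $X_i$'s; equivalently, for each $i$, each uniform neighborhood of $p^\infty_i(X)$ in $X_i$ contains $p^j_i(X_j)$ for all but finitely many $j$. The mapping cylinder $MC(g)$ of a uniformly continuous map $g\colon P\to R$ is the quotient of $P\times[0,1]\sqcup R$ by $(x,1)\sim g(x)$, with the quotient uniformity (the finest pre-uniformity making the quotient map uniformly continuous). For an inverse sequence $Z=(\dots\xrightarrow{g_1}Z_1\xrightarrow{g_0}Z_0)$, the finite mapping telescope is $Z_{[0,m]}=MC(g_0)\cup_{Z_1}MC(g_1)\cup_{Z_2}\dots\cup_{Z_{m-1}}MC(g_{m-1})$ (successive amalgamated unions with quotient uniformity), with the obvious projection to $[0,m]$ sending $MC(g_i)$ onto $[i,i+1]$, $Z_i$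 to $i$ and the domain end $Z_{i+1}$ to $i+1$. The extended mapping telescope $Z_{[0,\infty]}$ is the inverse limit of the $Z_{[0,m]}$ along the obvious retractions $Z_{[0,m+1]}\to Z_{[0,m]}$ (collapsing $MC(g_m)$ onto $Z_m$); it has a projection to $[0,\infty]$, and its part over $\infty$ is identified with $\varprojlim Z$. A map between extended telescopes is level-preserving if it commutes with the projections to $[0,\infty]$. For an increasing sequence $n=(n_i)$, $X_{n_{[0,\infty]}}$ is the extended mapping telescope of $\dots\to X_{n_1}\to X_{n_0}$ with bonding maps $p^{n_{i+1}}_{n_i}$; its limit is identified with $X$. For a subsequence $l$ of $n$, $p^l_n\colon X_{l_{[0,\infty]}}\to X_{n_{[0,\infty]}}$ is the level-preserving map induced by the bonding maps $p^{l_i}_{n_i}\colon X_{l_i}\to X_{n_i}$. *)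

(* Defs.v *)
From HB Require Import structures.
From Stdlib Require Import Relations.
From mathcomp Require Import all_boot all_order all_algebra generic_quotient.
From mathcomp Require Import all_classical all_reals ereal topology normedtype.
Set Implicit Arguments.
Unset Strict Implicit.
Unset Printing Implicit Defensive.

Import Order.TTheory GRing.Theory Num.Theory.
Import numFieldNormedType.Exports.
Local Open Scope classical_set_scope.
Local Open Scope ring_scope.
Local Open Scope quotient_scope.

Definition pair_map (S T : Type) (f : S -> T) (xy : S * S) : T * T :=
  (f xy.1, f xy.2).

(** [uniformType] is a pre-uniform space: separatedness is not built in, it is
    part of metrizability. *)

Definition metrizable (R : realType) (T : uniformType) : Prop :=
  exists d : T -> T -> R, [/\ forall x y, d x y = 0 <-> x = y,
    forall x y, d x y = d y x,
    forall x y z, d x z <= d x y + d y z &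
    entourage = entourage_ (fun x e => [set y | d x y < e])].

Definition uniform_nbhd (T : uniformType) (S N : set T) : Prop :=
  exists2 E, entourage E & forall x y, S x -> E (x, y) -> N y.

Definition uniform_embedding (S T : uniformType) (i : S -> T) : Prop :=
  injective i /\ (entourage : set_system (S * S)) = @initial_ent S T i.

Definition uniform_ANR (R : realType) (Y : uniformType) : Prop :=
  metrizable R Y /\
  forall (Z : uniformType) (i : Y -> Z),
    metrizable R Z -> uniform_embedding i -> closed (range i) ->
    exists N : set Z, uniform_nbhd (range i) N /\
      exists r : set_type N -> Z, [/\ unif_continuous r,
        forall z, range i (r z) &
        forall z, range i (set_val z) -> r z = set_val z].

Section sum_uniform.
Local Open Scope relation_scope.
Variables S T : uniformType.

Definition sum_ent : set_system ((S + T) * (S + T)) :=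
  [set E | entourage (pair_map inl @^-1` E) /\
           entourage (pair_map inr @^-1` E)].

Let sum_ent_filter : Filter sum_ent.
Proof.
split.
- by split; exact: filterT.
- by move=> A B [A1 A2] [B1 B2]; split; exact: filterI.
- by move=> A B AB [A1 A2]; split; [move: A1|move: A2]; apply: filterS => ? /AB.
Qed.

Let sum_ent_refl A : sum_ent A -> diagonal `<=` A.
Proof.
move=> [A1 A2] [x y] /diagonalP -> {x}.
by case: y => y; [exact: (entourage_refl y A1)|exact: (entourage_refl y A2)].
Qed.

Let sum_ent_inv A : sum_ent A -> sum_ent A^-1.
Proof. by move=> [A1 A2]; split; [exact: (entourage_inv A1)|exact: (entourage_inv A2)]. Qed.

Let sum_ent_split A : sum_ent A -> exists2 B, sum_ent B & B \; B `<=` A.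
Proof.
move=> [/entourage_split_ex[B1 eB1 B1A] /entourage_split_ex[B2 eB2 B2A]].
exists [set xy | match xy with
  | (inl x, inl y) => B1 (x, y) | (inr x, inr y) => B2 (x, y) | _ => False end].
  by split; [apply: filterS eB1|apply: filterS eB2] => -[].
move=> [x y] [z]; case: x => x; case: z => z; case: y => y //= xz zy.
  by apply: (B1A (x, y)); exists z.
by apply: (B2A (x, y)); exists z.
Qed.

HB.instance Definition _ := isUniform.Build (S + T)%type
  sum_ent_filter sum_ent_refl sum_ent_inv sum_ent_split.

End sum_uniform.

Section finest_preuniformity.
Local Open Scope relation_scope.

Definition preuniformity (T : Type) (U : set_system (T * T)) : Prop :=
  [/\ Filter U, forall A, U A -> diagonal `<=` A,
      forall A, U A -> U A^-1 &
      forall A, U A -> exists2 B, U B & B \; B `<=` A].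

Variables (T : uniformType) (Q : Type) (pr : T -> Q).

(** The union of all pre-uniformities on [Q] making [pr] uniformly continuous;
    it is itself such a pre-uniformity. *)
Definition finest_ent : set_system (Q * Q) :=
  [set E | exists U, [/\ preuniformity U,
    forall V, U V -> entourage (pair_map pr @^-1` V) & U E]].

Lemma finest_entP : preuniformity finest_ent.
Proof.
split; [split|..].
- exists [set setT]; split => //; last by move=> _ ->; exact: filterT.
  split.
  + split => //; first by move=> P S -> ->; rewrite setTI.
    by move=> P S + /= PT; rewrite PT => TS; apply/seteqP; split.
  + by move=> _ ->.
  + by move=> _ ->.
  + by move=> _ ->; exists setT.
- move=> A B [U [[FU Ur Ui Us] Uc UA]] [V [[FV Vr Vi Vs] Vc VB]].
  exists [set E | exists C D, [/\ U C, V D & C `&` D `<=` E]]; split.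
  + split; [split|..].
    * by exists setT, setT; split => //; exact: filterT.
    * move=> P S [C [D [UC VD CD]]] [C' [D' [UC' VD' CD']]].
      exists (C `&` C'), (D `&` D'); split; [exact: filterI|exact: filterI|].
      by move=> x [[? ?] [? ?]]; split; [exact: CD|exact: CD'].
    * move=> P S PS [C [D [UC VD CD]]].
      by exists C, D; split => // x /CD /PS.
    * move=> P [C [D [UC VD CD]]] x dx.
      by apply: CD; split; [exact: Ur dx|exact: Vr dx].
    * move=> P [C [D [UC VD CD]]]; exists C^-1, D^-1.
      by split; [exact: Ui|exact: Vi|move=> x [? ?]; exact: CD].
    * move=> P [C [D [/Us[C' UC' CC] /Vs[D' VD' DD] CD]]].
      exists (C' `&` D'); first by exists C', D'; split.
      move=> [x y] [z [xz xz'] [zy zy']]; apply: CD.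
      by split; [apply: CC|apply: DD]; exists z.
  + move=> E [C [D [UC VD CD]]]; apply: filterS (filterI (Uc _ UC) (Vc _ VD)).
    by move=> x [? ?]; exact: CD.
  + by exists A, B; split.
- by move=> A B AB [U [[FU ? ? ?] Uc UA]]; exists U; split => //; exact: filterS UA.
- by move=> A [U [[? Ur ? ?] Uc UA]]; exact: Ur.
- by move=> A [U [[? ? Ui ?] Uc UA]]; exists U; split => //; exact: Ui.
- move=> A [U [[? ? ? Us] Uc UA]]; have [B UB BA] := Us _ UA.
  by exists B => //; exists U.
Qed.

End finest_preuniformity.

Section uniform_quotient.
Variables (T : uniformType) (r : T -> T -> Prop).

Definition gen_equiv : rel T := fun x y => `[< clos_refl_sym_trans T r x y >].

Lemma gen_equiv_refl : reflexive gen_equiv.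
Proof. by move=> x; apply/asboolP; exact: rst_refl. Qed.

Lemma gen_equiv_sym : symmetric gen_equiv.
Proof. by move=> x y; apply/asboolP/asboolP => ?; exact: rst_sym. Qed.

Lemma gen_equiv_trans : transitive gen_equiv.
Proof.
by move=> y x z /asboolP xy /asboolP yz; apply/asboolP; exact: rst_trans yz.
Qed.

Canonical gen_equiv_equiv :=
  EquivRel gen_equiv gen_equiv_refl gen_equiv_sym gen_equiv_trans.

(** The quotient of [T] by the equivalence relation generated by [r], with the
    quotient uniformity. *)
Definition uquot : Type := {eq_quot gen_equiv_equiv}.
Definition uquot_pi (x : T) : uquot := \pi_({eq_quot gen_equiv_equiv}) x.
Definition uquot_lift (S : Type) (f : T -> S) (x : uquot) : S :=
  f (repr (x : {eq_quot gen_equiv_equiv})).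

HB.instance Definition _ := Choice.on uquot.

Let ent := finest_ent uquot_pi.

Let ent_filter : Filter ent.
Proof. by have [] := finest_entP uquot_pi. Qed.

HB.instance Definition _ := isUniform.Build uquot ent_filter
  (let: And4 _ h _ _ := finest_entP uquot_pi in h)
  (let: And4 _ _ h _ := finest_entP uquot_pi in h)
  (let: And4 _ _ _ h := finest_entP uquot_pi in h).

Lemma uquot_piP x y : r x y -> uquot_pi x = uquot_pi y.
Proof. by move=> rxy; apply/eqquotP/asboolP; exact: rst_step. Qed.

Lemma uquot_liftE (S : Type) (f : T -> S) :
  (forall x y, r x y -> f x = f y) ->
  forall x, uquot_lift f (uquot_pi x) = f x.
Proof.
move=> fr x; have fE a b : clos_refl_sym_trans T r a b -> f a = f b.
  by elim=> [? ? /fr| |? ? _ ->|? ? ? _ -> _ ->].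
have /eqquotP/asboolP : repr (uquot_pi x : {eq_quot gen_equiv_equiv}) = x
    %[mod {eq_quot gen_equiv_equiv}] by rewrite [LHS]reprK.
exact: fE.
Qed.

Lemma uquot_ind (P : uquot -> Prop) : (forall x, P (uquot_pi x)) -> forall q, P q.
Proof. by move=> h q; rewrite -[q]reprK; exact: h. Qed.

Lemma uquot_pi_unif_continuous : unif_continuous uquot_pi.
Proof. by move=> E [U [_ Uc UE]]; exact: Uc. Qed.

Lemma uquot_unif_continuousP (S : uniformType) (h : uquot -> S) :
  unif_continuous h <-> unif_continuous (h \o uquot_pi).
Proof.
split=> [hc E /hc /uquot_pi_unif_continuous //|hc E entE].
exists [set A | @initial_ent _ _ h A]; split => //; last by exists E.
- split.
  + exact: (@entourage_filter' (initial_topology h)).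
  + move=> A eA [x y] xy; have <- : x = y := xy.
    exact: (@entourage_refl (initial_topology h) A x eA).
  + exact: (@entourage_inv (initial_topology h)).
  + exact: (@entourage_split_ex (initial_topology h)).
- move=> A [V eV VA]; have : entourage (pair_map (h \o uquot_pi) @^-1` V) := hc _ eV.
  by apply: filterS => -[x y] ?; exact: VA.
Qed.

End uniform_quotient.

Section unit_interval.
Variable R : realType.

Definition unitI : uniformType := set_type (`[0%R, 1%R]%classic : set R).

Lemma unitI0_subproof : (0 : R) \in (`[0%R, 1%R]%classic : set R).
Proof. by rewrite inE /= in_itv /= lexx ler01. Qed.
Lemma unitI1_subproof : (1 : R) \in (`[0%R, 1%R]%classic : set R).
Proof. by rewrite inE /= in_itv /= lexx ler01. Qed.

Definition unitI0 : unitI := SigSub unitI0_subproof.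
Definition unitI1 : unitI := SigSub unitI1_subproof.

End unit_interval.

Section inverse_limit.
Variables (Z : nat -> uniformType) (g : forall i, Z i.+1 -> Z i).

Definition invlim_set : set (prod_topology Z) :=
  [set x : prod_topology Z | forall i, g (x i.+1) = x i].

Definition invlim : uniformType := set_type invlim_set.

Definition invlim_mk (x : prod_topology Z) (h : invlim_set x) : invlim :=
  SigSub (mem_set h).

Definition invlim_proj (i : nat) (x : invlim) : Z i := set_val x i.

Lemma invlim_projP i (x : invlim) : g (invlim_proj i.+1 x) = invlim_proj i x.
Proof. by case: x => x xP; exact: (set_mem xP). Qed.

Lemma invlim_projE i (x : prod_topology Z) (h : invlim_set x) :
  invlim_proj i (invlim_mk h) = x i.
Proof. by []. Qed.

Fixpoint iter_bond (i k : nat) : Z (k + i) -> Z i :=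
  match k with
  | 0 => id
  | k'.+1 => fun x => iter_bond (g x)
  end.

(** The composite bonding map from [Z j] to [Z i]. *)
Definition bond (i j : nat) (h : (i <= j)%N) (x : Z j) : Z i :=
  @iter_bond i (j - i) (ecast m (Z m) (esym (subnK h)) x).

Lemma iter_bondE i j k (h : (i <= j)%N) (e : (j = k + i)%N) (x : Z j) :
  bond h x = @iter_bond i k (ecast m (Z m) e x).
Proof.
rewrite /bond; move: (esym (subnK h)); have -> : (j - i = k)%N by rewrite e addnK.
by move=> e'; rewrite (eq_irrelevance e e').
Qed.

Lemma bond_refl i (h : (i <= i)%N) (x : Z i) : bond h x = x.
Proof. by rewrite (@iter_bondE i i 0%N h erefl). Qed.

Lemma bondS i j (h : (i <= j)%N) (h' : (i <= j.+1)%N) (x : Z j.+1) :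
  bond h' x = bond h (g x).
Proof.
have e : j = (j - i + i)%N by rewrite subnK.
rewrite (iter_bondE h e) (@iter_bondE i j.+1 (j - i).+1 h' (congr1 S e)) /=.
have castE m (e' : j = m) :
    g (ecast m (Z m) (congr1 S e') x) = ecast m (Z m) e' (g x).
  by case: m / e'.
exact: (congr1 (@iter_bond i (j - i)) (castE _ e)).
Qed.

Lemma bond_comp i j k (h : (i <= j)%N) (h' : (j <= k)%N) (h'' : (i <= k)%N)
  (x : Z k) : bond h (bond h' x) = bond h'' x.
Proof.
elim: k h' h'' x => [|k ih] h' h'' x.
  have j0 : j = 0%N by apply/eqP; rewrite -leqn0.
  by subst j; rewrite bond_refl (eq_irrelevance h h'').
have [jk|kj] := leqP j k.
  by rewrite (bondS jk) (bondS (leq_trans h jk)); exact: ih.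
have jk : j = k.+1 by apply/eqP; rewrite eqn_leq h' kj.
by subst j; rewrite bond_refl (eq_irrelevance h h'').
Qed.

Lemma invlim_bond i j (h : (i <= j)%N) (x : invlim) :
  bond h (invlim_proj j x) = invlim_proj i x.
Proof.
elim: j h => [|j ih] h.
  have i0 : i = 0%N by apply/eqP; rewrite -leqn0.
  by subst i; rewrite bond_refl.
have [ij|ji] := leqP i j; first by rewrite (bondS ij) invlim_projP.
have ij : i = j.+1 by apply/eqP; rewrite eqn_leq h ji.
by subst i; rewrite bond_refl.
Qed.

End inverse_limit.

Section convergent.
Variables (X : nat -> uniformType) (p : forall i, X i.+1 -> X i).

(** The disjoint union of [X n], ..., [X 0] with the inclusion of [X n]. *)
Fixpoint stage (n : nat) : {W : uniformType & X n -> W} :=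
  match n with
  | 0 => existT _ (X 0%N) id
  | k.+1 => existT _ ((X k.+1 + projT1 (stage k))%type : uniformType) inl
  end.

Definition stage_bond (n : nat) (w : projT1 (stage n.+1)) : projT1 (stage n) :=
  match w with
  | inl x => projT2 (stage n) (p x)
  | inr w' => w'
  end.

(** [stage_index w = i] iff [w] lies in the summand [X i]. *)
Fixpoint stage_index (n : nat) : projT1 (stage n) -> nat :=
  match n with
  | 0 => fun=> 0%N
  | k.+1 => fun w => if w is inr w' then stage_index w' else k.+1
  end.

Definition XNoo : uniformType := invlim stage_bond.

Definition limit_to_XNoo (x : invlim p) : XNoo.
Proof.
apply: (@invlim_mk _ stage_bond (fun n => projT2 (stage n) (invlim_proj n x))).
abstract by move=> n /=; rewrite invlim_projP.
Defined.

(** The copy of [X i] in [XNoo]: a thread in it has its coordinates in [X i]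
    from stage [i] on, and the [n]-th one in [X n] before. *)
Definition level_set (i : nat) : set XNoo :=
  [set w | forall n, stage_index (invlim_proj n w) = minn n i].

Definition convergent : Prop :=
  forall U : set XNoo, uniform_nbhd (range limit_to_XNoo) U ->
    \forall i \near \oo, level_set i `<=` U.

End convergent.

Section mapping_cylinder.
Variable R : realType.

Section cylinder.
Variables (P Q : uniformType) (g : P -> Q).

Definition MC_rel (u v : (P * unitI R) + Q) : Prop :=
  exists x, u = inl (x, unitI1 R) /\ v = inr (g x).

Definition MC : uniformType := uquot MC_rel.
Definition MC_dom (x : P) : MC := uquot_pi MC_rel (inl (x, unitI0 R)).
Definition MC_rng (y : Q) : MC := uquot_pi MC_rel (inr y).

(** Height above the range end [Q]; the domain end [P] has height [1]. *)
Definition MC_height : MC -> R :=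
  @uquot_lift _ MC_rel _ (fun u => if u is inl (_, t) then 1 - set_val t else 0).

Definition MC_collapse : MC -> Q :=
  @uquot_lift _ MC_rel _
    (fun u => match u with inl (x, _) => g x | inr y => y end).

Lemma MC_collapse_dom x : MC_collapse (MC_dom x) = g x.
Proof. by rewrite /MC_collapse uquot_liftE // => ? ? [y [-> ->]]. Qed.

Lemma MC_collapse_rng y : MC_collapse (MC_rng y) = y.
Proof. by rewrite /MC_collapse uquot_liftE // => ? ? [z [-> ->]]. Qed.

End cylinder.

Section cylinder_map.
Variables (P Q P' Q' : uniformType) (g : P -> Q) (g' : P' -> Q').
Variables (u : P -> P') (v : Q -> Q').

Definition MC_map : MC g -> MC g' :=
  @uquot_lift _ (MC_rel g) _ (fun w => match w with
    | inl (x, t) => uquot_pi (MC_rel g') (inl (u x, t))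
    | inr y => uquot_pi (MC_rel g') (inr (v y))
    end).

Hypothesis guv : forall x, g' (u x) = v (g x).

Lemma MC_map_compat a b : MC_rel g a b ->
  match a with
    | inl (x, t) => uquot_pi (MC_rel g') (inl (u x, t))
    | inr y => uquot_pi (MC_rel g') (inr (v y))
  end = match b with
    | inl (x, t) => uquot_pi (MC_rel g') (inl (u x, t))
    | inr y => uquot_pi (MC_rel g') (inr (v y))
  end.
Proof. by move=> [x [-> ->]]; apply: uquot_piP; exists (u x); rewrite guv. Qed.

Lemma MC_map_dom x : MC_map (MC_dom g x) = MC_dom g' (u x).
Proof. by rewrite /MC_map uquot_liftE //; exact: MC_map_compat. Qed.

Lemma MC_map_rng y : MC_map (MC_rng g y) = MC_rng g' (v y).
Proof. by rewrite /MC_map uquot_liftE //; exact: MC_map_compat. Qed.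

Lemma MC_collapse_map w : MC_collapse (MC_map w) = v (MC_collapse w).
Proof.
elim/uquot_ind: w => w; rewrite /MC_map uquot_liftE; last exact: MC_map_compat.
have compat (Q0 R0 : uniformType) (h : Q0 -> R0) a b : MC_rel h a b ->
    (match a with inl (x, _) => h x | inr y => y end) =
    (match b with inl (x, _) => h x | inr y => y end).
  by move=> [? [-> ->]].
rewrite /MC_collapse (uquot_liftE (compat _ _ g)).
by case: w => [[x t]|y]; rewrite uquot_liftE //; exact: compat.
Qed.

End cylinder_map.
End mapping_cylinder.

Section amalgam.
Variables (C A B : uniformType) (a : C -> A) (b : C -> B).

Definition amalgam_rel (u v : A + B) : Prop :=
  exists c, u = inl (a c) /\ v = inr (b c).

(** The amalgamated union of [A] and [B] along [C]. *)
Definition amalgam : uniformType := uquot amalgam_rel.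
Definition amalgam_inl (x : A) : amalgam := uquot_pi amalgam_rel (inl x).
Definition amalgam_inr (y : B) : amalgam := uquot_pi amalgam_rel (inr y).

Definition amalgam_case (S : Type) (f : A -> S) (h : B -> S) : amalgam -> S :=
  @uquot_lift _ amalgam_rel _
    (fun u => match u with inl x => f x | inr y => h y end).

Section case_lemmas.
Variables (S : Type) (f : A -> S) (h : B -> S).
Hypothesis fh : forall c, f (a c) = h (b c).

Lemma amalgam_case_inl x : amalgam_case f h (amalgam_inl x) = f x.
Proof. by rewrite /amalgam_case uquot_liftE // => ? ? [c [-> ->]]. Qed.

Lemma amalgam_case_inr y : amalgam_case f h (amalgam_inr y) = h y.
Proof. by rewrite /amalgam_case uquot_liftE // => ? ? [c [-> ->]]. Qed.

End case_lemmas.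

Lemma amalgam_glue c : amalgam_inl (a c) = amalgam_inr (b c).
Proof. by apply: uquot_piP; exists c. Qed.

Lemma amalgam_ind (P : amalgam -> Prop) :
  (forall x, P (amalgam_inl x)) -> (forall y, P (amalgam_inr y)) ->
  forall w, P w.
Proof. by move=> hl hr; elim/uquot_ind => -[]. Qed.

End amalgam.

Section telescope.
Variables (R : realType) (Z : nat -> uniformType).
Variable g : forall i, Z i.+1 -> Z i.

(** The finite telescope over [0, m] with the inclusion of its end [Z m].
    It starts from the telescope over [0, 0], which is [Z 0]; thus the one
    over [0, 1] is the amalgam of [Z 0] and [MC (g 0)] along [Z 0]. *)
Fixpoint tel_end (m : nat) : {T : uniformType & Z m -> T} :=
  match m with
  | 0 => existT _ (Z 0%N) id
  | k.+1 => existT _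
      (amalgam (projT2 (tel_end k)) (@MC_rng R _ _ (@g k)))
      (fun z => amalgam_inr _ _ (MC_dom R (@g k) z))
  end.

Definition tel (m : nat) : uniformType := projT1 (tel_end m).
Definition tel_incl (m : nat) : Z m -> tel m := projT2 (tel_end m).

Fixpoint tel_level (m : nat) : tel m -> R :=
  match m return tel m -> R with
  | 0 => fun=> 0
  | k.+1 => amalgam_case (@tel_level k) (fun c => k%:R + MC_height c)
  end.

Definition tel_retr (m : nat) : tel m.+1 -> tel m :=
  amalgam_case id (fun c => tel_incl (MC_collapse c)).

Definition tel_inl (m : nat) (w : tel m) : tel m.+1 :=
  amalgam_inl (@tel_incl m) (@MC_rng R _ _ (@g m)) w.
Definition tel_inr (m : nat) (c : MC R (@g m)) : tel m.+1 :=
  amalgam_inr (@tel_incl m) (@MC_rng R _ _ (@g m)) c.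

Lemma tel_glue m (z : Z m) : tel_inl (tel_incl z) = tel_inr (MC_rng R (@g m) z).
Proof. exact: amalgam_glue. Qed.

Lemma tel_inclS m (z : Z m.+1) : tel_incl z = tel_inr (MC_dom R (@g m) z).
Proof. by []. Qed.

Lemma tel_ind m (P : tel m.+1 -> Prop) :
  (forall w, P (tel_inl w)) -> (forall c, P (tel_inr c)) -> forall w, P w.
Proof. by move=> hl hr w; elim/amalgam_ind: w. Qed.

Lemma tel_retr_inl m (w : tel m) :
  tel_retr (tel_inl w) = w.
Proof. by apply: amalgam_case_inl => c; rewrite MC_collapse_rng. Qed.

Lemma tel_retr_inr m (c : MC R (@g m)) :
  tel_retr (tel_inr c) = tel_incl (MC_collapse c).
Proof. by apply: amalgam_case_inr => z; rewrite MC_collapse_rng. Qed.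

Lemma tel_retr_incl m (z : Z m.+1) : tel_retr (tel_incl z) = tel_incl (g z).
Proof. by rewrite tel_inclS tel_retr_inr MC_collapse_dom. Qed.

(** The extended mapping telescope. *)
Definition xtel : uniformType := invlim tel_retr.

Definition xtel_level (w : xtel) : \bar R :=
  ereal_sup (range (fun m => (tel_level (invlim_proj m w))%:E)).

Definition xtel_lim (x : invlim g) : xtel.
Proof.
apply: (@invlim_mk _ tel_retr (fun m => tel_incl (invlim_proj m x))).
abstract by move=> m; rewrite tel_retr_incl invlim_projP.
Defined.

End telescope.

Section telescope_map.
Variables (R : realType) (A B : nat -> uniformType).
Variables (g : forall i, A i.+1 -> A i) (h : forall i, B i.+1 -> B i).
Variable u : forall i, A i -> B i.

Fixpoint tel_map (m : nat) : tel R g m -> tel R h m :=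
  match m return tel R g m -> tel R h m with
  | 0 => @u 0%N
  | k.+1 => amalgam_case (fun w => amalgam_inl _ _ (@tel_map k w))
      (fun c => amalgam_inr _ _ (MC_map (@h k) (@u k.+1) (@u k) c))
  end.

Hypothesis hu : forall i (x : A i.+1), h (u x) = u (g x).

Lemma tel_map_incl m (x : A m) : tel_map (tel_incl R g x) = tel_incl R h (u x).
Proof.
elim: m x => [//|m ih] x; rewrite !tel_inclS -(MC_map_dom R (@hu m)).
apply: amalgam_case_inr => c; rewrite MC_map_rng //.
exact: etrans (congr1 (@tel_inl R _ h m) (ih c)) (tel_glue _ _ _).
Qed.

Lemma tel_map_inl m (w : tel R g m) :
  @tel_map m.+1 (tel_inl w) = tel_inl (tel_map w).
Proof.
apply: amalgam_case_inl => c; rewrite MC_map_rng //.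
exact: etrans (congr1 (@tel_inl R _ h m) (tel_map_incl c)) (tel_glue _ _ _).
Qed.

Lemma tel_map_inr m (c : MC R (@g m)) :
  @tel_map m.+1 (tel_inr c) = tel_inr (MC_map (@h m) (@u m.+1) (@u m) c).
Proof.
apply: amalgam_case_inr => z; rewrite MC_map_rng //.
exact: etrans (congr1 (@tel_inl R _ h m) (tel_map_incl z)) (tel_glue _ _ _).
Qed.

Lemma tel_map_retr m (w : tel R g m.+1) :
  tel_retr (tel_map w) = tel_map (tel_retr w).
Proof.
elim/tel_ind: w => [w|c].
  by rewrite tel_map_inl !tel_retr_inl.
by rewrite tel_map_inr !tel_retr_inr MC_collapse_map // tel_map_incl.
Qed.

(** The level-preserving map of extended telescopes induced by the [u i]. *)
Definition xtel_map (w : xtel R g) : xtel R h.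
Proof.
apply: (@invlim_mk _ (@tel_retr R B h) (fun m => tel_map (invlim_proj m w))).
abstract by move=> m; rewrite tel_map_retr invlim_projP.
Defined.

End telescope_map.

Definition increasing (n : nat -> nat) : Prop := {homo n : i j / (i < j)%N}.

Lemma increasing_comp n k : increasing n -> increasing k -> increasing (n \o k).
Proof. by move=> hn hk i j /hk /hn. Qed.

Lemma increasing_leS n : increasing n -> forall i, (n i <= n i.+1)%N.
Proof. by move=> hn i; exact/ltnW/hn. Qed.

Lemma increasing_geid n : increasing n -> forall i, (i <= n i)%N.
Proof. by move=> hn; elim=> // i ih; exact: leq_ltn_trans ih (hn _ _ (ltnSn i)). Qed.

Lemma increasing_le n k : increasing n -> increasing k ->
  forall i, (n i <= n (k i))%N.
Proof.
move=> hn hk i; have := increasing_geid hk i; rewrite leq_eqVlt => /orP[/eqP <-//|].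
by move/hn/ltnW.
Qed.

Section subsequence.
Variables (R : realType) (X : nat -> uniformType) (p : forall i, X i.+1 -> X i).
Variables (n : nat -> nat) (hn : increasing n).

Definition sub_seq (i : nat) : uniformType := X (n i).
Definition sub_bond (i : nat) : sub_seq i.+1 -> sub_seq i :=
  bond p (increasing_leS hn i).

Definition sub_xtel : uniformType := xtel R sub_bond.

Definition sub_lim (x : invlim p) : invlim sub_bond.
Proof.
apply: (@invlim_mk _ sub_bond (fun i => invlim_proj (n i) x)).
abstract by move=> i; exact: (invlim_bond (increasing_leS hn i) x).
Defined.

(** The identification of [invlim p] with the part of [sub_xtel] over oo. *)
Definition sub_xtel_lim (x : invlim p) : sub_xtel := xtel_lim R (sub_lim x).

End subsequence.

(** The map p^l_n, for the subsequence [l := n \o k] of [n]. *)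
Definition sub_xtel_map (R : realType) (X : nat -> uniformType)
  (p : forall i, X i.+1 -> X i) (n k : nat -> nat) (hn : increasing n)
  (hk : increasing k) : sub_xtel R p (increasing_comp hn hk) -> sub_xtel R p hn.
Proof.
apply: (@xtel_map R _ _ (sub_bond p (increasing_comp hn hk)) (sub_bond p hn)
  (fun i => bond p (increasing_le hn hk i))).
abstract by move=> i x; rewrite /sub_bond
  !(bond_comp _ _ _ (leq_trans (increasing_leS hn i) (increasing_le hn hk i.+1))).
Defined.

Definition level_preserving (R : realType) (A B : nat -> uniformType)
  (a : forall i, A i.+1 -> A i) (b : forall i, B i.+1 -> B i)
  (F : xtel R a -> xtel R b) : Prop :=
  forall w, xtel_level (F w) = xtel_level w.

Section extensions.
Variables (R : realType) (X Y : nat -> uniformType).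
Variables (p : forall i, X i.+1 -> X i) (q : forall i, Y i.+1 -> Y i).
Variables (f : invlim p -> invlim q) (n : nat -> nat) (hn : increasing n).

Definition extends (F : sub_xtel R p hn -> xtel R q) : Prop :=
  forall x, F (sub_xtel_lim R hn x) = xtel_lim R (f x).

Definition level_extension (F : sub_xtel R p hn -> xtel R q) : Prop :=
  [/\ unif_continuous F, level_preserving F & extends F].

Definition homotopic_through_level_extensions
  (F G : sub_xtel R p hn -> xtel R q) : Prop :=
  exists H : (sub_xtel R p hn * unitI R)%type -> xtel R q,
    [/\ unif_continuous H,
        forall w, H (w, unitI0 R) = F w,
        forall w, H (w, unitI1 R) = G w &
        forall t, level_extension (fun w => H (w, t))].

End extensions.

Arguments sub_xtel_map R {X} p {n k} hn hk _.

(* Main.v *)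
From HB Require Import structures.
Require Import Defs.
From mathcomp Require Import all_boot all_order all_algebra.
From mathcomp Require Import finmap ring lra.
From mathcomp Require Import all_classical all_reals ereal topology normedtype.
Set Implicit Arguments.
Unset Strict Implicit.
Unset Printing Implicit Defensive.

Import Order.TTheory GRing.Theory Num.Theory.
Import numFieldNormedType.Exports.
Local Open Scope classical_set_scope.
Local Open Scope ring_scope.

(** The proof rests on three facts.

    1. A map of an extended telescope is known once it is known on the cylinders
    and on the limit, and it is uniformly continuous as soon as it is so on each
    cylinder and is uniformly approximated by maps that factor through finite
    telescopes ([xtel_extension]). Maps out of the quotients that make up the
    telescopes can be handled together with a parameter ([uc_uquot]), so the same
    lemma yields maps, homotopies and the retractions onto the initial parts of
    a telescope ([xtel_cut]).

    2. A uniform ANR [Y] is a uniform neighborhood retract of a space of bounded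
    functions which contains it as a closed subset ([ANR_collar_retraction]). Hence
    close points of [Y] are joined by short paths that depend uniformly
    continuously on them ([ANR_paths]), and a map of [invlim p] to [Y] is
    approximated by a map which is defined near the image of the limit in some
    [X i] ([ANR_approximation]). By convergence, all but finitely many of the [X j]
    are mapped into this neighborhood ([convergent_shadows]).

    3. A level-preserving map into the telescope of [Y] amounts, on the cylinder
    over the interval from [j] to [j.+1], to a homotopy in [Y j.+1] which after
    composition with the bonding map ends at the map prescribed on the lower end.
    Short paths supply such homotopies, if one starts from maps [psi j] into
    [Y j.+1] and lets [q (psi j)] be the map at level [j] ([xtel_bridge]). They are
    chosen shorter and shorter as seen from each fixed term of [Y], which gives
    continuity at infinity.

    Existence: approximate the coordinate of [f] in [Y j.+1] by [psi j] on a far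
    term [X (n j)] and bridge the differences ([level_extension_exists]).

    Uniqueness: two extensions are close near the limit, but not at low levels.
    In the telescope of a sparse subsequence [n \o k] each point has room to move up
    along its path in the telescope of [n] before the extension is applied; after
    that the value is retracted to its original level ([push_up]). This homotopes
    each composition to one that takes values of the extension at high levels only,
    where the two extensions are close, and short paths join them
    ([level_extensions_homotopic]). *)

Section uniform_maps.

Lemma ucP (U V : uniformType) (f : U -> V) :
  unif_continuous f <-> forall B, entourage B ->
    exists2 A, entourage A & forall x y, A (x, y) -> B (f x, f y).
Proof.
split=> [fc B /fc fB|h B /h[A eA AB]].
  by exists [set xy | B (f xy.1, f xy.2)].
by apply: filterS eA => -[x y]; exact: AB.
Qed.

Lemma ent_trans (U : uniformType) (B : set (U * U)) : entourage B ->
  exists2 A, entourage A & forall x y z, A (x, y) -> A (y, z) -> B (x, z).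
Proof.
move=> /entourage_split_ex[A eA AB]; exists A => // x y z xy yz.
by apply: AB; exists y.
Qed.

Lemma ent_sym (U : uniformType) (B : set (U * U)) : entourage B ->
  exists2 A, entourage A & forall x y, A (x, y) -> B (x, y) /\ B (y, x).
Proof. by move=> /entourage_invI eB; eexists; first exact: eB. Qed.

Lemma ent_sym_trans (U : uniformType) (B : set (U * U)) : entourage B ->
  exists2 A, entourage A & forall x y z,
    [/\ A (y, x) -> A (y, z) -> B (x, z), A (x, y) -> A (y, z) -> B (x, z)
      & A (x, y) -> A (z, y) -> B (x, z)].
Proof.
move=> /ent_trans[A eA AB]; have [C eC CA] := ent_sym eA.
exists C => // x y z; split=> [/CA[_ ?] /CA[? _]|/CA[? _] /CA[? _]|/CA[? _] /CA[_ ?]].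
all: exact: (AB x y z).
Qed.

Lemma ent_bigI (U : uniformType) m (A : forall j, (j <= m)%N -> set (U * U)) :
  (forall j h, entourage (@A j h)) -> entourage [set z | forall j h, @A j h z].
Proof.
move=> eA; suff H k : (k <= m.+1)%N -> entourage [set z | forall j (h : (j <= m)%N),
    (j < k)%N -> A j h z].
  by apply: filterS (H _ (leqnn _)) => z zA j h; exact: zA.
elim: k => [|k ih] km; first by apply: filterS (@entourageT U).
apply: filterS (filterI (eA k km) (ih (ltnW km))) => z [zk zj] j h.
rewrite ltnS leq_eqVlt => /predU1P[jk|]; last exact: zj.
by subst j; rewrite (eq_irrelevance h km).
Qed.

Lemma ent_prodP (U V : uniformType) (E : set ((U * V) * (U * V))) :
  entourage E <-> exists A B, [/\ entourage A, entourage B &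
    forall x y x' y', A (x, x') -> B (y, y') -> E ((x, y), (x', y'))].
Proof.
split=> [[[A B] /= [eA eB] AB]|[A [B [eA eB AB]]]].
  exists A, B; split=> // x y x' y' Ax By.
  have [|[[a b] [c d]] Ez] := AB ((x, x'), (y, y')); first by split.
  by move=> [<- <- <- <-].
apply: (filterS _ (prod_entP eA eB)) => -[[x y] [x' y']] /= [].
exact: AB.
Qed.

Lemma uc_id (U : uniformType) : unif_continuous (fun x : U => x).
Proof. by apply/ucP => B eB; exists B. Qed.

Lemma uc_cst (U V : uniformType) (v : V) : unif_continuous (fun _ : U => v).
Proof.
apply/ucP => B eB; exists setT; first exact: entourageT.
by move=> *; exact: entourage_refl.
Qed.

Lemma uc_comp (U V W : uniformType) (f : U -> V) (g : V -> W) :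
  unif_continuous g -> unif_continuous f ->
  unif_continuous (fun x => g (f x)).
Proof. by move=> gc fc B /gc /fc. Qed.

Lemma uc_fst (U V : uniformType) :
  unif_continuous (fun x : U * V => x.1).
Proof.
apply/ucP => B eB.
exists [set xy | B (xy.1.1, xy.2.1)] => //.
apply/ent_prodP; exists B, setT; split => //; exact: entourageT.
Qed.

Lemma uc_snd (U V : uniformType) :
  unif_continuous (fun x : U * V => x.2).
Proof.
apply/ucP => B eB.
exists [set xy | B (xy.1.2, xy.2.2)] => //.
apply/ent_prodP; exists setT, B; split => //; exact: entourageT.
Qed.

Lemma uc_pair (T U V : uniformType) (f : T -> U) (g : T -> V) :
  unif_continuous f -> unif_continuous g ->
  unif_continuous (fun x => (f x, g x)).
Proof.
move=> /ucP fc /ucP gc; apply/ucP => E /ent_prodP[A [B [eA eB AB]]].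
have [A' eA' fA] := fc _ eA; have [B' eB' gB] := gc _ eB.
exists (A' `&` B'); first exact: filterI.
by move=> x y [? ?]; apply: AB; [exact: fA|exact: gB].
Qed.

Lemma uc_comp2 (T U V W : uniformType) (h : U -> V -> W) (f : T -> U) (g : T -> V) :
  unif_continuous (fun z : U * V => h z.1 z.2) ->
  unif_continuous f -> unif_continuous g -> unif_continuous (fun x => h (f x) (g x)).
Proof. by move=> hc fc gc; exact: (uc_comp hc (uc_pair fc gc)). Qed.

Lemma uc_comp1 (S U V : uniformType) (f : S -> U) :
  unif_continuous f -> unif_continuous (fun x : S * V => (f x.1, x.2)).
Proof.
by move=> fc; exact: (uc_pair (uc_comp fc (@uc_fst S V)) (@uc_snd S V)).
Qed.

Lemma uc_slice (U V W : uniformType) (h : U * V -> W) (v : V) :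
  unif_continuous h -> unif_continuous (fun x => h (x, v)).
Proof.
by move=> hc; exact: (uc_comp hc (uc_pair (@uc_id U) (@uc_cst U V v))).
Qed.

Lemma uc_set_val (U : uniformType) (A : set U) :
  unif_continuous (set_val : A -> U).
Proof.
by apply/ucP => B eB; exists [set xy | B (set_val xy.1, set_val xy.2)] => //; exists B.
Qed.

Lemma uc_set_valP (U V : uniformType) (A : set U) (f : V -> A) :
  unif_continuous f <-> unif_continuous (fun x => set_val (f x)).
Proof.
split=> [|/ucP fc]; first exact: uc_comp (@uc_set_val _ _).
apply/ucP => B [C eC CB]; have [D eD DC] := fc _ eC.
by exists D => // x y /DC ?; exact: CB.
Qed.

(** An entourage can be halved, so the two variables may be moved one at a time. *)
Lemma uc_prodP (U V W : uniformType) (h : U * V -> W) :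
  unif_continuous h <-> forall C, entourage C ->
   (exists2 A, entourage A & forall x x' y, A (x, x') -> C (h (x, y), h (x', y)))
   /\ (exists2 B, entourage B &
         forall x y y', B (y, y') -> C (h (x, y), h (x, y'))).
Proof.
split=> [/ucP hc C /hc[E /ent_prodP[A [B [eA eB AB]]] EC]|hc].
  split; [exists A => // x x' y xx|exists B => // x y y' yy];
    by apply/EC/AB => //; exact: entourage_refl.
apply/ucP => D /ent_trans[C eC CD].
have [[A eA AC] [B eB BC]] := hc _ eC.
exists [set z | A (z.1.1, z.2.1) /\ B (z.1.2, z.2.2)].
  exact: prod_entP.
move=> [x y] [x' y'] /= [xx yy].
exact: CD (AC _ _ y xx) (BC x' _ _ yy).
Qed.

End uniform_maps.

Section real_valued.
Variable R : realType.

Lemma entRP (B : set (R * R)) : entourage B <->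
  exists2 e : R, 0 < e & forall x y, `|x - y| < e -> B (x, y).
Proof.
rewrite -entourage_ballE; split=> [[e e0 eB]|[e e0 eB]].
  by exists e => // x y xy; exact: eB.
by exists e => // -[x y] /= xy; apply: eB; move: xy; rewrite /ball/=.
Qed.

Lemma ucRP (U : uniformType) (f : U -> R) : unif_continuous f <->
  forall e, 0 < e -> exists2 A, entourage A &
    forall x y, A (x, y) -> `|f x - f y| < e.
Proof.
split=> [/ucP fc e e0|fc].
  have [|A eA AB] := fc [set z | `|z.1 - z.2| < e]; first by apply/entRP; exists e.
  by exists A => // x y /AB.
by apply/ucP => B /entRP[e /fc[A eA Ae] eB]; exists A => // x y /Ae /eB.
Qed.

Lemma uc_lip (U : uniformType) (f g h : U -> R) (a : R) :
  unif_continuous g -> unif_continuous h ->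
  (forall x y, `|f x - f y| <= a * (`|g x - g y| + `|h x - h y|)) ->
  unif_continuous f.
Proof.
move=> /ucRP gc /ucRP hc fgh; apply/ucRP => e e0.
have a0 : 0 < `|a| + 1 by rewrite ltr_wpDl.
have d0 : 0 < e / (`|a| + 1) / 2 by rewrite divr_gt0 // divr_gt0.
have [A eA Ag] := gc _ d0; have [B eB Bh] := hc _ d0.
exists (A `&` B); first exact: filterI.
move=> x y [/Ag xy /Bh xy']; apply: le_lt_trans (fgh x y) _.
apply: (@le_lt_trans _ _ ((`|a| + 1) * (`|g x - g y| + `|h x - h y|))).
  apply: ler_wpM2r; first by rewrite addr_ge0.
  by apply: le_trans (ler_norm a) _; rewrite lerDl.
by rewrite mulrC -ltr_pdivlMr // [ltRHS]splitr ltrD.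
Qed.

Lemma uc_add (U : uniformType) (f g : U -> R) :
  unif_continuous f -> unif_continuous g -> unif_continuous (fun x => f x + g x).
Proof.
move=> fc gc; apply: (uc_lip (a := 1) fc gc) => x y; rewrite mul1r.
by rewrite [X in `|X|](_ : _ = (f x - f y) + (g x - g y)) ?ler_normD //; ring.
Qed.

Lemma uc_scale (U : uniformType) (f : U -> R) (a : R) :
  unif_continuous f -> unif_continuous (fun x => a * f x).
Proof.
move=> fc; apply: (uc_lip (a := `|a|) fc (uc_cst _ (0 : R))) => x y.
by rewrite subrr normr0 addr0 -mulrBr normrM.
Qed.

Lemma uc_opp (U : uniformType) (f : U -> R) :
  unif_continuous f -> unif_continuous (fun x => - f x).
Proof.
move=> fc; apply: (uc_lip (a := 1) fc (uc_cst _ (0 : R))) => x y.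
by rewrite subrr normr0 addr0 mul1r -opprD normrN.
Qed.

Lemma uc_sub (U : uniformType) (f g : U -> R) :
  unif_continuous f -> unif_continuous g -> unif_continuous (fun x => f x - g x).
Proof. by move=> fc gc; apply: uc_add fc _; exact: uc_opp. Qed.

Lemma uc_max (U : uniformType) (f g : U -> R) :
  unif_continuous f -> unif_continuous g ->
  unif_continuous (fun x => Num.max (f x) (g x)).
Proof.
move=> fc gc; apply: (uc_lip (a := 1) fc gc) => x y; rewrite mul1r.
have := ler_norm (f x - f y); have := ler_norm (g x - g y).
have := ler_norm (f y - f x); have := ler_norm (g y - g x).
rewrite (distrC (f y)) (distrC (g y)) ler_norml.
move=> h1 h2 h3 h4; case: (leP (f x) (g x)) => ?; case: (leP (f y) (g y)) => ?; apply/andP; split; lra.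
Qed.

Lemma uc_min (U : uniformType) (f g : U -> R) :
  unif_continuous f -> unif_continuous g ->
  unif_continuous (fun x => Num.min (f x) (g x)).
Proof.
move=> fc gc.
have -> : (fun x => Num.min (f x) (g x)) = (fun x => - Num.max (- f x) (- g x)).
  by apply/funext => x; rewrite -oppr_min opprK.
by apply: uc_opp; apply: uc_max; exact: uc_opp.
Qed.

Lemma uc_mul (U : uniformType) (f g : U -> R) (a : R) :
  (forall x, `|f x| <= a) -> (forall x, `|g x| <= a) ->
  unif_continuous f -> unif_continuous g -> unif_continuous (fun x => f x * g x).
Proof.
move=> fa ga fc gc; apply: (uc_lip (a := a) fc gc) => x y.
rewrite [X in `|X|](_ : _ = (f x - f y) * g x + f y * (g x - g y)); last by ring.
apply: le_trans (ler_normD _ _) _; rewrite !normrM mulrDr [a * `|f _ - _|]mulrC.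
by apply: lerD; [apply: ler_wpM2l|apply: ler_wpM2r].
Qed.

End real_valued.


(** * Inverse limits, quotients and the unit interval *)

Section inverse_limits.
Variables (Z : nat -> uniformType) (g : forall i, Z i.+1 -> Z i).

Lemma uc_invlim_proj i : unif_continuous (@invlim_proj Z g i).
Proof.
suff pc : unif_continuous (fun x : prod_topology Z => x i).
  exact: (uc_comp pc (@uc_set_val _ _)).
apply/ucP => B eB.
exists [set xy | B (xy.1 i, xy.2 i)] => //.
have eC : @entourage (initial_topology (@proj _ Z i)) [set xy | B (xy.1 i, xy.2 i)].
  by exists B.
pose p : {classic nat} * set (prod_topology Z * prod_topology Z) :=
  (i, [set xy | B (xy.1 i, xy.2 i)]).
have pP : `[< @entourage (initial_topology (@proj _ Z p.1)) p.2 >] by apply/asboolP.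
exists [set xy | B (xy.1 i, xy.2 i)] => //.
exists [fset (exist _ p pP)]%fset; first by move=> ? _; rewrite inE.
rewrite predeqE => -[x y]; split => [/(_ (exist _ p pP))|Bxy q].
  by apply; rewrite /= inE.
by rewrite /= inE => /eqP ->.
Qed.

Hypothesis gc : forall i, unif_continuous (@g i).

Lemma uc_bond i j (h : (i <= j)%N) : unif_continuous (bond g h).
Proof.
elim: j h => [|j ih] h.
  have i0 : i = 0%N by apply/eqP; rewrite -leqn0.
  subst i; rewrite (_ : bond g h = id); first exact: uc_id.
  by apply/funext => x; rewrite bond_refl.
have [ij|ji] := leqP i j.
  rewrite (_ : bond g h = fun x => bond g ij (g x)); first exact: (uc_comp (ih ij) (@gc j)).
  by apply/funext => x; rewrite (bondS g ij).
have ij : i = j.+1 by apply/eqP; rewrite eqn_leq h ji.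
subst i; rewrite (_ : bond g h = id); first exact: uc_id.
by apply/funext => x; rewrite bond_refl.
Qed.

(** The terms of the sequence are directed by the bonding maps, so the finite
    intersections in the product uniformity collapse to conditions on a single
    term. *)
Lemma invlim_entP (E : set (invlim g * invlim g)) : entourage E <->
  exists m B, entourage B /\
    forall x y, B (invlim_proj m x, invlim_proj m y) -> E (x, y).
Proof.
split=> [|[m [B [eB BE]]]]; last first.
  have /ucP/(_ _ eB)[A eA AB] := @uc_invlim_proj m.
  by apply: filterS eA => -[x y] /AB /BE.
pose G : set_system (prod_topology Z * prod_topology Z) := [set A | exists m B,
  entourage B /\ forall x y : invlim g,
    B (invlim_proj m x, invlim_proj m y) -> A (set_val x, set_val y)].
have FG : Filter G.
  split.
  - by exists 0%N, setT; split => //; exact: entourageT.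
  - move=> P Q [m [B [eB BP]]] [n [C [eC CQ]]].
    have /ucP/(_ _ eB)[B' eB' B'B] := uc_bond (leq_maxl m n).
    have /ucP/(_ _ eC)[C' eC' C'C] := uc_bond (leq_maxr m n).
    exists (maxn m n), (B' `&` C'); split; first exact: filterI.
    move=> x y [/B'B + /C'C]; rewrite !invlim_bond => xy xy'.
    by split; [exact: BP|exact: CQ].
  - by move=> P Q PQ [m [B [eB BP]]]; exists m, B; split => // x y /BP /PQ.
suff GE A : entourage A -> G A.
  by move=> [A /GE[m [B [eB BA]]] AE]; exists m, B; split=> // x y /BA ?; exact: AE.
move=> [D [F _ <-] DA]; apply: (filterS DA).
apply: filter_bigI => -[[i C]] /= /asboolP [B eB BC] _.
by exists i, B; split => // x y xy; exact: BC.
Qed.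

Lemma uc_invlimP (T : uniformType) (f : T -> invlim g) :
  unif_continuous f <-> forall m, unif_continuous (fun x => invlim_proj m (f x)).
Proof.
split=> [fc m|fc]; first by exact: (uc_comp (@uc_invlim_proj m) fc).
apply/ucP => E /invlim_entP[m [B [eB BE]]].
have /ucP/(_ _ eB)[A eA AB] := fc m.
by exists A => // x y /AB /BE.
Qed.

Lemma invlim_eqP (x y : invlim g) :
  (forall m, invlim_proj m x = invlim_proj m y) -> x = y.
Proof.
by move=> xy; apply: val_inj; apply: functional_extensionality_dep => m; exact: xy.
Qed.

End inverse_limits.

Section quotients.

(** The quotient uniformity is the finest possible one, hence finer than that of
    uniform closeness of the maps [fun k => H (q, k)]. Thus homotopies, and other
    families of maps out of a quotient, can be constructed before passing to the
    quotient. *)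
Lemma uc_uquot (T : uniformType) (r : T -> T -> Prop) (K S : uniformType)
    (H : uquot r * K -> S) :
  unif_continuous (fun z : T * K => H (uquot_pi r z.1, z.2)) ->
  unif_continuous H.
Proof.
move=> /uc_prodP Hc; apply/uc_prodP => C eC.
have [[A eA AC] [B eB BC]] := Hc _ eC.
split; last by exists B => // q k k' kk; elim/uquot_ind: q => x; exact: (BC x).
exists [set z | forall k, C (H (z.1, k), H (z.2, k))]; last by move=> x x' y; exact.
exists [set P | exists2 D, entourage D & forall x y,
  (forall k, D (H (x, k), H (y, k))) -> P (x, y)]; split; last by exists C.
- split; first split.
  + by exists setT => //; exact: entourageT.
  + move=> P Q [D eD DP] [E eE EQ]; exists (D `&` E); first exact: filterI.
    by move=> x y DE; split; [apply: DP|apply: EQ] => k; have [] := DE k.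
  + by move=> P Q PQ [D eD DP]; exists D => // x y /DP /PQ.
  + move=> P [D eD DP] [x y] /= xy; rewrite /diagonal/= in xy; rewrite -xy.
    by apply: DP => k; exact: entourage_refl.
  + move=> P [D eD DP]; exists (D^-1)%relation; first exact: entourage_inv.
    by move=> x y xy; exact: DP.
  + move=> P [D eD DP]; have [E eE ED] := ent_trans eD.
    exists [set z | forall k, E (H (z.1, k), H (z.2, k))]; first by exists E.
    move=> [x y] [z] /= xz zy; apply: DP => k; exact: ED (xz k) (zy k).
- move=> P [D eD DP]; have [[A' eA' A'D] _] := Hc _ eD.
  by apply: filterS eA' => -[x y] xy; apply: DP => k; exact: (A'D x y k).
Qed.

Lemma uc_sum (S T K W : uniformType) (H : (S + T) * K -> W) :
  unif_continuous (fun z : S * K => H (inl z.1, z.2)) ->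
  unif_continuous (fun z : T * K => H (inr z.1, z.2)) ->
  unif_continuous H.
Proof.
move=> /uc_prodP Hl /uc_prodP Hr; apply/uc_prodP => C eC.
have [[A eA AC] [B eB BC]] := Hl _ eC; have [[A' eA' AC'] [B' eB' BC']] := Hr _ eC.
split; last first.
  exists (B `&` B'); first exact: filterI.
  by move=> [x|x] y y' [? ?]; [exact: (BC x)|exact: (BC' x)].
exists [set z | match z with
  | (inl x, inl y) => A (x, y) | (inr x, inr y) => A' (x, y) | _ => False end].
  by split; [apply: filterS eA|apply: filterS eA'] => -[].
by move=> [x|x] [x'|x'] y //= xx; [exact: (AC x)|exact: (AC' x)].
Qed.

Lemma uc_inl (S T : uniformType) : unif_continuous (inl : S -> (S + T)%type).
Proof. by move=> B []. Qed.

Lemma uc_inr (S T : uniformType) : unif_continuous (inr : T -> (S + T)%type).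
Proof. by move=> B []. Qed.

Lemma uc_amalgam (C A B K S : uniformType) (a : C -> A) (b : C -> B)
    (H : amalgam a b * K -> S) :
  unif_continuous (fun z : A * K => H (amalgam_inl a b z.1, z.2)) ->
  unif_continuous (fun z : B * K => H (amalgam_inr a b z.1, z.2)) ->
  unif_continuous H.
Proof. by move=> Hl Hr; apply: uc_uquot; exact: uc_sum. Qed.

Lemma uc_MC (R : realType) (P Q K S : uniformType) (g : P -> Q)
    (H : MC R g * K -> S) :
  unif_continuous (fun z : P * unitI R * K =>
    H (uquot_pi (MC_rel g) (inl z.1), z.2)) ->
  unif_continuous (fun z : Q * K => H (MC_rng R g z.1, z.2)) ->
  unif_continuous H.
Proof. by move=> Hl Hr; apply: uc_uquot; exact: uc_sum. Qed.

Lemma MC_ind (R : realType) (P Q : uniformType) (g : P -> Q) (A : MC R g -> Prop) :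
  (forall x, A (uquot_pi (MC_rel g) (inl x))) -> (forall y, A (MC_rng R g y)) ->
  forall c, A c.
Proof. by move=> Al Ar; elim/uquot_ind => -[x|y]; [exact: Al|exact: Ar]. Qed.

End quotients.

Section interval.
Variable R : realType.

Lemma clip_subproof (x : R) :
  Num.max 0 (Num.min 1 x) \in (`[0%R, 1%R]%classic : set R).
Proof.
by rewrite inE /= in_itv /= le_max lexx /= ge_max ler01 ge_min lexx.
Qed.

Definition clip (x : R) : unitI R := SigSub (clip_subproof x).

Lemma uc_clip : unif_continuous clip.
Proof.
apply/uc_set_valP; apply: uc_max (uc_cst _ _) _.
by apply: uc_min (uc_cst _ _) _; exact: uc_id.
Qed.

Lemma clipE x : set_val (clip x) = Num.max 0 (Num.min 1 x).
Proof. by []. Qed.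

Lemma clip_val x : 0 <= x <= 1 -> set_val (clip x) = x.
Proof. by move=> /andP[x0 x1]; rewrite clipE min_r // max_r. Qed.

Lemma unitI_ge0 (t : unitI R) : 0 <= set_val t.
Proof. by have := set_valP t; rewrite /= in_itv /= => /andP[]. Qed.

Lemma unitI_le1 (t : unitI R) : set_val t <= 1.
Proof. by have := set_valP t; rewrite /= in_itv /= => /andP[]. Qed.

Lemma clipK (t : unitI R) : clip (set_val t) = t.
Proof. by apply: val_inj; apply: clip_val; rewrite unitI_ge0 unitI_le1. Qed.

Lemma clip_le0 x : x <= 0 -> clip x = unitI0 R.
Proof.
move=> x0; apply: val_inj; rewrite [LHS]clipE min_r ?max_l //.
exact: le_trans x0 ler01.
Qed.

Lemma clip_ge1 x : 1 <= x -> clip x = unitI1 R.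
Proof. by move=> x1; apply: val_inj; rewrite [LHS]clipE min_l // max_r. Qed.

(** Two points on different sides of the cut are compared through the point at
    the cut. *)
Lemma uc_glue (P S : uniformType) (f : P * R -> S) (c : R) :
  unif_continuous (fun z : P * R => f (z.1, Num.min z.2 c)) ->
  unif_continuous (fun z : P * R => f (z.1, Num.max z.2 c)) ->
  unif_continuous f.
Proof.
move=> /uc_prodP fl /uc_prodP fr; apply/uc_prodP => C /ent_trans[D eD DC].
have [[A eA AC] [B eB BC]] := fl _ eD; have [[A' eA' AC'] [B' eB' BC']] := fr _ eD.
have sDC x y : D (x, y) -> C (x, y).
  by move=> xy; apply: (DC x y y) => //; exact: entourage_refl.
split.
  exists (A `&` A'); first exact: filterI.
  move=> x x' r [xA xA']; move: (AC x x' r xA) (AC' x x' r xA') => /=.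
  by case: (leP r c) => [?|?]; [move=> /sDC|move=> _ /sDC].
exists (B `&` B'); first exact: filterI.
move=> x r r' [rB rB']; move: (BC x r r' rB) (BC' x r r' rB') => /=.
case: (leP r c) => rc; case: (leP r' c) => rc'; first by move=> /sDC.
- exact: DC.
- by move=> h1 h2; exact: DC h2 h1.
- by move=> _ /sDC.
Qed.

End interval.


(** * Points of the mapping telescopes *)

Section telescope_geometry.
Variables (R : realType) (Z : nat -> uniformType).
Variable g : forall i, Z i.+1 -> Z i.

Local Notation tel := (tel R g).
Local Notation xtel := (xtel R g).

(** The coordinate [t] runs downwards, from the end [Z m.+1] to the end [Z m]. *)
Definition cyl m (x : Z m.+1) (t : unitI R) : tel m.+1 :=
  tel_inr (uquot_pi (MC_rel (@g m)) (inl (x, t))).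

Lemma cyl0 m (x : Z m.+1) : cyl x (unitI0 R) = tel_incl R g x.
Proof. by []. Qed.

Lemma cyl1 m (x : Z m.+1) : cyl x (unitI1 R) = tel_inl (tel_incl R g (g x)).
Proof.
by rewrite tel_glue; congr tel_inr; apply: uquot_piP; exists x.
Qed.

Lemma tel_cyl_ind m (P : tel m.+1 -> Prop) :
  (forall w, P (tel_inl w)) -> (forall x t, P (cyl x t)) -> forall w, P w.
Proof.
move=> Pl Pc; elim/tel_ind => // c; elim/MC_ind: c => [[x t]|y]; first exact: Pc.
by rewrite -tel_glue.
Qed.

Lemma tel_retr_cyl m (x : Z m.+1) t : tel_retr (cyl x t) = tel_incl R g (g x).
Proof.
rewrite tel_retr_inr; congr tel_incl.
by rewrite /MC_collapse uquot_liftE // => ? ? [y [-> ->]].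
Qed.

Lemma MC_height_rng (P Q : uniformType) (h : P -> Q) y :
  MC_height (MC_rng R h y) = 0.
Proof. by rewrite /MC_height uquot_liftE // => ? ? [z [-> ->]] /=; rewrite subrr. Qed.

Lemma MC_height_cyl (P Q : uniformType) (h : P -> Q) x (t : unitI R) :
  MC_height (uquot_pi (MC_rel h) (inl (x, t))) = 1 - set_val t.
Proof. by rewrite /MC_height uquot_liftE // => ? ? [z [-> ->]] /=; rewrite subrr. Qed.

Lemma tel_level_incl m (x : Z m) : tel_level (tel_incl R g x) = m%:R.
Proof.
elim: m x => [//|m ih] x; rewrite -cyl0.
rewrite [LHS]amalgam_case_inr ?MC_height_cyl /= ?subr0 ?natr1 // => c.
by rewrite MC_height_rng addr0; exact: ih.
Qed.

Lemma tel_level_inl m (w : tel m) : tel_level (tel_inl w) = tel_level w.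
Proof.
by apply: amalgam_case_inl => c; rewrite MC_height_rng addr0; exact: tel_level_incl.
Qed.

Lemma tel_level_cyl m (x : Z m.+1) t :
  tel_level (cyl x t) = m.+1%:R - set_val t.
Proof.
rewrite [LHS]amalgam_case_inr ?MC_height_cyl; first by rewrite -natr1 addrA.
by move=> c; rewrite MC_height_rng addr0; exact: tel_level_incl.
Qed.

Lemma tel_level_itv m (w : tel m) : 0 <= tel_level w <= m%:R.
Proof.
elim: m w => [w|m ih w]; first by rewrite /= lexx.
elim/tel_cyl_ind: w => [w|x t].
  rewrite tel_level_inl; have /andP[-> /=] := ih w => /le_trans; apply.
  by rewrite ler_nat.
rewrite tel_level_cyl gerBl unitI_ge0 andbT subr_ge0.
by apply: le_trans (unitI_le1 t) _; rewrite ler1n.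
Qed.

Lemma tel_level_retr m (w : tel m.+1) :
  tel_level (tel_retr w) = Num.min (tel_level w) m%:R.
Proof.
elim/tel_cyl_ind: w => [w|x t].
  rewrite tel_retr_inl tel_level_inl min_l //.
  by have /andP[] := tel_level_itv w.
rewrite tel_retr_cyl tel_level_incl tel_level_cyl min_r // -natr1.
by have := unitI_le1 t; lra.
Qed.

Lemma tel_level_top m (w : tel m) : m%:R <= tel_level w ->
  exists x, w = tel_incl R g x.
Proof.
case: m w => [|m] w; first by exists w.
elim/tel_cyl_ind: w => [w|x t].
  rewrite tel_level_inl => mw; have /andP[_ wm] := tel_level_itv w.
  by have := le_trans mw wm; rewrite ler_nat ltnn.
rewrite tel_level_cyl => mt; exists x; rewrite -cyl0; congr cyl.
apply: val_inj; apply/eqP; rewrite eq_le [X in _ && X]unitI_ge0 andbT.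
by change (set_val t <= 0); lra.
Qed.

(** The points off the range end of a mapping cylinder have a well-defined
    domain coordinate; this separates the points of the domain end. *)
Definition MC_fiber (P Q : uniformType) (h : P -> Q) : MC R h -> option P :=
  @uquot_lift _ (MC_rel h) _ (fun u => if u is inl (x, t) then
    if set_val t < 1 then Some x else None else None).

Lemma tel_incl_inj m : injective (@tel_incl R Z g m).
Proof.
case: m => [//|m] x y; rewrite -!cyl0.
have fE : forall c, amalgam_case (fun=> None) (@MC_fiber _ _ (@g m))
    (tel_inr c) = MC_fiber c.
  move=> c; apply: amalgam_case_inr => z.
  by rewrite /MC_fiber uquot_liftE // => ? ? [u [-> ->]] /=; rewrite ltxx.
move=> /(congr1 (amalgam_case (fun=> None) (@MC_fiber _ _ (@g m)))).
rewrite !fE /MC_fiber !uquot_liftE /= ?ltr01 => [[]//||];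
  by move=> ? ? [u [-> ->]] /=; rewrite ltxx.
Qed.

(** The path down the telescope which starts at [x], parametrized by the level;
    levels above [m] are cut down to [m]. *)
Fixpoint track m (x : Z m) (s : R) : tel m :=
  match m return Z m -> tel m with
  | 0 => fun x => x
  | k.+1 => fun x => if s <= k%:R then tel_inl (track (g x) s)
                     else cyl x (clip (k.+1%:R - s))
  end x.

Lemma track_full m (x : Z m) s : m%:R <= s -> track x s = tel_incl R g x.
Proof.
case: m x => [//|m] x ms /=; rewrite ifF ?clip_le0 ?subr_le0 //.
by apply/negbTE; rewrite -ltNge (lt_le_trans _ ms) // ltr_nat.
Qed.

Lemma track_lo m (x : Z m.+1) s : s <= m%:R -> track x s = tel_inl (track (g x) s).
Proof. by move=> /= ->. Qed.

Lemma track_hi m (x : Z m.+1) s : m%:R <= s ->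
  track x s = cyl x (clip (m.+1%:R - s)).
Proof.
move=> /= ms; case: ifP => // sm; have -> : s = m%:R by apply/le_anti/andP.
by rewrite track_full // clip_ge1 ?cyl1 // -natr1 addrAC subrr add0r.
Qed.

Lemma track_retr m (x : Z m.+1) s : tel_retr (track x s) = track (g x) s.
Proof.
have [sm|ms] := leP s m%:R; first by rewrite track_lo // tel_retr_inl.
by rewrite track_hi 1?ltW // tel_retr_cyl track_full // ltW.
Qed.

Lemma tel_level_track m (x : Z m) s : 0 <= s ->
  tel_level (track x s) = Num.min s m%:R.
Proof.
elim: m x => [|m ih] x s0; first by rewrite min_r.
have [sm|ms] := leP s m%:R.
  by rewrite track_lo // tel_level_inl ih // !min_l // (le_trans sm) // ler_nat.
rewrite track_hi 1?ltW // tel_level_cyl.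
have [sm1|ms1] := leP s m.+1%:R.
  rewrite clip_val; first by rewrite opprB addrC subrK.
  by move: sm1; rewrite -natr1 => sm1; apply/andP; split; lra.
by rewrite clip_le0 /= ?subr0 // subr_le0 ltW.
Qed.

Lemma bond_track i j (h : (i <= j)%N) (x : Z j) s :
  bond (@tel_retr R Z g) h (track x s) = track (bond g h x) s.
Proof.
elim: j h x => [|j ih] h x.
  have i0 : i = 0%N by apply/eqP; rewrite -leqn0.
  by subst i; rewrite !bond_refl.
have [ij|ji] := leqP i j; first by rewrite !(bondS _ ij) track_retr ih.
have ij : i = j.+1 by apply/eqP; rewrite eqn_leq h ji.
by subst i; rewrite !bond_refl.
Qed.

(** Stated by transport of predicates along the inclusions, because the index of
    the term over which [w] lies may be smaller than [m]. *)
Lemma tel_track m (w : tel m) : exists j (x : Z j) s,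
  [/\ 0 <= s <= j%:R, (j <= m)%N & forall (P : forall i, tel i -> Prop),
    (forall i v, P i v -> P i.+1 (tel_inl v)) -> P j (track x s) -> P m w].
Proof.
elim: m w => [w|m ih w].
  by exists 0%N, w, 0; split => //; rewrite lexx.
elim/tel_cyl_ind: w => [w|x t].
  have [j [x [s [sj jm wx]]]] := ih w; exists j, x, s; split => //.
    exact: leqW.
  by move=> P PS Px; exact: PS (wx P PS Px).
have t0 := unitI_ge0 t; have t1 := unitI_le1 t.
exists m.+1, x, (m.+1%:R - set_val t); split=> //.
  by have := ler0n R m; rewrite -natr1; lra.
move=> P _; rewrite track_hi; last by rewrite -natr1; lra.
by rewrite opprB addrC subrK clipK.
Qed.

Fixpoint emb_fun j (w : tel j) (m : nat) : tel m :=
  match m with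
  | 0 => bond (@tel_retr R Z g) (leq0n j) w
  | k.+1 => match decP (@idP (k.+1 <= j)%N) with
            | left h => bond (@tel_retr R Z g) h w
            | right _ => tel_inl (emb_fun w k)
            end
  end.

Lemma emb_fun_le j (w : tel j) m (h : (m <= j)%N) :
  emb_fun w m = bond (@tel_retr R Z g) h w.
Proof.
case: m h => [|m] h /=; first by rewrite (eq_irrelevance h (leq0n j)).
by case: decP => // h'; rewrite (eq_irrelevance h h').
Qed.

Lemma emb_fun_gt j (w : tel j) m : (j <= m)%N ->
  emb_fun w m.+1 = tel_inl (emb_fun w m).
Proof. by move=> jm /=; case: decP => // h; have := h; rewrite ltnNge jm. Qed.

Lemma emb_subproof j (w : tel j) : invlim_set (@tel_retr R Z g) (emb_fun w).
Proof.
move=> m; have [mj|jm] := leqP m.+1 j; last first.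
  by rewrite emb_fun_gt // tel_retr_inl.
rewrite (emb_fun_le _ mj) (emb_fun_le _ (ltnW mj)).
rewrite -(bond_comp _ (leqnSn m) mj); set v := bond _ mj w.
by rewrite (bondS _ (leqnn m)) bond_refl.
Qed.

(** The inclusion of a finite telescope into the extended one: the coordinates
    are retractions of [w] below [j] and copies of [w] above. *)
Definition emb j (w : tel j) : xtel := invlim_mk (@emb_subproof j w).

Lemma proj_emb_le j (w : tel j) m (h : (m <= j)%N) :
  invlim_proj m (emb w) = bond (@tel_retr R Z g) h w.
Proof. by rewrite invlim_projE; exact: emb_fun_le. Qed.

Lemma proj_emb j (w : tel j) : invlim_proj j (emb w) = w.
Proof. by rewrite (proj_emb_le w (leqnn j)) bond_refl. Qed.

Lemma proj_emb_gt j (w : tel j) m : (j <= m)%N ->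
  invlim_proj m.+1 (emb w) = tel_inl (invlim_proj m (emb w)).
Proof. by move=> jm; rewrite !invlim_projE; exact: emb_fun_gt. Qed.

Lemma emb_unique j (w : tel j) (v : xtel) : invlim_proj j v = w ->
  (forall m, (j <= m)%N -> invlim_proj m.+1 v = tel_inl (invlim_proj m v)) ->
  v = emb w.
Proof.
move=> vj vm; apply: invlim_eqP => m; have [mj|/ltnW jm] := leqP m j.
  by rewrite (proj_emb_le w mj) -vj invlim_bond.
rewrite -(subnK jm); elim: (m - j)%N => [|k ih]; first by rewrite proj_emb.
by rewrite addSn vm ?leq_addl // proj_emb_gt ?leq_addl // ih.
Qed.

Lemma emb_inl j (w : tel j) : emb (tel_inl w) = emb w.
Proof.
symmetry; apply: emb_unique; first by rewrite proj_emb_gt // proj_emb.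
by move=> m jm; rewrite proj_emb_gt // ltnW.
Qed.

Definition pt j (x : Z j) (s : R) : xtel := emb (track x s).

Lemma proj_pt j (x : Z j) s m (h : (m <= j)%N) :
  invlim_proj m (pt x s) = track (bond g h x) s.
Proof. by rewrite (proj_emb_le _ h) bond_track. Qed.

Lemma proj_pt_hi j (x : Z j) s m (h : (m <= j)%N) : m%:R <= s ->
  invlim_proj m (pt x s) = tel_incl R g (bond g h x).
Proof. by move=> ms; rewrite proj_pt track_full. Qed.

Lemma pt_bond i j (h : (i <= j)%N) (x : Z j) s : s <= i%:R ->
  pt x s = pt (bond g h x) s.
Proof.
move=> si; elim: j h x => [|j ih] h x.
  have i0 : i = 0%N by apply/eqP; rewrite -leqn0.
  by subst i; rewrite !bond_refl.
have [ij|ji] := leqP i j.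
  rewrite (bondS _ ij) -ih /pt track_lo ?emb_inl // (le_trans si) //.
  by rewrite ler_nat.
have ij : i = j.+1 by apply/eqP; rewrite eqn_leq h ji.
by subst i; rewrite !bond_refl.
Qed.

Lemma ptS j (x : Z j.+1) s : s <= j%:R -> pt x s = pt (g x) s.
Proof. by move=> sj; rewrite /pt track_lo // emb_inl. Qed.

Lemma emb_pt j (w : tel j) : exists k (x : Z k) s,
  0 <= s <= k%:R /\ emb w = pt x s.
Proof.
have [k [x [s [sk _ wP]]]] := tel_track w; exists k, x, s; split => //.
by apply: (wP (fun i v => emb v = pt x s)) => // i v; rewrite emb_inl.
Qed.

Lemma tel_level_proj (w : xtel) m n : (m <= n)%N ->
  tel_level (invlim_proj m w) = Num.min (tel_level (invlim_proj n w)) m%:R.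
Proof.
elim: n => [|n ih].
  by rewrite leqn0 => /eqP ->; rewrite min_l //; have /andP[] := tel_level_itv (invlim_proj 0 w).
rewrite leq_eqVlt => /predU1P[->|].
  by rewrite min_l //; have /andP[] := tel_level_itv (invlim_proj n.+1 w).
rewrite ltnS => mn; rewrite ih // -invlim_projP tel_level_retr -minA; congr Num.min.
by rewrite min_r // ler_nat.
Qed.

Lemma xtel_level_fin (w : xtel) m : tel_level (invlim_proj m w) < m%:R ->
  xtel_level w = (tel_level (invlim_proj m w))%:E.
Proof.
move=> wm; apply/eqP; rewrite eq_le; apply/andP; split; last first.
  by apply: ereal_sup_ubound; exists m.
apply: ub_ereal_sup => _ [n _ <-]; rewrite lee_fin.
have [nm|/ltnW mn] := leqP n m; first by rewrite (tel_level_proj w nm) ge_min lexx.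
have := tel_level_proj w mn; have [//|_ mE] := leP (tel_level (invlim_proj n w)) m%:R.
  by move=> _ ->.
by rewrite mE ltxx in wm.
Qed.

Lemma xtel_level_ge (w : xtel) m : (m%:R%:E <= xtel_level w)%E =
  (m%:R <= tel_level (invlim_proj m w)).
Proof.
apply/idP/idP => [|mw]; last first.
  apply: (@le_trans _ _ (tel_level (invlim_proj m w))%:E); first by rewrite lee_fin.
  by apply: ereal_sup_ubound; exists m.
by apply: contraTT; rewrite -!ltNge => wm; rewrite (xtel_level_fin wm) lte_fin.
Qed.

Lemma xtel_level_proj (w : xtel) m s : xtel_level w = s%:E ->
  tel_level (invlim_proj m w) = Num.min s m%:R.
Proof.
move=> ws; have [wm|mw] := ltP (tel_level (invlim_proj m w)) m%:R.
  by move: (xtel_level_fin wm); rewrite ws => -[->]; rewrite min_l // ltW.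
have : (m%:R%:E <= xtel_level w)%E by rewrite xtel_level_ge.
rewrite ws lee_fin => ms; rewrite min_r //; apply/le_anti; rewrite mw andbT.
by have /andP[] := tel_level_itv (invlim_proj m w).
Qed.

Lemma xtel_level_lim (x : invlim g) : xtel_level (xtel_lim R x) = +oo%E.
Proof.
case E : (xtel_level _) => [s||] //.
  have := xtel_level_ge (xtel_lim R x) (Num.bound `|s|).
  rewrite E lee_fin tel_level_incl lexx => bs.
  have := le_lt_trans (ler_norm s) (archi_boundP (normr_ge0 s)).
  by rewrite ltNge bs.
by have := xtel_level_ge (xtel_lim R x) 0; rewrite E tel_level_incl lexx.
Qed.

End telescope_geometry.


(** * Uniform continuity of the telescope operations *)

Section metrics.
Variable R : realType.

Definition bounded_metric (T : uniformType) (d : T -> T -> R) : Prop :=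
  [/\ forall x y, d x y = 0 <-> x = y, forall x y, d x y = d y x,
    forall x y z, d x z <= d x y + d y z, forall x y, 0 <= d x y <= 1 &
    forall E : set (T * T), entourage E <->
      exists2 e, 0 < e & forall x y, d x y < e -> E (x, y)].

Lemma metrizable_bounded (T : uniformType) : metrizable R T ->
  exists d : T -> T -> R, bounded_metric d.
Proof.
move=> [d [d0 dC dD dE]]; exists (fun x y => Num.min (d x y) 1).
have dxx x : d x x = 0 by apply/d0.
have dge0 x y : 0 <= d x y.
  by have := dD x y x; rewrite dxx (dC y x); lra.
split.
- by move=> x y; rewrite -d0; case: leP => // ? ; split; lra.
- by move=> x y; rewrite dC.
- move=> x y z; have := dD x y z; have := dge0 x y; have := dge0 y z.
  by move=> h1 h2; case: (leP (d x z) 1) => ?; case: (leP (d x y) 1) => ?;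
    case: (leP (d y z) 1) => ?; lra.
- by move=> x y; rewrite le_min dge0 ler01 ge_min lexx orbT.
- move=> E; rewrite dE; split=> [[e e0 eE]|[e e0 eE]].
    exists (Num.min e 1); first by rewrite lt_min e0 ltr01.
    move=> x y; rewrite lt_min => /andP[+ +].
    by case: (leP (d x y) 1) => [_ xy _|_ _]; [exact: eE|rewrite ltxx].
  exists e => // -[x y] /= xy; apply: eE; apply: le_lt_trans xy.
  by rewrite ge_min lexx.
Qed.

Variables (T : uniformType) (d : T -> T -> R).
Hypothesis dm : bounded_metric d.

Lemma bmxx x : d x x = 0. Proof. by case: dm => h _ _ _ _; apply/h. Qed.
Lemma bm_eq0 x y : d x y = 0 -> x = y. Proof. by case: dm => h _ _ _ _ /h. Qed.
Lemma bmC x y : d x y = d y x. Proof. by case: dm. Qed.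
Lemma bmD x y z : d x z <= d x y + d y z. Proof. by case: dm. Qed.
Lemma bm_ge0 x y : 0 <= d x y. Proof. by case: dm => _ _ _ h _; case/andP: (h x y). Qed.
Lemma bm_le1 x y : d x y <= 1. Proof. by case: dm => _ _ _ h _; case/andP: (h x y). Qed.
Lemma bm_entP (E : set (T * T)) : entourage E <->
  exists2 e, 0 < e & forall x y, d x y < e -> E (x, y).
Proof. by case: dm. Qed.

Lemma bm_ent e : 0 < e -> entourage [set z | d z.1 z.2 < e].
Proof. by move=> e0; apply/bm_entP; exists e. Qed.

Lemma bm_dist x y x' y' : `|d x y - d x' y'| <= d x x' + d y y'.
Proof.
have h1 := bmD x x' y; have h2 := bmD x' y' y.
have h3 := bmD x' x y'; have h4 := bmD x y y'.
rewrite ler_norml; move: h1 h2 h3 h4; rewrite (bmC x' x) (bmC y' y) => *.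
by apply/andP; split; lra.
Qed.

Lemma uc_bm : unif_continuous (fun z : T * T => d z.1 z.2).
Proof.
apply/ucRP => e e0; have e2 : 0 < e / 2 by rewrite divr_gt0.
exists [set z | d z.1.1 z.2.1 < e / 2 /\ d z.1.2 z.2.2 < e / 2].
  by have := prod_entP (bm_ent e2) (bm_ent e2).
move=> [x y] [x' y'] /= [xx yy]; apply: le_lt_trans (bm_dist _ _ _ _) _.
by rewrite [e]splitr ltrD.
Qed.

End metrics.


Section telescope_uniformity.
Variables (R : realType) (Z : nat -> uniformType).
Variable g : forall i, Z i.+1 -> Z i.

Lemma uc_tel_inl m : unif_continuous (@tel_inl R Z g m).
Proof. exact: (uc_comp (@uquot_pi_unif_continuous _ _) (@uc_inl _ _)). Qed.

Lemma uc_cyl m : unif_continuous (fun z : Z m.+1 * unitI R => cyl g z.1 z.2).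
Proof.
apply: (uc_comp (@uquot_pi_unif_continuous _ _)).
apply: (uc_comp (@uc_inr _ _)).
apply: (uc_comp (@uquot_pi_unif_continuous _ _)).
apply: (uc_comp (@uc_inl _ _)).
exact: (uc_pair (@uc_fst _ _) (@uc_snd _ _)).
Qed.

Lemma uc_tel_incl m : unif_continuous (@tel_incl R Z g m).
Proof.
by case: m => [|m]; [exact: uc_id|exact: (uc_slice (unitI0 R) (@uc_cyl m))].
Qed.

Lemma uc_tel m (K S : uniformType) (H : tel R g m.+1 * K -> S) :
  unif_continuous (fun z : tel R g m * K => H (tel_inl z.1, z.2)) ->
  unif_continuous (fun z : Z m.+1 * unitI R * K => H (cyl g z.1.1 z.1.2, z.2)) ->
  unif_continuous H.
Proof.
move=> Hl Hc; apply: uc_amalgam => //; apply: uc_MC.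
  rewrite (_ : (fun z => _) =
    (fun z : Z m.+1 * unitI R * K => H (cyl g z.1.1 z.1.2, z.2))) //.
  by apply/funext => -[[x t] k].
have Hli := uc_comp Hl (@uc_comp1 _ _ K _ (@uc_tel_incl m)).
rewrite (_ : (fun z => _) =
  (fun z : Z m * K => H (tel_inl (tel_incl R g z.1), z.2))) //.
by apply/funext => -[y k]; rewrite /= tel_glue.
Qed.

Hypothesis gc : forall i, unif_continuous (@g i).

Lemma uc_tel_retr m : unif_continuous (@tel_retr R Z g m).
Proof.
have : unif_continuous (fun z : tel R g m.+1 * R => tel_retr z.1).
  apply: uc_tel.
    rewrite (_ : (fun z => _) = (fun z : tel R g m * R => z.1)); first exact: uc_fst.
    by apply/funext => -[w r] /=; rewrite tel_retr_inl.
  rewrite (_ : (fun z => _) =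
    (fun z : Z m.+1 * unitI R * R => tel_incl R g (g z.1.1))).
    have h := uc_comp (@gc m) (uc_comp (@uc_fst _ _) (@uc_fst (Z m.+1 * unitI R)%type R)).
    exact: (uc_comp (@uc_tel_incl m) h).
  by apply/funext => -[[x t] r] /=; rewrite tel_retr_cyl.
exact: (@uc_slice _ _ _ _ 0).
Qed.

Lemma uc_track m : unif_continuous (fun z : Z m * R => track g z.1 z.2).
Proof.
elim: m => [|m ih]; first exact: uc_fst.
apply: (@uc_glue _ _ _ _ m%:R).
  rewrite (_ : (fun z => _) = (fun z : Z m.+1 * R =>
    tel_inl (track g (g z.1) (Num.min z.2 m%:R)))).
    apply: (uc_comp (@uc_tel_inl m)); apply: (uc_comp2 ih).
      exact: (uc_comp (@gc m) (@uc_fst _ _)).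
    exact: (uc_min (@uc_snd _ _) (uc_cst _ _)).
  by apply/funext => -[x s]; rewrite track_lo //= ge_min lexx orbT.
rewrite (_ : (fun z => _) = (fun z : Z m.+1 * R =>
    cyl g z.1 (clip (m.+1%:R - (Num.max z.2 m%:R))))).
  apply: (uc_comp2 (@uc_cyl m)); first exact: uc_fst.
  apply: (uc_comp (@uc_clip R)); apply: uc_sub; first exact: uc_cst.
  exact: (uc_max (@uc_snd _ _) (uc_cst _ _)).
by apply/funext => -[x s]; rewrite track_hi //= le_max lexx orbT.
Qed.

Lemma uc_emb j : unif_continuous (@emb R Z g j).
Proof.
apply/(uc_invlimP (fun m => @uc_tel_retr m)) => m.
elim: m => [|m ih]; first exact: (uc_bond (fun m => @uc_tel_retr m)).
have [mj|jm] := leqP m.+1 j.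
  rewrite (_ : (fun x => _) = bond (@tel_retr R Z g) mj).
    exact: (uc_bond (fun m => @uc_tel_retr m)).
  by apply/funext => w; rewrite (proj_emb_le w mj).
rewrite (_ : (fun x => _) = (fun w => tel_inl (invlim_proj m (@emb R Z g j w)))).
  exact: (uc_comp (@uc_tel_inl m) ih).
by apply/funext => w; rewrite proj_emb_gt.
Qed.

Lemma uc_pt j : unif_continuous (fun z : Z j * R => pt g z.1 z.2).
Proof. exact: (uc_comp (@uc_emb j) (@uc_track j)). Qed.

(** Scaling the distance to [p] by the height gives functions on the top
    cylinder which vanish on its bottom, hence extend by zero to the telescope;
    being jointly uniformly continuous in [p], they detect closeness of points at
    the top. *)
Lemma tel_incl_embedding m (B : set (Z m * Z m)) :
  metrizable R (Z m) -> entourage B ->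
  exists2 A, entourage A &
    forall x y, A (tel_incl R g x, tel_incl R g y) -> B (x, y).
Proof.
move=> /metrizable_bounded[d dm] eB.
case: m B d dm eB => [|m] B d dm eB; first by exists B.
have compat p : forall a b, MC_rel (@g m) a b ->
    (if a is inl (x, t) then (1 - set_val (t : unitI R)) * d x p else 0) =
    (if b is inl (x, t) then (1 - set_val (t : unitI R)) * d x p else 0).
  by move=> ? ? [z [-> ->]] /=; rewrite subrr mul0r.
pose F (z : tel R g m.+1 * Z m.+1) : R := amalgam_case (fun=> 0)
  (@uquot_lift _ (MC_rel (@g m)) _ (fun u => if u is inl (x, t) then
     (1 - set_val t) * d x z.2 else 0)) z.1.
have Fl w p : F (tel_inl w, p) = 0.
  by apply: amalgam_case_inl => c; rewrite uquot_liftE //; exact: compat.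
have Fc x t p : F (cyl g x t, p) = (1 - set_val t) * d x p.
  rewrite /F [LHS]amalgam_case_inr => [|c]; rewrite uquot_liftE //;
    exact: compat.
have Fu : unif_continuous F.
  apply: uc_tel.
    rewrite (_ : (fun z => _) = fun=> 0); first exact: uc_cst.
    by apply/funext => -[w p]; rewrite /= Fl.
  rewrite (_ : (fun z => _) = fun z : Z m.+1 * unitI R * Z m.+1 =>
    (1 - set_val z.1.2) * d z.1.1 z.2).
    apply: (@uc_mul _ _ _ _ 1) => [z|z||].
    - by have := unitI_ge0 z.1.2; have := unitI_le1 z.1.2; rewrite ler_norml => *;
        apply/andP; split; lra.
    - by rewrite ger0_norm ?(bm_le1 dm) // (bm_ge0 dm).
    - apply: uc_sub; first exact: uc_cst.
      exact: (uc_comp (@uc_set_val _ _) (uc_comp (@uc_snd _ _) (@uc_fst _ _))).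
    - apply: (uc_comp2 (uc_bm dm)); last exact: uc_snd.
      exact: (uc_comp (@uc_fst _ _) (@uc_fst _ _)).
  by apply/funext => -[[x t] p]; rewrite /= Fc.
have [e e0 eBe] := (bm_entP dm _).1 eB.
have eR : entourage [set z : R * R | `|z.1 - z.2| < e] by apply/entRP; exists e.
have [[A eA AF] _] := (uc_prodP _).1 Fu _ eR.
exists A => // x y /AF => /(_ y); rewrite -!cyl0 /= !Fc (bmxx dm) mulr0 subr0.
rewrite subr0 mul1r ger0_norm ?(bm_ge0 dm) //; exact: eBe.
Qed.

(** Once some coordinate lies below the top of its finite telescope, all later
    ones are copies of it. Otherwise all coordinates lie at the top ends, and
    they form a thread of the limit. *)
Lemma xtel_cases (w : xtel R g) :
  (exists j (v : tel R g j), w = emb v) \/ (exists x, w = xtel_lim R x).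
Proof.
have [[m wm]|nw] := pselect (exists m, tel_level (invlim_proj m w) < m%:R).
  left; exists m, (invlim_proj m w); apply: emb_unique => // n mn.
  have lev k : (m <= k)%N -> tel_level (invlim_proj k w) < m%:R.
    move=> mk; have := tel_level_proj w mk.
    by case: leP => // _ h; move: wm; rewrite h ltxx.
  move: (lev _ mn) (lev _ (leqW mn)).
  rewrite -(invlim_projP n w); elim/tel_cyl_ind: (invlim_proj n.+1 w) => [v|x t].
    by rewrite tel_retr_inl.
  by rewrite tel_retr_cyl tel_level_incl ltr_nat ltnNge mn.
have top m : exists x, invlim_proj m w = tel_incl R g x.
  by apply: tel_level_top; rewrite leNgt; apply/negP => wm; apply: nw; exists m.
pose x m := projT1 (cid (top m)); have xw m := projT2 (cid (top m)) : _ = tel_incl R g (x m).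
have xlim : invlim_set g x.
  move=> m; apply: (@tel_incl_inj R _ g); rewrite -tel_retr_incl -!xw.
  exact: invlim_projP.
by right; exists (invlim_mk xlim); apply: invlim_eqP => m; exact: xw.
Qed.

Lemma xtel_level_emb m (v : tel R g m) : xtel_level (emb v) = (tel_level v)%:E.
Proof.
have lev : tel_level (invlim_proj m.+1 (emb v)) = tel_level v.
  by rewrite proj_emb_gt // proj_emb tel_level_inl.
rewrite -lev; apply: xtel_level_fin; rewrite lev.
by have /andP[_ /le_lt_trans] := tel_level_itv v; apply; rewrite ltr_nat.
Qed.

Lemma emb_lim m (v : tel R g m) x : emb v <> xtel_lim R x.
Proof. by move=> /(congr1 (@xtel_level R _ g)); rewrite xtel_level_emb xtel_level_lim. Qed.

Lemma xtel_lim_inj : injective (@xtel_lim R Z g).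
Proof.
move=> x y xy; apply: invlim_eqP => m; apply: (@tel_incl_inj R _ g).
by have := congr1 (invlim_proj m) xy.
Qed.

Lemma xtel_level_pt j (x : Z j) (s : R) : 0 <= s ->
  xtel_level (pt g x s) = (Num.min s j%:R)%:E.
Proof. by move=> s0; rewrite xtel_level_emb tel_level_track. Qed.

Lemma bond_cyl i j (h : (i <= j)%N) (h' : (i <= j.+1)%N) (x : Z j.+1) t :
  bond (@tel_retr R Z g) h' (cyl g x t) = tel_incl R g (bond g h' x).
Proof.
rewrite (bondS _ h) tel_retr_cyl (bondS g h).
by rewrite -(track_full g (g x) (lexx _)) bond_track track_full ?ler_nat.
Qed.

End telescope_uniformity.


(** * Extension of maps over infinity *)

Section uniform_limits.

Lemma uc_approx (U V : uniformType) (H : U -> V) :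
  (forall B, entourage B -> exists2 f : U -> V, unif_continuous f &
     forall x, B (f x, H x)) -> unif_continuous H.
Proof.
move=> h; apply/ucP => B /ent_trans[C eC CB]; have [D eD DC] := ent_sym_trans eC.
have [E eE ED] := ent_sym eD.
have [f /ucP fc fH] := h _ eE; have [A eA AE] := fc _ eE.
exists A => // x y /AE xy; apply: (CB _ (f y)).
  have [Dxy _ _] := DC (H x) (f x) (f y).
  by apply: Dxy; [have [] := ED _ _ (fH x)|have [] := ED _ _ xy].
have [_ _ Dyy] := DC (f y) (f y) (H y).
have [_ Dy _] := DC (f y) (f y) (H y).
apply: Dy; last by have [] := ED _ _ (fH y).
exact: entourage_refl.
Qed.

End uniform_limits.

Section telescope_recursion.
Variables (R : realType) (A : nat -> uniformType).
Variables (a : forall i, A i.+1 -> A i) (K S : uniformType).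
Variables (e0 : A 0%N * K -> S) (h : forall j, A j.+1 * unitI R * K -> S).

(** The map on the end [A j] of the telescope is prescribed by the cylinder that
    has this end as its domain. *)
Definition end_val j : A j -> K -> S :=
  match j return A j -> K -> S with
  | 0 => fun x k => e0 (x, k)
  | i.+1 => fun x k => h (x, unitI0 R, k)
  end.

Fixpoint tel_rec m : tel R a m -> K -> S :=
  match m return tel R a m -> K -> S with
  | 0 => fun x k => e0 (x, k)
  | i.+1 => amalgam_case (@tel_rec i) (@uquot_lift _ (MC_rel (@a i)) _
      (fun u => match u with
        | inl (x, t) => fun k => h (x, t, k)
        | inr y => @end_val i y end))
  end.

Hypothesis ha : forall j (x : A j.+1) k, h (x, unitI1 R, k) = end_val (a x) k.

Let compat m b c : MC_rel (@a m) b c ->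
  match b with
        | inl (x, t) => fun k => h (x, t, k)
        | inr y => @end_val m y end =
  match c with
        | inl (x, t) => fun k => h (x, t, k)
        | inr y => @end_val m y end.
Proof. by move=> [x [-> ->]]; apply/funext => k; exact: ha. Qed.

Lemma tel_rec_incl m (x : A m) : tel_rec (tel_incl R a x) = end_val x.
Proof.
elim: m x => [//|m ih] x.
rewrite [LHS]amalgam_case_inr => [|c]; rewrite uquot_liftE //;
  [exact: compat|exact: ih|exact: compat].
Qed.

Lemma tel_rec_inl m (w : tel R a m) : tel_rec (tel_inl w) = tel_rec w.
Proof.
apply: amalgam_case_inl => c; rewrite uquot_liftE; last exact: compat.
exact: tel_rec_incl.
Qed.

Lemma tel_rec_cyl m (x : A m.+1) t k : tel_rec (cyl a x t) k = h (x, t, k).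
Proof.
rewrite [tel_rec _]amalgam_case_inr => [|c]; rewrite uquot_liftE //;
  [exact: compat|exact: tel_rec_incl|exact: compat].
Qed.

Hypothesis e0c : unif_continuous e0.
Hypothesis hc : forall j, unif_continuous (@h j).

Lemma uc_tel_rec m : unif_continuous (fun z : tel R a m * K => tel_rec z.1 z.2).
Proof.
elim: m => [|m ih].
  rewrite (_ : (fun z => _) = e0) //; apply/funext => -[x k] //.
apply: uc_tel.
  rewrite (_ : (fun z => _) = (fun z : tel R a m * K => tel_rec z.1 z.2)) //.
  by apply/funext => -[w k]; rewrite /= -tel_rec_inl.
rewrite (_ : (fun z => _) = @h m) //.
by apply/funext => -[[x t] k]; rewrite tel_rec_cyl.
Qed.

Lemma tel_rec_proj_emb m n (v : tel R a n) : (n <= m)%N ->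
  tel_rec (invlim_proj m (emb v)) = tel_rec v.
Proof.
move=> nm; rewrite -(subnK nm); elim: (m - n)%N => [|k ih]; first by rewrite proj_emb.
by rewrite addSn proj_emb_gt ?leq_addl // tel_rec_inl.
Qed.

Lemma tel_rec_emb m n (v : tel R a n) (v' : tel R a m) :
  emb v = emb v' -> tel_rec v = tel_rec v'.
Proof.
move=> vv; rewrite -(tel_rec_proj_emb v (leq_maxl n m)) vv.
by rewrite tel_rec_proj_emb // leq_maxr.
Qed.


Variable finf : invlim a -> K -> S.
Hypothesis hinf : forall B : set (S * S), entourage B -> exists m,
  (forall j (mj : (m <= j)%N) (x : A j.+1) t k,
     B (end_val (bond a (leqW mj) x) k, h (x, t, k))) /\
  (forall x k, B (end_val (invlim_proj m x) k, finf x k)).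

(** The extended map is a uniform limit of maps which factor through finite
    telescopes, and these are uniformly continuous by construction. *)
Lemma xtel_extension : exists H : xtel R a * K -> S, [/\ unif_continuous H,
  forall m (v : tel R a m) k, H (emb v, k) = tel_rec v k &
  forall x k, H (xtel_lim R x, k) = finf x k].
Proof.
have /choice[H HP] : forall z : xtel R a * K, exists s,
    (forall m (v : tel R a m), z.1 = emb v -> s = tel_rec v z.2) /\
    (forall x, z.1 = xtel_lim R x -> s = finf x z.2).
  move=> [w k] /=; have [[m [v ->]]|[x ->]] := xtel_cases w.
    exists (tel_rec v k); split=> [n u /tel_rec_emb -> //|x /emb_lim []].
  by exists (finf x k); split=> [n u /esym/emb_lim []|y /xtel_lim_inj ->].
have Hfin m (v : tel R a m) k : H (emb v, k) = tel_rec v k.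
  by have [h1 _] := HP (emb v, k); exact: h1.
have Hlim x k : H (xtel_lim R x, k) = finf x k.
  by have [_ h2] := HP (xtel_lim R x, k); exact: h2.
exists H; split=> //.
apply: uc_approx => B eB; have [m [hm hl]] := hinf eB.
exists (fun z => tel_rec (invlim_proj m z.1) z.2).
  apply: (uc_comp2 (@uc_tel_rec m)); last exact: uc_snd.
  exact: (uc_comp (@uc_invlim_proj _ _ m) (@uc_fst _ _)).
move=> [w k] /=; have [[n [v ->]]|[x ->]] := xtel_cases w; last first.
  by rewrite Hlim [invlim_proj _ _]/(tel_incl R a (invlim_proj m x)) tel_rec_incl.
rewrite Hfin; elim: n v => [|n ih] v.
  by rewrite tel_rec_proj_emb //; exact: entourage_refl.
have [mn|nm] := leqP m n; last first.
  by rewrite tel_rec_proj_emb //; exact: entourage_refl.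
elim/tel_cyl_ind: v => [v|x t]; first by rewrite emb_inl tel_rec_inl.
by rewrite (proj_emb_le _ (leqW mn)) (bond_cyl a mn) tel_rec_incl tel_rec_cyl.
Qed.

End telescope_recursion.


(** * Level-preserving maps and retractions *)

Section cutting.
Variables (R : realType) (B : nat -> uniformType).
Variable b : forall i, B i.+1 -> B i.
Hypothesis bc : forall i, unif_continuous (@b i).

Lemma track_min m (y : B m) (c s : R) : m%:R <= c ->
  track b y (Num.min c s) = track b y s.
Proof.
move=> mc; have [cs|//] := leP c s.
by rewrite !track_full // (le_trans mc).
Qed.

Lemma lim_track_subproof (y : invlim b) (s : R) :
  invlim_set (@tel_retr R B b) (fun m => track b (invlim_proj m y) s).
Proof. by move=> m; rewrite track_retr invlim_projP. Qed.

Definition lim_track (y : invlim b) (s : R) : xtel R b :=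
  invlim_mk (lim_track_subproof y s).

(** The retractions of the extended telescope onto its parts over [[0, c]],
    as a single uniformly continuous map: the height [c] is the parameter of
    the family, so the extension lemma applies with the real line as [K]. *)
Lemma xtel_cut : exists rho : xtel R b * R -> xtel R b,
  [/\ unif_continuous rho,
    forall j (y : B j) s c, s <= j%:R -> rho (pt b y s, c) = pt b y (Num.min s c) &
    forall m w c, m%:R <= c -> invlim_proj m (rho (w, c)) = invlim_proj m w].
Proof.
pose e0 (z : B 0%N * R) := pt b z.1 (Num.min 0 z.2).
pose h j (z : B j.+1 * unitI R * R) :=
  pt b z.1.1 (Num.min (j.+1%:R - set_val z.1.2) z.2).
have endE j (y : B j) c : end_val e0 h y c = pt b y (Num.min j%:R c).
  by case: j y => [//|j] y; rewrite /= /h /= subr0.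
have compat j (y : B j.+1) c : h _ (y, unitI1 R, c) = end_val e0 h (b y) c.
  have -> : h _ (y, unitI1 R, c) = pt b y (Num.min j%:R c).
    by rewrite /h /= -natr1 addrK.
  by rewrite endE ptS // ge_min lexx.
have [|||rho [rhoc rhoE rhol]] := @xtel_extension R B b R _ e0 h compat _ _ lim_track.
- apply: (uc_comp2 (@uc_pt _ _ _ bc _)); first exact: uc_fst.
  exact: (uc_min (uc_cst _ _) (@uc_snd _ _)).
- move=> j; apply: (uc_comp2 (@uc_pt _ _ _ bc _)).
    exact: (uc_comp (@uc_fst _ _) (@uc_fst _ _)).
  apply: uc_min (@uc_snd _ _); apply: uc_sub; first exact: uc_cst.
  exact: (uc_comp (@uc_set_val _ _) (uc_comp (@uc_snd _ _) (@uc_fst _ _))).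
- move=> E /(invlim_entP (fun m => uc_tel_retr bc (m := m))) [m [V [eV VE]]].
  exists m; split=> [j mj x t c|x c]; apply: VE; rewrite endE (proj_pt _ _ _ (leqnn m))
    bond_refl track_min //.
    rewrite (proj_pt _ _ _ (leqW mj)) track_min; first exact: entourage_refl.
    have := unitI_le1 t; have : m%:R <= j%:R :> R by rewrite ler_nat.
    by rewrite -natr1; lra.
  exact: entourage_refl.
have rhoP j (y : B j) s c : s <= j%:R -> rho (pt b y s, c) = pt b y (Num.min s c).
  rewrite rhoE; elim: j y => [|j ih] y sj.
    by rewrite /= /e0 /pt /=.
  have [sj'|/ltW js] := leP s j%:R.
    by rewrite track_lo // tel_rec_inl // ih // -ptS // ge_min sj'.
  rewrite track_hi // tel_rec_cyl // /h /= clip_val ?opprB 1?addrC ?subrK //.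
  by rewrite -natr1 in sj *; apply/andP; split; lra.
exists rho; split=> // m w c mc.
have [[n [v ->]]|[x ->]] := xtel_cases w; last first.
  have E : invlim_proj m (lim_track x c) = track b (invlim_proj m x) c by [].
  by rewrite rhol E track_full.
have [k [x [s [/andP[s0 sk] ->]]]] := emb_pt v; rewrite rhoP //.
have [mk|/ltnW km] := leqP m k.
  by rewrite !(proj_pt _ _ _ mk) minC track_min.
by rewrite min_l // (le_trans sk) // (le_trans _ mc) // ler_nat.
Qed.

End cutting.

Section level_maps.
Variables (R : realType) (A B : nat -> uniformType).
Variables (a : forall i, A i.+1 -> A i) (b : forall i, B i.+1 -> B i).
Hypothesis bc : forall i, unif_continuous (@b i).
Variables (K : uniformType).
Variables (e0 : A 0%N * K -> xtel R b).
Variable (h : forall j, A j.+1 * unitI R * K -> xtel R b).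
Hypothesis ha : forall j (x : A j.+1) k, h (x, unitI1 R, k) = end_val e0 h (a x) k.
Hypothesis e0c : unif_continuous e0.
Hypothesis hc : forall j, unif_continuous (@h j).
Hypothesis e0_level : forall x k, xtel_level (e0 (x, k)) = 0%:E.
Hypothesis h_level : forall j (x : A j.+1) t k,
  xtel_level (h (x, t, k)) = (j.+1%:R - set_val t)%:E.

Variable f : invlim a -> invlim b.
Hypothesis hf : forall M (V : set (tel R b M * tel R b M)), entourage V -> exists m,
  (forall j (mj : (m <= j)%N) (x : A j.+1) t k,
     V (invlim_proj M (end_val e0 h (bond a (leqW mj) x) k),
        invlim_proj M (h (x, t, k)))) /\
  (forall x k, V (invlim_proj M (end_val e0 h (invlim_proj m x) k),
                  tel_incl R b (invlim_proj M (f x)))).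

Lemma xtel_level_extension : exists H : xtel R a * K -> xtel R b,
  [/\ unif_continuous H, forall m (v : tel R a m) k, H (emb v, k) = tel_rec e0 h v k,
    forall x k, H (xtel_lim R x, k) = xtel_lim R (f x) &
    forall k, level_preserving (fun w => H (w, k))].
Proof.
have [E|H [Hc HE Hl]] :=
    @xtel_extension R A a K _ e0 h ha e0c hc (fun x _ => xtel_lim R (f x)).
  move=> /(invlim_entP (fun m => uc_tel_retr bc (m := m))) [M [V [eV VE]]].
  have [m [hm hl]] := hf eV; exists m; split=> [j mj x t k|x k]; apply: VE.
    exact: hm.
  exact: hl.
exists H; split=> // k w.
have [[n [v ->]]|[x ->]] := xtel_cases w; last by rewrite Hl !xtel_level_lim.
rewrite HE xtel_level_emb; elim: n v => [|n ih] v; first exact: e0_level.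
elim/tel_cyl_ind: v => [v|x t]; first by rewrite tel_rec_inl // tel_level_inl.
by rewrite tel_rec_cyl // tel_level_cyl h_level.
Qed.

End level_maps.

Section ladders.
Variables (R : realType) (A B : nat -> uniformType).
Variables (a : forall i, A i.+1 -> A i) (b : forall i, B i.+1 -> B i).
Hypothesis bc : forall i, unif_continuous (@b i).
Variables (K : uniformType).
Variables (om : forall j, A j * K -> B j).
Variable (eta : forall j, A j.+1 * unitI R * K -> B j.+1).
Hypothesis omc : unif_continuous (@om 0).
Hypothesis etac : forall j, unif_continuous (@eta j).
Hypothesis eta0 : forall j (x : A j.+1) k, eta (x, unitI0 R, k) = om (x, k).
Hypothesis eta1 : forall j (x : A j.+1) k, b (eta (x, unitI1 R, k)) = om (a x, k).
Variable f : invlim a -> invlim b.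
Hypothesis hf : forall M (V : set (B M * B M)), entourage V ->
  exists m (Mm : (M <= m)%N),
  (forall j (mj : (m <= j)%N) (x : A j.+1) t k,
     V (bond b Mm (om (bond a (leqW mj) x, k)),
        bond b (leqW (leq_trans Mm mj)) (eta (x, t, k)))) /\
  (forall x k, V (bond b Mm (om (invlim_proj m x, k)), invlim_proj M (f x))).

(** A ladder of maps into the terms of the target sequence, commuting with
    its bonding maps up to homotopies in the upper terms, gives a level-preserving
    map: each homotopy is used while the level runs through one unit interval. *)
Lemma xtel_ladder : exists H : xtel R a * K -> xtel R b,
  [/\ unif_continuous H,
    forall j (x : A j.+1) t k, H (emb (cyl a x t), k) =
      pt b (eta (x, t, k)) (j.+1%:R - set_val t),
    forall (x : A 0%N) k, H (@emb _ _ a 0 x, k) = pt b (om (x, k)) 0,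
    forall x k, H (xtel_lim R x, k) = xtel_lim R (f x) &
    forall k, level_preserving (fun w => H (w, k))].
Proof.
pose e0 (z : A 0%N * K) : xtel R b := pt b (om z) 0.
pose h j (z : A j.+1 * unitI R * K) := pt b (eta z) (j.+1%:R - set_val z.1.2).
have endE j (x : A j) k : end_val e0 h x k = pt b (om (x, k)) j%:R.
  by case: j x => [//|j] x; rewrite /= /h /= subr0 eta0.
have compat j (x : A j.+1) k : h _ (x, unitI1 R, k) = end_val e0 h (a x) k.
  have -> : h _ (x, unitI1 R, k) = pt b (eta (x, unitI1 R, k)) j%:R.
    by rewrite /h /= -natr1 addrK.
  by rewrite endE ptS // eta1.
have [|||||H [Hc HE Hl Hlev]] :=
    @xtel_level_extension R A B a b bc K e0 h compat _ _ _ _ f.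
- by apply: (uc_comp2 (@uc_pt _ _ _ bc _)) => //; exact: uc_cst.
- move=> j; apply: (uc_comp2 (@uc_pt _ _ _ bc _)) => //.
  apply: uc_sub; first exact: uc_cst.
  exact: (uc_comp (@uc_set_val _ _) (uc_comp (@uc_snd _ _) (@uc_fst _ _))).
- by move=> x k; rewrite /e0 xtel_level_pt // min_l.
- move=> j x t k; have := unitI_ge0 t; have := unitI_le1 t => t1 t0.
  rewrite /h xtel_level_pt /= ?min_l //; first by lra.
  by have := ler0n R j; rewrite -natr1; lra.
- move=> M V eV; have /ucP/(_ _ eV)[V' eV' V'V] := @uc_tel_incl R B b M.
  have [m [Mm [h1 h2]]] := hf eV'; exists m; split=> [j mj x t k|x k].
    rewrite endE (proj_pt_hi _ _ Mm) ?ler_nat //.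
    rewrite (proj_pt_hi _ _ (leqW (leq_trans Mm mj))); first exact: V'V.
    have := unitI_le1 t; have : M%:R <= j%:R :> R by rewrite ler_nat (leq_trans Mm).
    by rewrite /= -natr1; lra.
  by rewrite endE (proj_pt_hi _ _ Mm) ?ler_nat //; exact: V'V.
by exists H; split=> // j x t k; rewrite HE tel_rec_cyl.
Qed.

End ladders.


(** * Local structure of uniform ANRs *)

Section collar.
Variables (R : realType) (Y : uniformType) (d : Y -> Y -> R).

(** The metric space that consists of all functions from [Y] to the unit interval
    at positive heights, and at height [0] of the distance functions [d y] only.
    The sup metric makes [y |-> d y] an isometric embedding (Kuratowski). *)
Definition collar_pred (z : (Y -> R) * R) : Prop :=
  [/\ forall y, 0 <= z.1 y <= 1, 0 <= z.2 <= 1 & z.2 = 0 -> exists y, z.1 = d y].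

Definition collar : Type := {z : (Y -> R) * R | collar_pred z}.

HB.instance Definition _ := gen_eqMixin collar.
HB.instance Definition _ := gen_choiceMixin collar.

Implicit Types z : collar.

Lemma collar_eqP z z' : (sval z).1 = (sval z').1 -> (sval z).2 = (sval z').2 -> z = z'.
Proof.
case: z z' => [[u s] zP] [[u' s'] zP'] /= uu ss; case: _ / uu zP'; case: _ / ss => zP'.
by congr exist; exact: Prop_irrelevance.
Qed.

Definition collar_diff z z' : set R :=
  [set r | r = `|(sval z).2 - (sval z').2| \/
           exists y, r = `|(sval z).1 y - (sval z').1 y|].

Definition collar_dist z z' : R := sup (collar_diff z z').

Lemma collar_distP z z' e : reflect
  (`|(sval z).2 - (sval z').2| <= e /\
   forall y, `|(sval z).1 y - (sval z').1 y| <= e) (collar_dist z z' <= e).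
Proof.
have dist01 (u v : R) : 0 <= u <= 1 -> 0 <= v <= 1 -> `|u - v| <= 1.
  by move=> /andP[? ?] /andP[? ?]; rewrite ler_norml; apply/andP; split; lra.
have ub1 : ubound (collar_diff z z') 1.
  have [z1 z2 _] := svalP z; have [z1' z2' _] := svalP z'.
  by move=> _ [->|[y ->]]; exact: dist01.
have ne : collar_diff z z' !=set0 by eexists; left.
apply: (iffP idP) => [ze|[z2 z1]]; last first.
  by apply: ge_sup => // _ [->|[y ->]].
have bd r : collar_diff z z' r -> r <= e.
  by move=> zr; apply: le_trans ze; apply: ub_le_sup => //; exists 1.
by split=> [|y]; apply: bd; [left|right; exists y].
Qed.

Lemma collar_dist2 z z' : `|(sval z).2 - (sval z').2| <= collar_dist z z'.
Proof. by have /collar_distP[] := lexx (collar_dist z z'). Qed.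

Lemma collar_dist1 z z' y : `|(sval z).1 y - (sval z').1 y| <= collar_dist z z'.
Proof. by have /collar_distP[] := lexx (collar_dist z z'). Qed.

Lemma collar_dist_ge0 z z' : 0 <= collar_dist z z'.
Proof. exact: le_trans (normr_ge0 _) (collar_dist2 z z'). Qed.

Lemma collar_distxx z : collar_dist z z = 0.
Proof.
apply/le_anti; rewrite collar_dist_ge0 andbT; apply/collar_distP.
by split=> [|y]; rewrite subrr normr0.
Qed.

Lemma collar_distC z z' : collar_dist z z' = collar_dist z' z.
Proof.
by apply/le_anti/andP; split; apply/collar_distP; split=> [|y]; rewrite distrC;
  [exact: collar_dist2|exact: collar_dist1|exact: collar_dist2|exact: collar_dist1].
Qed.

Lemma collar_distD z z' z'' :
  collar_dist z z'' <= collar_dist z z' + collar_dist z' z''.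
Proof.
apply/collar_distP; split=> [|y]; apply: le_trans (ler_distD _ _ _) _.
  by apply: lerD; exact: collar_dist2.
by apply: lerD; exact: collar_dist1.
Qed.

Lemma collar_dist_eq0 z z' : collar_dist z z' = 0 -> z = z'.
Proof.
move=> zz; apply: collar_eqP; last first.
  by have := collar_dist2 z z'; rewrite zz normr_le0 subr_eq0 => /eqP.
apply/funext => y; have := collar_dist1 z z' y.
by rewrite zz normr_le0 subr_eq0 => /eqP.
Qed.

Let ent := entourage_ (fun z e => [set z' | collar_dist z z' < e]).

Let ent_filter : Filter ent.
Proof.
apply: filter_from_filter; first by exists 1 => /=.
move=> e e' e0 e0'; exists (Num.min e e'); first by rewrite /= lt_min; apply/andP; split.
by move=> -[x y] /=; rewrite lt_min => /andP[].
Qed.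

Let ent_refl A : ent A -> diagonal `<=` A.
Proof.
move=> [e e0 eA] [x y] xy; apply: eA => /=.
by have <- : x = y := xy; rewrite collar_distxx.
Qed.

Let ent_inv A : ent A -> ent (A^-1)%relation.
Proof.
by move=> [e e0 eA]; exists e => // -[x y] /=; rewrite collar_distC => /(eA (_, _)).
Qed.

Let ent_split A : ent A -> exists2 B, ent B & (B \; B `<=` A)%relation.
Proof.
move=> [e e0 eA]; exists [set z | collar_dist z.1 z.2 < e / 2].
  by exists (e / 2) => //=; rewrite divr_gt0.
move=> [x y] [z /= xz zy]; apply: eA => /=.
by apply: le_lt_trans (collar_distD x z y) _; rewrite [e]splitr ltrD.
Qed.

HB.instance Definition _ := isUniform.Build collar ent_filter ent_refl ent_inv ent_split.

Lemma collar_entP (E : set (collar * collar)) : entourage E <->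
  exists2 e, 0 < e & forall z z', collar_dist z z' < e -> E (z, z').
Proof.
split=> -[e e0 eE]; exists e => //; first by move=> z z'; exact: (eE (z, z')).
by move=> -[z z'] /=; exact: eE.
Qed.

Lemma collar_metrizable : metrizable R collar.
Proof.
exists collar_dist; split; [|exact: collar_distC|exact: collar_distD|by []].
by move=> z z'; split=> [/collar_dist_eq0|->]; rewrite ?collar_distxx.
Qed.

Hypothesis dm : bounded_metric d.

Lemma collar_in_subproof y : collar_pred (d y, 0).
Proof.
split=> [p|/=|_]; [by rewrite (bm_ge0 dm) (bm_le1 dm)|by rewrite lexx ler01|].
by exists y.
Qed.

Definition collar_in y : collar := exist _ _ (collar_in_subproof y).

Lemma collar_in_dist y y' : collar_dist (collar_in y) (collar_in y') = d y y'.
Proof.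
apply/le_anti/andP; split.
  apply/collar_distP; split=> [|p] /=; first by rewrite subrr normr0 (bm_ge0 dm).
  by apply: le_trans (bm_dist dm _ _ _ _) _; rewrite (bmxx dm) addr0.
have := collar_dist1 (collar_in y) (collar_in y') y'.
by rewrite /= (bmxx dm) subr0 ger0_norm // (bm_ge0 dm).
Qed.

Lemma collar_in_embedding : uniform_embedding collar_in.
Proof.
split=> [y y' yy|].
  by apply: (bm_eq0 dm); rewrite -collar_in_dist yy collar_distxx.
apply/seteqP; split=> E.
  move=> /(bm_entP dm)[e e0 eE].
  exists [set z | collar_dist z.1 z.2 < e]; first by apply/collar_entP; exists e.
  by move=> [y y'] /=; rewrite collar_in_dist => /eE.
move=> [F /collar_entP[e e0 eF] FE]; apply/(bm_entP dm); exists e => // y y' yy.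
by apply: FE; apply: eF; rewrite /= collar_in_dist.
Qed.

Lemma collar_in_closed : closed (range collar_in).
Proof.
move=> z cz; have [z1 /andP[z2 _] z3] := svalP z.
have [z20|z20] := eqVneq (sval z).2 0.
  by have [y zy] := z3 z20; exists y => //; exact: collar_eqP.
have t0 : 0 < (sval z).2 by rewrite lt_def z20.
have /cz : nbhs z (xsection [set w | collar_dist w.1 w.2 < (sval z).2] z).
  by apply: nbhs_entourage; apply/collar_entP; exists (sval z).2.
move=> [_ [[y _ <-] /xsectionP /= yz]]; have := le_lt_trans (collar_dist2 _ _) yz.
by rewrite /= subr0 ger0_norm // ltxx.
Qed.

Definition collar_nbhd (e : R) : set collar :=
  [set z | exists y, collar_dist (collar_in y) z < e].

(** The bottom of the collar is closed in it even when [Y] is not complete,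
    because limits of distance functions are missing at height [0]. Hence the
    ANR property applies, while convex combinations of points of [Y] are
    available at positive heights. *)
Lemma ANR_collar_retraction : uniform_ANR R Y ->
  exists2 e : R, 0 < e & exists2 r : collar_nbhd e -> Y, unif_continuous r &
    forall (z : collar_nbhd e) y, set_val z = collar_in y -> r z = y.
Proof.
move=> [_ /(_ collar collar_in collar_metrizable collar_in_embedding
  collar_in_closed)] [N [[E /collar_entP[e e0 eE] EN] [r [rc rY rE]]]].
have sub (z : collar_nbhd e) : set_val z \in N.
  have [y yz] := set_valP z; apply/mem_set/(EN (collar_in y)); last exact: eE.
  by exists y.
exists e => //.
pose s (z : collar_nbhd e) : N := SigSub (sub z).
have sc : unif_continuous s by apply/uc_set_valP; exact: uc_set_val.
pose q (z : collar_nbhd e) := projT1 (cid2 (rY (s z))).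
have qE (z : collar_nbhd e) : collar_in (q z) = r (s z) by rewrite /q; case: (cid2 _).
exists q.
  apply/ucP => B /(bm_entP dm)[h h0 hB].
  have [|A eA AB] := (ucP _).1 (uc_comp rc sc) [set w | collar_dist w.1 w.2 < h].
    by apply/collar_entP; exists h.
  by exists A => // x y /AB /=; rewrite -!qE collar_in_dist => /hB.
move=> z y zy; have [/= collar_inj _] := collar_in_embedding.
by apply: collar_inj; rewrite qE rE //; exists y.
Qed.

End collar.

Section ANR_consequences.
Variables (R : realType) (Y : uniformType).

(** Uniform local equiconnectedness. The fourth condition is stated for maps into
    pairs of close points, which saves making a uniform space of such pairs. *)
Definition path_structure (E0 : set (Y * Y)) (lam : Y -> Y -> unitI R -> Y) : Prop :=
  [/\ forall y y', lam y y' (unitI0 R) = y,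
    forall y y', E0 (y, y') -> lam y y' (unitI1 R) = y',
    forall y s, lam y y s = y,
    forall (T : uniformType) (u v : T -> Y) (s : T -> unitI R),
      unif_continuous u -> unif_continuous v -> unif_continuous s ->
      (forall x, E0 (u x, v x)) -> unif_continuous (fun x => lam (u x) (v x) (s x)) &
    forall B, entourage B -> exists2 E, entourage E & forall y u v,
      E (y, u) -> E (y, v) -> E0 (u, v) /\ forall s, B (y, lam u v s)].

Hypothesis Y_ANR : uniform_ANR R Y.

(** The retraction of a neighborhood in the collar is applied to convex
    combinations of two close points, lifted off the bottom of the collar by an
    amount which vanishes at the ends and on the diagonal. *)
Lemma ANR_paths : exists E0 lam, path_structure E0 lam.
Proof.
have [d dm] := metrizable_bounded Y_ANR.1.
have [e e0 [r rc rE]] := ANR_collar_retraction dm Y_ANR.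
(* the convex combination at height [s (1 - s) d y y'], which is positive
   unless the combination is a distance function *)
have combP y y' (s : unitI R) : collar_pred d
    (fun p => (1 - set_val s) * d y p + set_val s * d y' p,
     set_val s * (1 - set_val s) * d y y').
  have s0 := unitI_ge0 s; have s1 := unitI_le1 s.
  have d0 p q := bm_ge0 dm p q; have d1 p q := bm_le1 dm p q.
  split=> [p /=||/eqP /=].
  - have := d0 y p; have := d1 y p; have := d0 y' p; have := d1 y' p => *.
    by apply/andP; split; nra.
  - have := d0 y y'; have := d1 y y' => /= *.
    have h : 0 <= set_val s * (1 - set_val s) <= 1 by apply/andP; split; nra.
    by case/andP: h => *; apply/andP; split; nra.
  - rewrite !mulf_eq0 => /orP[/orP[]|] /eqP sE.
    + by exists y; apply/funext => p; rewrite sE subr0 mul1r mul0r addr0.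
    + by exists y'; apply/funext => p; rewrite sE mul0r add0r (_ : set_val s = 1) ?mul1r //; lra.
    + by exists y; apply/funext => p; rewrite -(bm_eq0 dm sE) -mulrDl subrK mul1r.
pose comb y y' s : collar d := exist _ _ (combP y y' s).
have comb_dist y z z' s : collar_dist (collar_in dm y) (comb z z' s) <= d y z + d y z'.
  have s0 := unitI_ge0 s; have s1 := unitI_le1 s.
  apply/collar_distP; split=> [|p] /=.
    rewrite sub0r normrN ger0_norm.
      have h : set_val s * (1 - set_val s) <= 1 by nra.
      apply: (@le_trans _ _ (1 * d z z')).
        by apply: ler_wpM2r => //; exact: (bm_ge0 dm).
      by rewrite mul1r (bmC dm y z); exact: (bmD dm).
    by rewrite !mulr_ge0 ?subr_ge0 ?(bm_ge0 dm).
  have h1 := bm_dist dm y p z p; have h2 := bm_dist dm y p z' p.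
  rewrite !(bmxx dm) !addr0 in h1 h2.
  rewrite [X in `|X|](_ : _ = (1 - set_val s) * (d y p - d z p) +
    set_val s * (d y p - d z' p)); last by ring.
  apply: le_trans (ler_normD _ _) _; rewrite !normrM.
  rewrite (ger0_norm s0) (@ger0_norm _ (1 - set_val s)) ?subr_ge0 //.
  by have := normr_ge0 (d y p - d z p); have := normr_ge0 (d y p - d z' p); nra.
have comb_uc (T : uniformType) (u v : T -> Y) (s : T -> unitI R) :
    unif_continuous u -> unif_continuous v -> unif_continuous s ->
    unif_continuous (fun x => comb (u x) (v x) (s x)).
  move=> uc vc sc; apply/ucP => B /collar_entP[h h0 hB].
  have h4 : 0 < h / 4 by rewrite divr_gt0.
  have [U eU UB] := (ucP _).1 uc _ (bm_ent dm h4).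
  have [V eV VB] := (ucP _).1 vc _ (bm_ent dm h4).
  have [S eS SB] := (ucRP _).1 (uc_comp (@uc_set_val _ _) sc) _ h4.
  exists (U `&` (V `&` S)); first by apply: filterI => //; exact: filterI.
  move=> x x' [/UB /= xu [/VB /= xv /SB xs]]; apply: hB.
  apply: (@le_lt_trans _ _ (h / 4 + h / 4 + h / 4)); last by lra.
  have s0 := unitI_ge0 (s x); have s1 := unitI_le1 (s x).
  have s0' := unitI_ge0 (s x'); have s1' := unitI_le1 (s x').
  move: s0 s1 s0' s1' xs.
  set s1 := set_val (s x); set s2 := set_val (s x') => p1 p2 p3 p4 xs.
  apply/collar_distP; split=> [|p] /=; rewrite -/s1 -/s2.
    rewrite [X in `|X|](_ : _ = s1 * (1 - s1) * (d (u x) (v x) - d (u x') (v x')) +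
      d (u x') (v x') * (1 - s1 - s2) * (s1 - s2)); last by ring.
    apply: le_trans (ler_normD _ _) _; rewrite !normrM.
    have := bm_dist dm (u x) (v x) (u x') (v x') => uv.
    have h1 : `|s1| * `|1 - s1| <= 1.
      by rewrite !ger0_norm ?subr_ge0 //; nra.
    have h2 : `|1 - s1 - s2| <= 1 by rewrite ler_norml; apply/andP; split; lra.
    have h3 : `|d (u x') (v x')| <= 1 by rewrite ger0_norm ?(bm_ge0 dm) ?(bm_le1 dm).
    apply: lerD.
      apply: le_trans (ler_wpM2r (normr_ge0 _) h1) _; rewrite mul1r.
      by apply: le_trans uv _; apply: ltW; exact: ltrD.
    apply: le_trans (ltW xs); rewrite -[leRHS]mul1r; apply: ler_wpM2r => //.
    by rewrite -[leRHS]mul1r; apply: ler_pM.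
  have h1 := bm_dist dm (u x) p (u x') p; have h2 := bm_dist dm (v x) p (v x') p.
  rewrite !(bmxx dm) !addr0 in h1 h2.
  rewrite [X in `|X|](_ : _ = (1 - s1) * (d (u x) p - d (u x') p) +
    s1 * (d (v x) p - d (v x') p) + (s1 - s2) * (d (v x') p - d (u x') p)); last by ring.
  apply: le_trans (ler_normD _ _) _; apply: lerD.
    apply: le_trans (ler_normD _ _) _; apply: lerD; rewrite normrM ger0_norm ?subr_ge0 //.
      apply: (@le_trans _ _ (1 * `|d (u x) p - d (u x') p|)).
        by apply: ler_wpM2r => //; lra.
      by rewrite mul1r; apply: le_trans h1 _; exact: ltW.
    apply: (@le_trans _ _ (1 * `|d (v x) p - d (v x') p|)).
      by apply: ler_wpM2r => //; lra.
    by rewrite mul1r; apply: le_trans h2 _; exact: ltW.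
  rewrite normrM; apply: le_trans (ltW xs); rewrite -[leRHS]mulr1; apply: ler_wpM2l => //.
  have := bm_ge0 dm (v x') p; have := bm_le1 dm (v x') p.
  have := bm_ge0 dm (u x') p; have := bm_le1 dm (u x') p => *.
  by rewrite ler_norml; apply/andP; split; lra.
have comb0 y y' : comb y y' (unitI0 R) = collar_in dm y.
  apply: collar_eqP => /=; last by rewrite !mul0r.
  by apply/funext => p; rewrite subr0 mul1r mul0r addr0.
have comb1 y y' : comb y y' (unitI1 R) = collar_in dm y'.
  apply: collar_eqP => /=; last by rewrite subrr mulr0 mul0r.
  by apply/funext => p; rewrite subrr mul0r mul1r add0r.
have combyy y s : comb y y s = collar_in dm y.
  apply: collar_eqP => /=; last by rewrite (bmxx dm) mulr0.
  by apply/funext => p; rewrite -mulrDl subrK mul1r.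
have near y y' s : d y y' < e -> comb y y' s \in collar_nbhd dm e.
  move=> yy; apply/mem_set; exists y; apply: le_lt_trans (comb_dist _ _ _ _) _.
  by rewrite (bmxx dm) add0r.
pose lam y y' s := if pselect (d y y' < e) is left h then r (SigSub (near y y' s h)) else y.
exists [set z | d z.1 z.2 < e], lam; split.
- by move=> y y'; rewrite /lam; case: pselect => // h; apply: rE; exact: comb0.
- by move=> y y' /= h'; rewrite /lam; case: pselect => // h; apply: rE; exact: comb1.
- by move=> y s; rewrite /lam; case: pselect => // h; apply: rE; exact: combyy.
- move=> T u v s uc vc sc uv.
  rewrite (_ : (fun x => _) = (fun x => r (SigSub (near _ _ (s x) (uv x))))).
    apply: (uc_comp rc); apply/uc_set_valP; exact: comb_uc.
  apply/funext => x; rewrite /lam; case: pselect => [h|/(_ (uv x)) []].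
  by congr (r (SigSub _)); exact: Prop_irrelevance.
- move=> B eB.
  have [U [F /collar_entP[h h0 hF] FU] UB] := (ucP _).1 rc _ eB.
  pose m := Num.min e h; have m0 : 0 < m by rewrite lt_min e0 h0.
  have m2 : 0 < m / 2 by rewrite divr_gt0.
  have [me mh] : m <= e /\ m <= h by rewrite /m !ge_min !lexx orbT.
  exists [set z | d z.1 z.2 < m / 2]; first exact: (bm_ent dm).
  move=> y u v /= yu yv.
  have uv : d u v < e.
    by have := bmD dm u y v; rewrite (bmC dm u y); lra.
  split=> // s; rewrite /lam; case: pselect => // h'.
  have yy : d y y < e by rewrite (bmxx dm).
  have <- : r (SigSub (near y y s yy)) = y by apply: rE; exact: combyy.
  apply: UB; apply: FU; apply: hF; rewrite [set_val _]combyy.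
  by apply: le_lt_trans (comb_dist y u v s) _; lra.
Qed.

End ANR_consequences.


(** * Approximation of maps of the limit *)

Section approximation.
Variables (R : realType) (Y : uniformType).
Hypothesis Y_ANR : uniform_ANR R Y.
Variables (X : nat -> uniformType) (p : forall i, X i.+1 -> X i).
Hypothesis X_metrizable : forall i, metrizable R (X i).
Hypothesis pc : forall i, unif_continuous (@p i).
Variables (f : invlim p -> Y).
Hypothesis fc : unif_continuous f.

Definition shadow i (D : set (X i * X i)) : set (X i) :=
  [set z | exists x : invlim p, D (invlim_proj i x, z)].

(** Up to a given error, [f] has a Lipschitz extension to a term [X i] as a map
    into functions on [Y], by McShane's formula. Placed at a constant positive
    height in the collar of [Y], this extension may be retracted to [Y] near the
    image of the limit. *)
Lemma ANR_approximation (V : set (Y * Y)) : entourage V ->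
  exists i (D : set (X i * X i)), entourage D /\
  exists2 psi : shadow D -> Y, unif_continuous psi &
    forall x (z : shadow D), D (invlim_proj i x, set_val z) -> V (f x, psi z).
Proof.
move=> eV; have [d dm] := metrizable_bounded Y_ANR.1.
have [e e0 [r rc rE]] := ANR_collar_retraction dm Y_ANR.
have [U [F /collar_entP[h h0 hF] FU] UV] := (ucP _).1 rc _ eV.
pose c := Num.min 1 (Num.min e h) / 3.
have m0 : 0 < Num.min 1 (Num.min e h) by rewrite !lt_min ltr01 e0 h0.
have c0 : 0 < c by rewrite divr_gt0.
have [c1 ce ch] : [/\ c <= 1, c * 2 < e & c * 2 < h].
  have cE : c * 3 = Num.min 1 (Num.min e h) by rewrite /c mulfVK.
  have m1 : c * 3 <= 1 by rewrite cE ge_min lexx.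
  have m2 : c * 3 <= e by rewrite cE !ge_min lexx !orbT.
  have m3 : c * 3 <= h by rewrite cE !ge_min lexx !orbT.
  by split; lra.
have [C eC CV] := (ucP _).1 fc _ (bm_ent dm c0).
have [i [B [eB BC]]] := (invlim_entP pc _).1 eC.
have [t tm] := metrizable_bounded (X_metrizable i).
have [k k0 kB] := (bm_entP tm _).1 eB.
(* [d] is bounded by [1], so it cannot exceed the linear term beyond distance [k] *)
have near x x' : d (f x) (f x') <= c + t (invlim_proj i x) (invlim_proj i x') / k.
  have [xx|xx] := ltP (t (invlim_proj i x) (invlim_proj i x')) k.
    have := CV _ _ (BC _ _ (kB _ _ xx)) => /= /ltW /le_trans; apply.
    by rewrite lerDl divr_ge0 ?(bm_ge0 tm) // ltW.
  apply: le_trans (bm_le1 dm _ _) _.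
  have : 1 <= t (invlim_proj i x) (invlim_proj i x') / k by rewrite ler_pdivlMr ?mul1r.
  lra.
(* the infimum of [S z y] is the value at [y] of McShane's extension at [z] *)
pose S z y : set R := [set d (f x) y + t (invlim_proj i x) z / k | x in [set: invlim p]].
have S_lb z y : lbound (S z y) 0.
  by move=> _ [x _ <-]; rewrite addr_ge0 ?(bm_ge0 dm) // divr_ge0 ?(bm_ge0 tm) // ltW.
have S_lip z z' y : inf (S z y) <= inf (S z' y) + t z z' / k.
  have [S0|/set0P ne] := eqVneq (S z' y) set0.
    have -> : S z y = set0.
      apply/seteqP; split=> // _ [x _ <-].
      have : S z' y (d (f x) y + t (invlim_proj i x) z' / k) by exists x.
      by rewrite S0.
    by rewrite S0 lerDl divr_ge0 ?(bm_ge0 tm) // ltW.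
  rewrite -lerBlDr; apply: lb_le_inf => // _ [x _ <-]; rewrite lerBlDr.
  apply: (@le_trans _ _ (d (f x) y + t (invlim_proj i x) z / k)).
    by apply: ge_inf; [exists 0|exists x].
  rewrite -addrA lerD2l -mulrDl ler_pM2r ?invr_gt0 // (bmC tm z z').
  exact: (bmD tm).
pose g z y := Num.min 1 (inf (S z y)).
have gP z : collar_pred d (g z, c).
  split=> [y|/=|/= c00]; [|by rewrite (ltW c0) c1|by rewrite c00 ltxx in c0].
  rewrite /g /= le_min ler01 ge_min lexx /= andbT.
  have [->|/set0P ne] := eqVneq (S z y) set0; first by rewrite inf0.
  exact: lb_le_inf.
pose G z : collar d := exist _ _ (gP z).
have G_uc : unif_continuous G.
  apply/ucP => P /collar_entP[a a0 aP].
  have ka : 0 < k * a by rewrite mulr_gt0.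
  exists [set z | t z.1 z.2 < k * a]; first exact: (bm_ent tm).
  move=> z z' /= zz; apply: aP.
  have zz' : t z z' / k < a by rewrite ltr_pdivrMr // mulrC.
  apply: le_lt_trans zz'; apply/collar_distP.
  split=> [|y] /=; first by rewrite subrr normr0 divr_ge0 ?(bm_ge0 tm) // ltW.
  have := S_lip z z' y; have := S_lip z' z y; rewrite (bmC tm z' z) => h1 h2.
  have tk : 0 <= t z z' / k by rewrite divr_ge0 ?(bm_ge0 tm) // ltW.
  rewrite /g ler_norml.
  by case: (leP 1 (inf (S z y))) => ?; case: (leP 1 (inf (S z' y))) => ?;
    apply/andP; split; lra.
have G_near x z : t (invlim_proj i x) z < k * c ->
    collar_dist (collar_in dm (f x)) (G z) <= c * 2.
  move=> xz; have xz' : t (invlim_proj i x) z / k < c by rewrite ltr_pdivrMr // mulrC.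
  apply/collar_distP; split=> [|y] /=; first by rewrite sub0r normrN ger0_norm; lra.
  have ub : inf (S z y) <= d (f x) y + c.
    apply: (@le_trans _ _ (d (f x) y + t (invlim_proj i x) z / k)).
      by apply: ge_inf; [exists 0|exists x].
    by rewrite lerD2l ltW.
  have lb : d (f x) y - c * 2 <= inf (S z y).
    apply: lb_le_inf; first by exists (d (f x) y + t (invlim_proj i x) z / k), x.
    move=> _ [x' _ <-].
    have h1 := bmD dm (f x) (f x') y; have h2 := near x x'.
    have h3 : t (invlim_proj i x) (invlim_proj i x') / k <=
        t (invlim_proj i x) z / k + t (invlim_proj i x') z / k.
      by rewrite -mulrDl ler_pM2r ?invr_gt0 // (bmC tm (invlim_proj i x') z); exact: (bmD tm).
    by lra.
  have := bm_ge0 dm (f x) y; have := bm_le1 dm (f x) y.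
  rewrite /g ler_norml => d1 d0.
  by case: (leP 1 (inf (S z y))) => ?; apply/andP; split; lra.
pose D : set (X i * X i) := [set z | t z.1 z.2 < k * c].
have sub (z : shadow D) : G (set_val z) \in collar_nbhd dm e.
  have [x /= xz] := set_valP z; apply/mem_set; exists (f x).
  by apply: le_lt_trans (G_near _ _ xz) _.
have fsub y : collar_in dm y \in collar_nbhd dm e.
  by apply/mem_set; exists y; rewrite collar_distxx.
exists i, D; split; first by apply: (bm_ent tm); rewrite mulr_gt0.
exists (fun z => r (SigSub (sub z))).
  apply: (uc_comp rc); apply/uc_set_valP.
  exact: (uc_comp G_uc (@uc_set_val _ _)).
move=> x z xz; have <- : r (SigSub (fsub (f x))) = f x by apply: rE.
by apply: UV; apply: FU; apply: hF; apply: le_lt_trans (G_near _ _ xz) _.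
Qed.

End approximation.

Section convergence.
Variables (X : nat -> uniformType) (p : forall i, X i.+1 -> X i).
Hypothesis pc : forall i, unif_continuous (@p i).
Hypothesis conv : convergent p.

Let W n : uniformType := projT1 (stage X n).
Let inc n : X n -> W n := projT2 (stage X n).

Lemma stage_index_incl n (x : X n) : stage_index (inc x) = n.
Proof. by case: n x. Qed.

(** The thread of the point [x] of the summand [X n]: its images under the bonding
    maps below [n], and copies of it above. *)
Fixpoint level_fun n (x : X n) (m : nat) : W m :=
  match m return W m with
  | 0 => inc (bond p (leq0n n) x)
  | k.+1 => match decP (@idP (k.+1 <= n)%N) with
            | left h => inc (bond p h x)
            | right _ => inr (level_fun x k)
            end
  end.

Lemma level_fun_le n (x : X n) m (h : (m <= n)%N) : level_fun x m = inc (bond p h x).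
Proof.
case: m h => [|m] h /=; first by rewrite (eq_irrelevance h (leq0n n)).
by case: decP => // h'; rewrite (eq_irrelevance h h').
Qed.

Lemma level_fun_gt n (x : X n) m : (n <= m)%N -> level_fun x m.+1 = inr (level_fun x m).
Proof. by move=> nm /=; case: decP => // h; have := h; rewrite ltnNge nm. Qed.

Lemma level_subproof n (x : X n) : invlim_set (@stage_bond X p) (level_fun x).
Proof.
move=> m; have [mn|nm] := leqP m.+1 n; last by rewrite level_fun_gt.
rewrite (level_fun_le _ mn) (level_fun_le _ (ltnW mn)).
rewrite -(bond_comp _ (leqnSn m) mn); set v := bond _ mn x.
by rewrite (bondS _ (leqnn m)) bond_refl.
Qed.

Definition level_pt n (x : X n) : XNoo p := invlim_mk (level_subproof x).

Lemma level_ptP n (x : X n) : level_set n (level_pt x).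
Proof.
move=> m; rewrite invlim_projE; have [mn|/ltnW nm] := leqP m n.
  by rewrite (level_fun_le _ mn) stage_index_incl.
rewrite -(subnK nm); elim: (m - n)%N => [|k ih].
  by rewrite (level_fun_le _ (leqnn n)) stage_index_incl.
by rewrite addSn level_fun_gt ?leq_addl.
Qed.

Lemma stage_ent n (D : set (X n * X n)) : entourage D ->
  exists2 E : set (W n * W n), entourage E &
    forall x y, E (inc x, inc y) -> D (x, y).
Proof.
case: n D => [|n] D eD; first by exists D.
exists [set z | match z with (inl x, inl y) => D (x, y) | (inr _, inr _) => True
   | _ => False end] => //.
split; first by apply: filterS eD => -[].
by apply: filterS entourageT => -[].
Qed.

Lemma convergent_shadow i (D : set (X i * X i)) : entourage D ->
  exists N, forall n (h : (i <= n)%N) (x : X n), (N <= n)%N -> shadow p D (bond p h x).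
Proof.
move=> /stage_ent[E eE ED].
pose U : set (XNoo p) := [set w | exists x : invlim p,
  E (inc (invlim_proj i x), invlim_proj i w)].
have [|N _ NU] := conv (U := U).
  have /ucP/(_ _ eE)[F eF FE] := @uc_invlim_proj _ (@stage_bond X p) i.
  by exists F => // _ y [x _ <-] /FE xy; exists x.
exists N => n h x Nn; have [|y] := NU n Nn (level_pt x); first exact: level_ptP.
by rewrite invlim_projE (level_fun_le _ h) => /ED; exists y.
Qed.

(** Finitely many conditions of closeness to the limit are pulled back to a
    common later term, so a single point of the limit meets them all. *)
Lemma convergent_shadows (i : nat -> nat) (D : forall j, set (X (i j) * X (i j))) :
  (forall j, entourage (D j)) -> forall m, exists N, forall n, (N <= n)%N ->
  forall x : X n, exists y : invlim p, forall j, (j <= m)%N ->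
  forall h : (i j <= n)%N, D j (invlim_proj (i j) y, bond p h x).
Proof.
move=> eD m; pose c := (\max_(j < m.+1) i j)%N.
have ic j : (j <= m)%N -> (i j <= c)%N.
  by rewrite -ltnS => jm; exact: (leq_bigmax (Ordinal jm)).
pose C : set (X c * X c) := [set z | forall j (jm : (j <= m)%N),
  D j (bond p (ic j jm) z.1, bond p (ic j jm) z.2)].
have eC : entourage C.
  apply: ent_bigI => j jm.
  have [A eA AD] := (ucP _).1 (uc_bond pc (ic j jm)) _ (eD j).
  by apply: filterS eA => -[x y]; exact: AD.
have [N NC] := convergent_shadow eC.
exists (maxn N c) => n; rewrite geq_max => /andP[Nn cn] x.
have [y yx] := NC n cn x Nn; exists y => j jm h.
by have := yx j jm; rewrite /= invlim_bond (bond_comp _ _ _ h).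
Qed.

End convergence.


(** * Ladders with short homotopies *)

Section tolerances.
Variables (R : realType) (Y : nat -> uniformType) (q : forall i, Y i.+1 -> Y i).
Hypothesis qc : forall i, unif_continuous (@q i).
Variable d : forall i, Y i -> Y i -> R.
Hypothesis dm : forall i, bounded_metric (@d i).
Variables (E0 : forall i, set (Y i * Y i)) (lam : forall i, Y i -> Y i -> unitI R -> Y i).
Hypothesis paths : forall i, path_structure (@E0 i) (@lam i).

(** The bound tends to zero with [j] simultaneously in all earlier terms; this is
    what makes the maps built from such paths continuous at infinity. *)
Definition short_paths j (P : set (Y j.+1 * Y j.+1)) : Prop :=
  forall y u v, P (y, u) -> P (y, v) -> E0 (u, v) /\
    forall s i (h : (i <= j.+1)%N), d (bond q h y) (bond q h (lam u v s)) < j.+1%:R^-1.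

(** Two nested scales are needed because paths will be joined by paths: paths
    between [T]-close points, and their images one term below, stay [P]-close. *)
Lemma tolerances : exists P T : forall j, set (Y j.+1 * Y j.+1),
  [/\ forall j, entourage (T j),
    forall j, short_paths (P j),
    forall j y u v, T j (y, u) -> T j (y, v) ->
      E0 (u, v) /\ forall s, P j (y, lam u v s) &
    forall j y u v, T j.+1 (y, u) -> T j.+1 (y, v) -> forall s,
      P j (q y, q (lam u v s))].
Proof.
have /all_sig[P PP] j : {P : set (Y j.+1 * Y j.+1) | entourage P /\ short_paths P}.
  apply: cid; have [_ _ _ _ small] := paths j.+1.
  pose O : set (Y j.+1 * Y j.+1) := [set z | forall i (h : (i <= j.+1)%N),
    d (bond q h z.1) (bond q h z.2) < j.+1%:R^-1].
  have eO : entourage O.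
    apply: ent_bigI => i h.
    have j0 : 0 < j.+1%:R^-1 :> R by rewrite invr_gt0.
    have [A eA AD] := (ucP _).1 (uc_bond qc h) _ (bm_ent (dm i) j0).
    by apply: filterS eA => -[x y]; exact: AD.
  have [D eD DO] := small _ eO; by exists D.
pose Q j : set (Y j * Y j) :=
  match j return set (Y j * Y j) with
  | 0 => setT
  | i.+1 => P i `&` match i return set (Y i.+1 * Y i.+1) with
                    | 0 => setT
                    | k.+1 => [set z | P k (q z.1, q z.2)] end
  end.
have eQ j : entourage (Q j).
  case: j => [|[|j]]; first exact: entourageT.
    by apply: filterI; [have [] := PP 0%N|exact: entourageT].
  apply: filterI; first by have [] := PP j.+1.
  have [eP _] := PP j; have [A eA AD] := (ucP _).1 (@qc j.+1) _ eP.
  by apply: filterS eA => -[x y]; exact: AD.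
have /all_sig[T TP] j : {T : set (Y j.+1 * Y j.+1) | entourage T /\
    forall y u v, T (y, u) -> T (y, v) -> E0 (u, v) /\ forall s, Q j.+1 (y, lam u v s)}.
  apply: cid; have [_ _ _ _ small] := paths j.+1.
  by have [T eT TQ] := small _ (eQ j.+1); exists T.
exists P, T; split.
- by move=> j; have [] := TP j.
- by move=> j; have [] := PP j.
- move=> j y u v yu yv; have [_ h] := TP j; have [uv lQ] := h _ _ _ yu yv.
  by split=> // s; have [] := lQ s.
- move=> j y u v yu yv s; have [_ h] := TP j.+1; have [uv lQ] := h _ _ _ yu yv.
  by have [_] := lQ s.
Qed.

End tolerances.

Lemma ANR_tolerances (R : realType) (Y : nat -> uniformType)
    (q : forall i, Y i.+1 -> Y i) :
  (forall i, uniform_ANR R (Y i)) -> (forall i, unif_continuous (@q i)) ->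
  exists (d : forall i, Y i -> Y i -> R) (E0 : forall i, set (Y i * Y i))
    (lam : forall i, Y i -> Y i -> unitI R -> Y i)
    (P T : forall j, set (Y j.+1 * Y j.+1)),
  [/\ (forall i, bounded_metric (d i)) /\ (forall i, path_structure (E0 i) (lam i)),
    (forall j, entourage (T j)) /\ (forall j, short_paths q d E0 lam (P j)),
    forall j y u v, T j (y, u) -> T j (y, v) ->
      E0 j.+1 (u, v) /\ forall s, P j (y, lam j.+1 u v s) &
    forall j y u v, T j.+1 (y, u) -> T j.+1 (y, v) -> forall s,
      P j (q j.+1 y, q j.+1 (lam j.+2 u v s))].
Proof.
move=> hY hq; have /all_sig[d dm] i := cid (metrizable_bounded (hY i).1).
have paths_ i : {E0 : set (Y i * Y i) & {lam | @path_structure R _ E0 lam}}.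
  by have /cid[E0 /cid[lam ?]] := ANR_paths (hY i); exists E0, lam.
have paths i : path_structure (projT1 (paths_ i)) (projT1 (projT2 (paths_ i))).
  exact: projT2 (projT2 (paths_ i)).
have [P [T [eT Psh TP Tq]]] := tolerances hq dm paths.
by exists d, (fun i => projT1 (paths_ i)), (fun i => projT1 (projT2 (paths_ i))), P, T.
Qed.

Section bridges.
Variables (R : realType) (Y : nat -> uniformType) (q : forall i, Y i.+1 -> Y i).
Hypothesis qc : forall i, unif_continuous (@q i).
Variable d : forall i, Y i -> Y i -> R.
Hypothesis dm : forall i, bounded_metric (@d i).
Variables (E0 : forall i, set (Y i * Y i)) (lam : forall i, Y i -> Y i -> unitI R -> Y i).
Hypothesis paths : forall i, path_structure (@E0 i) (@lam i).
Variable P : forall j, set (Y j.+1 * Y j.+1).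
Arguments P : clear implicits.
Hypothesis P_short : forall j, short_paths q d E0 lam (P j).

Variables (A : nat -> uniformType) (a : forall i, A i.+1 -> A i) (K : uniformType).
Variables (psi : forall j, A j * K -> Y j.+1).
Variables (theta : forall j, A j.+1 * unitI R * K -> Y j.+1).
Hypothesis psic : forall j, unif_continuous (@psi j).
Hypothesis thetac : forall j, unif_continuous (@theta j).
Hypothesis theta1 : forall j (x : A j.+1) k, theta (x, unitI1 R, k) = psi (a x, k).
Variable f : invlim a -> invlim q.
Hypothesis near : forall j (x : A j.+1), exists y : invlim q,
  [/\ forall i (h : (i <= j.+1)%N) k, P i (invlim_proj i.+1 y, psi (bond a h x, k)),
    forall t k, P j (invlim_proj j.+1 y, theta (x, t, k)) &
    forall k, P j (invlim_proj j.+1 y, q (psi (x, k)))].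
Hypothesis near_lim : forall x i k,
  P i (invlim_proj i.+1 (f x), psi (invlim_proj i x, k)).

(** The parameter of the bridge between [theta j] and [q (psi j.+1)], which is
    crossed in the upper half of the cylinder. *)
Definition bridge_time (t : unitI R) : unitI R := clip (1 - 2 * set_val t).

Lemma bridge_time0 : bridge_time (unitI0 R) = unitI1 R.
Proof. by apply: clip_ge1; rewrite /= mulr0 subr0. Qed.

Lemma bridge_time1 : bridge_time (unitI1 R) = unitI0 R.
Proof. by apply: clip_le0; rewrite /= mulr1; lra. Qed.

Definition bridge j (z : A j.+1 * unitI R * K) : Y j.+1 :=
  lam (theta z) (q (psi (z.1.1, z.2))) (bridge_time z.1.2).

Let inv_small (e : R) : 0 < e -> exists m, forall n, (m <= n)%N -> n.+1%:R^-1 < e.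
Proof.
move=> e0; exists (Num.bound e^-1) => n mn.
have e1 : 0 < e^-1 by rewrite invr_gt0.
rewrite -[e]invrK ltf_pV2 ?posrE //.
apply: lt_le_trans (archi_boundP (ltW e1)) _; rewrite ler_nat.
exact: leqW.
Qed.

(** Over levels between [j] and [j.+1] the values of a level-preserving map have
    coordinates in [Y j.+1], so the homotopy along a cylinder must run there and
    not in [Y j]. Therefore the ladder starts from maps [psi j] into [Y j.+1], and
    [q (psi j)] is used on the end [A j]. The homotopy [theta j] leads from [psi j] to a map close to
    [q (psi j.+1)], and the path structure fills the remaining gap. *)
Lemma xtel_bridge : exists H : xtel R a * K -> xtel R q,
  [/\ unif_continuous H,
    forall j (x : A j.+1) t k, H (emb (cyl a x t), k) =
      pt q (bridge (x, t, k)) (j.+1%:R - set_val t),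
    forall (x : A 0%N) k, H (@emb _ _ a 0 x, k) = pt q (q (psi (x, k))) 0,
    forall x k, H (xtel_lim R x, k) = xtel_lim R (f x) &
    forall k, level_preserving (fun w => H (w, k))].
Proof.
have bridgeE j (x : A j.+1) t k : E0 (theta (x, t, k), q (psi (x, k))).
  have [y [_ /(_ t k) h1 /(_ k) h2]] := near x.
  by have [] := P_short h1 h2.
have psi_d (y : invlim q) i (u : Y i.+1) m (h : (m <= i)%N) : P i (invlim_proj i.+1 y, u) ->
    d (invlim_proj m y) (bond q h (q u)) < i.+1%:R^-1.
  move=> yu; have [_ /(_ (unitI0 R) m (leqW h))] := P_short yu yu.
  by have [_ _ -> _ _] := paths i.+1; rewrite (invlim_bond (leqW h)) (bondS q h).
apply: (@xtel_ladder R A Y a q qc K (fun j z => q (psi z)) bridge _ _ _ _ f).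
- exact: (uc_comp (@qc 0) (@psic 0)).
- move=> j; have [_ _ _ luc _] := paths j.+1; apply: luc => //; last by move=> [[x t] k].
    apply: (uc_comp (@qc _)); apply: (uc_comp2 (h := fun x k => psi (x, k))).
    + rewrite (_ : (fun z => _) = @psi j.+1) //; by apply/funext => -[].
    + exact: (uc_comp (@uc_fst _ _) (@uc_fst _ _)).
    + exact: uc_snd.
  apply: (uc_comp (@uc_clip R)); apply: uc_sub; first exact: uc_cst.
  apply: uc_scale.
  exact: (uc_comp (@uc_set_val _ _) (uc_comp (@uc_snd _ _) (@uc_fst _ _))).
- move=> j x k; have [_ l1 _ _ _] := paths j.+1.
  by rewrite /bridge /= bridge_time0 l1.
- move=> j x k; have [l0 _ _ _ _] := paths j.+1.
  by rewrite /bridge /= bridge_time1 l0 theta1.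
move=> M V /(bm_entP (dm M))[e e0 eV].
(* the two errors that occur below are halves of [e] *)
have [N0 N0e] : exists m, forall n, (m <= n)%N -> n.+1%:R^-1 < e / 2.
  by apply: inv_small; rewrite divr_gt0.
pose m := maxn M N0; have Mm : (M <= m)%N := leq_maxl _ _.
have Ne n : (m <= n)%N -> n.+1%:R^-1 < e / 2 by move=> mn; apply: N0e; rewrite (leq_trans _ mn) // leq_maxr.
exists m, Mm; split=> [j mj x t k|x k]; apply: eV.
  have [y [h1 h2 h3]] := near x.
  have d1 := psi_d y m _ M Mm (h1 m (leqW mj) k).
  have [_ /(_ (bridge_time t) M (leqW (leq_trans Mm mj)))] := P_short (h2 t k) (h3 k).
  rewrite invlim_bond => d2; have e1 := Ne _ (leqnn m); have e2 := Ne _ mj.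
  apply: le_lt_trans (bmD (dm M) _ (invlim_proj M y) _) _.
  rewrite [e]splitr; apply: ltrD; last exact: lt_trans d2 e2.
  by rewrite (bmC (dm M)); exact: lt_trans d1 e1.
have d1 := psi_d (f x) m _ M Mm (near_lim x m k).
rewrite (bmC (dm M)); apply: lt_trans (lt_trans d1 (Ne _ (leqnn m))) _; lra.
Qed.

End bridges.


(** * Existence of a level-preserving extension *)

Section subsequences.
Variables (X : nat -> uniformType) (p : forall i, X i.+1 -> X i).
Variables (n : nat -> nat) (hn : increasing n).

Lemma increasing_mono i j : (i <= j)%N -> (n i <= n j)%N.
Proof. by rewrite leq_eqVlt => /predU1P[->//|/hn/ltnW]. Qed.

Lemma sub_bondE i j (h : (i <= j)%N) (h' : (n i <= n j)%N) (x : X (n j)) :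
  bond (sub_bond p hn) h x = bond p h' x.
Proof.
elim: j h h' x => [|j ih] h h' x.
  have i0 : i = 0%N by apply/eqP; rewrite -leqn0.
  by subst i; rewrite !bond_refl.
have [ij|ji] := leqP i j.
  rewrite (bondS _ ij) (ih ij (increasing_mono ij)) /sub_bond.
  by rewrite (bond_comp _ _ _ h').
have ij : i = j.+1 by apply/eqP; rewrite eqn_leq h ji.
by subst i; rewrite !bond_refl.
Qed.

Lemma sub_lim_inj : injective (@sub_lim X p n hn).
Proof.
move=> x y xy; apply: invlim_eqP => i; have ni := increasing_geid hn i.
rewrite -!(invlim_bond ni); congr bond.
exact: (congr1 (invlim_proj i) xy).
Qed.

Lemma sub_lim_surj (y : invlim (sub_bond p hn)) : exists x, sub_lim hn x = y.
Proof.
pose x i := bond p (increasing_geid hn i) (invlim_proj i y : X (n i)).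
have xP : invlim_set p x.
  move=> i; rewrite /x -(invlim_projP i y) /sub_bond.
  have h : (i <= n i.+1)%N by rewrite (leq_trans (leqnSn i)) // increasing_geid.
  rewrite (bond_comp p _ _ h).
  rewrite -(bond_comp p (leqnSn i) (increasing_geid hn i.+1)).
  by rewrite (bondS _ (leqnn i)) bond_refl.
exists (invlim_mk xP); apply: invlim_eqP => i.
have -> : invlim_proj i (sub_lim hn (invlim_mk xP)) = x (n i) by [].
have ni := increasing_geid hn i.
rewrite -(invlim_bond ni y) (sub_bondE ni (increasing_mono ni)) /x.
by congr (bond p _ _); exact: Prop_irrelevance.
Qed.

Lemma sub_lim_ext (S : Type) (f : invlim p -> S) :
  exists f' : invlim (sub_bond p hn) -> S, forall x, f' (sub_lim hn x) = f x.
Proof.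
exists (fun y => f (projT1 (cid (sub_lim_surj y)))) => x.
by case: (cid _) => y /= /sub_lim_inj ->.
Qed.

End subsequences.

Lemma increasing_above (N : nat -> nat) : exists2 n, increasing n &
  forall i, (N i <= n i)%N.
Proof.
exists (fun i => \sum_(k < i.+1) (N k).+1)%N => [i j|i]; last first.
  by rewrite big_ord_recr /= (leq_trans _ (leq_addl _ _)).
move=> ij; have -> : j = (j - i.+1 + i.+1)%N by rewrite subnK.
elim: (j - i.+1)%N => [|k ih].
  by rewrite add0n [ltnRHS]big_ord_recr /= addnS ltnS leq_addr.
by rewrite addSn [ltnRHS]big_ord_recr /= (leq_trans ih) // leq_addr.
Qed.

Section existence.
Variables (R : realType) (Y : nat -> uniformType) (q : forall i, Y i.+1 -> Y i).
Hypothesis hY : forall i, uniform_ANR R (Y i).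
Hypothesis hq : forall i, unif_continuous (@q i).
Variables (X : nat -> uniformType) (p : forall i, X i.+1 -> X i).
Hypothesis hX : forall i, metrizable R (X i).
Hypothesis hp : forall i, unif_continuous (@p i).
Hypothesis hconv : convergent p.
Variable f : invlim p -> invlim q.
Hypothesis hf : unif_continuous f.

(** For each [j] the [j.+1]-st coordinate of [f] is approximated by a map of the
    shadow of the limit in some term of [X]; by convergence, [n j] may be chosen so
    that [X (n j)] is mapped to the first [j.+1] of these shadows, all conditions
    being witnessed by the same point of the limit. The bridges between these maps
    have constant [theta]. *)
Lemma level_extension_exists : exists (n : nat -> nat) (hn : increasing n)
  (fn : sub_xtel R p hn -> xtel R q), level_extension f fn.
Proof.
have [d [E0 [lam [P [T [[dm paths] [eT Psh] TP Tq]]]]]] := ANR_tolerances hY hq.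
have lamxx i (y : Y i) s : lam i y y s = y by have [_ _ h _ _] := paths i.
have dat j : {i : nat & {D : set (X i * X i) & {psi : shadow p D -> Y j.+1 |
   [/\ entourage D, unif_continuous psi & forall x (z : shadow p D),
     D (invlim_proj i x, set_val z) -> T j (invlim_proj j.+1 (f x), psi z)]}}}.
  have fc : unif_continuous (fun x => invlim_proj j.+1 (f x)).
    exact: (uc_comp (@uc_invlim_proj _ _ _) hf).
  have /cid[i /cid[D [eD /cid2[psi psic psiT]]]] :=
    ANR_approximation (hY j.+1) hX hp fc (eT j).
  by exists i, D, psi.
pose ix j := projT1 (dat j); pose D j := projT1 (projT2 (dat j)).
pose ps j : shadow p (D j) -> Y j.+1 := projT1 (projT2 (projT2 (dat j))).
have datP j : [/\ entourage (D j), unif_continuous (ps j) & forall x (z : shadow p (D j)),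
     D j (invlim_proj (ix j) x, set_val z) -> T j (invlim_proj j.+1 (f x), ps j z)].
  exact: projT2 (projT2 (projT2 (dat j))).
have eD j : entourage (D j) by have [] := datP j.
have /choice[N NP] := convergent_shadows hp hconv eD.
have [n hn nN] := increasing_above (fun j => N j + ix j)%N.
have ixn i j : (i <= j)%N -> (ix i <= n j)%N.
  move=> ij; apply: leq_trans (increasing_mono hn ij).
  by apply: leq_trans (nN i); exact: leq_addl.
have Nn j : (N j <= n j)%N by apply: leq_trans (nN j); exact: leq_addr.
have sub j (x : X (n j)) : bond p (ixn j j (leqnn j)) x \in shadow p (D j).
  by have [y yx] := NP j (n j) (Nn j) x; apply/mem_set; exists y; exact: yx.
pose psi j (x : X (n j)) : Y j.+1 := ps j (SigSub (sub j x)).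
have psic j : unif_continuous (psi j).
  have [_ psc _] := datP j; apply: (uc_comp psc); apply/uc_set_valP.
  exact: (uc_bond hp).
have psiT j y (x : X (n j)) : D j (invlim_proj (ix j) y, bond p (ixn j j (leqnn j)) x) ->
    T j (invlim_proj j.+1 (f y), psi j x).
  by have [_ _ h] := datP j; move=> yx; exact: h.
have TPP j y u : T j (y, u) -> P j (y, u).
  by move=> yu; have [_ /(_ (unitI0 R))] := TP _ _ _ _ yu yu; rewrite lamxx.
have [f' f'E] := sub_lim_ext hn f.
have [|||||H [Hc _ _ Hl Hlev]] := @xtel_bridge R Y q hq d dm E0 lam paths P Psh
  (sub_seq X n) (sub_bond p hn) (unitI R) (fun j z => psi j z.1)
  (fun j z => psi j (sub_bond p hn z.1.1)) _ _ _ f'.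
- by move=> j; exact: (uc_comp (psic j) (@uc_fst _ _)).
- move=> j; apply: (uc_comp (psic j)); apply: (uc_comp (uc_bond hp _)).
  exact: (uc_comp (@uc_fst _ _) (@uc_fst _ _)).
- by [].
- move=> j x; have [y yx] := NP j.+1 (n j.+1) (Nn j.+1) x.
  have yT i (h : (i <= j.+1)%N) :
      T i (invlim_proj i.+1 (f y), psi i (bond (sub_bond p hn) h x)).
    apply: psiT; rewrite (sub_bondE p hn h (increasing_mono hn h)).
    by rewrite (bond_comp _ _ _ (ixn i j.+1 h)); exact: yx.
  exists (f y); split=> [i h k|t k|k] /=; first exact/TPP/yT.
    have -> : sub_bond p hn x = bond (sub_bond p hn) (leqnSn j) x.
      by rewrite (bondS _ (leqnn j)) bond_refl.
    exact: (TPP _ _ _ (yT j (leqnSn j))).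
  have := Tq _ _ _ _ (yT j.+1 (leqnn _)) (yT j.+1 (leqnn _)) (unitI0 R).
  by rewrite lamxx bond_refl invlim_projP.
- move=> x j k; have [y <-] := sub_lim_surj x; rewrite f'E; apply/TPP/psiT.
  have -> : bond p (ixn j j (leqnn j)) (invlim_proj j (sub_lim hn y)) =
      invlim_proj (ix j) y := invlim_bond (ixn j j (leqnn j)) y.
  exact: (entourage_refl _ (eD j)).
exists n, hn, (fun w => H (w, unitI0 R)); split.
- exact: uc_slice.
- exact: Hlev.
- by move=> x; rewrite /sub_xtel_lim Hl f'E.
Qed.

End existence.


(** * Pushing points up the telescope *)

Section homotopies.
Variables (R : realType) (X Y : nat -> uniformType).
Variables (p : forall i, X i.+1 -> X i) (q : forall i, Y i.+1 -> Y i).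
Variables (f : invlim p -> invlim q) (n : nat -> nat) (hn : increasing n).
Implicit Types F G : sub_xtel R p hn -> xtel R q.

Lemma homotopic_sym F G : homotopic_through_level_extensions f F G ->
  homotopic_through_level_extensions f G F.
Proof.
move=> [H [Hc H0 H1 Hl]]; exists (fun z => H (z.1, clip (1 - set_val z.2))); split.
- apply: (uc_comp Hc); apply: uc_pair; first exact: uc_fst.
  apply: (uc_comp (@uc_clip R)); apply: uc_sub; first exact: uc_cst.
  exact: (uc_comp (@uc_set_val _ _) (@uc_snd _ _)).
- by move=> w; rewrite clip_ge1 ?H1 //= subr0.
- by move=> w; rewrite clip_le0 ?H0 //= subrr.
- by move=> t; exact: (Hl (clip (1 - set_val t))).
Qed.

Lemma homotopic_trans F G G' : homotopic_through_level_extensions f F G ->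
  homotopic_through_level_extensions f G G' ->
  homotopic_through_level_extensions f F G'.
Proof.
move=> [H [Hc H0 H1 Hl]] [H' [Hc' H0' H1' Hl']].
pose J (z : sub_xtel R p hn * R) := if z.2 <= 1 / 2 then H (z.1, clip (2 * z.2))
  else H' (z.1, clip (2 * z.2 - 1)).
have Jr w s : 1 / 2 <= s -> J (w, s) = H' (w, clip (2 * s - 1)).
  rewrite le_eqVlt => /predU1P[<-|s2]; last by rewrite /J leNgt s2.
  rewrite /J /= lexx clip_ge1; last by lra.
  by rewrite clip_le0 ?H1 ?H0' //; lra.
have Jl w s : s <= 1 / 2 -> J (w, s) = H (w, clip (2 * s)) by rewrite /J /= => ->.
have Jc : unif_continuous J.
  apply: (@uc_glue _ _ _ _ (1 / 2)).
    rewrite (_ : (fun z => _) = fun z : sub_xtel R p hn * R =>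
      H (z.1, clip (2 * Num.min z.2 (1 / 2)))); last first.
      by apply/funext => -[w s]; rewrite Jl //= ge_min lexx orbT.
    apply: (uc_comp Hc); apply: uc_pair; first exact: uc_fst.
    apply: (uc_comp (@uc_clip R)); apply: uc_scale.
    exact: (uc_min (@uc_snd _ _) (uc_cst _ _)).
  rewrite (_ : (fun z => _) = fun z : sub_xtel R p hn * R =>
    H' (z.1, clip (2 * Num.max z.2 (1 / 2) - 1))); last first.
    by apply/funext => -[w s]; rewrite Jr //= le_max lexx orbT.
  apply: (uc_comp Hc'); apply: uc_pair; first exact: uc_fst.
  apply: (uc_comp (@uc_clip R)); apply: uc_sub; last exact: uc_cst.
  apply: uc_scale; exact: (uc_max (@uc_snd _ _) (uc_cst _ _)).
exists (fun z => J (z.1, set_val z.2)); split.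
- apply: (uc_comp Jc); apply: uc_pair; first exact: uc_fst.
  exact: (uc_comp (@uc_set_val _ _) (@uc_snd _ _)).
- move=> w /=; have -> : set_val (unitI0 R) = 0 by [].
  by rewrite Jl ?mulr0 ?clip_le0 ?H0 //; lra.
- move=> w /=; have -> : set_val (unitI1 R) = 1 by [].
  by rewrite Jr ?clip_ge1 ?H1' //; lra.
- move=> t; have [t2|/ltW t2] := leP (set_val t) (1 / 2).
    rewrite (_ : (fun w => _) = fun w => H (w, clip (2 * set_val t))) //.
    by apply/funext => w; rewrite Jl.
  rewrite (_ : (fun w => _) = fun w => H' (w, clip (2 * set_val t - 1))) //.
  by apply/funext => w; rewrite Jr.
Qed.

End homotopies.

Section telescope_maps.
Variables (R : realType) (A B : nat -> uniformType).
Variables (g : forall i, A i.+1 -> A i) (h : forall i, B i.+1 -> B i).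
Variable u : forall i, A i -> B i.
Hypothesis hu : forall i (x : A i.+1), h (u x) = u (g x).

Lemma tel_map_cyl m (x : A m.+1) t :
  @tel_map R A B g h u m.+1 (cyl g x t) = cyl h (u x) t.
Proof.
rewrite /cyl tel_map_inr //; congr tel_inr.
by rewrite /MC_map uquot_liftE //; exact: MC_map_compat.
Qed.

Lemma tel_map_track m (x : A m) (s : R) :
  tel_map h u (track g x s) = track h (u x) s.
Proof.
elim: m x => [//|m ih] x; have [sm|/ltW ms] := leP s m%:R.
  by rewrite !track_lo // tel_map_inl // ih hu.
by rewrite !track_hi // tel_map_cyl.
Qed.

Lemma xtel_map_emb m (v : tel R g m) : xtel_map hu (emb v) = emb (tel_map h u v).
Proof.
have projE k w : invlim_proj k (xtel_map hu w) = tel_map h u (invlim_proj k w) by [].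
apply: emb_unique => [|k mk]; first by rewrite projE proj_emb.
by rewrite !projE proj_emb_gt // tel_map_inl.
Qed.

Lemma xtel_map_lim (x : invlim g) (y : invlim h) :
  (forall m, invlim_proj m y = u (invlim_proj m x)) ->
  xtel_map hu (xtel_lim R x) = xtel_lim R y.
Proof.
move=> yx; apply: invlim_eqP => m.
transitivity (tel_map h u (tel_incl R g (invlim_proj m x))); first by [].
by rewrite tel_map_incl // -yx.
Qed.

End telescope_maps.

Section subsequence_maps.
Variables (R : realType) (X : nat -> uniformType) (p : forall i, X i.+1 -> X i).
Variables (n k : nat -> nat) (hn : increasing n) (hk : increasing k).

Local Notation hl := (increasing_comp hn hk).

Lemma sub_bond_comp i j (h : (i <= j)%N) (x : X (n (k j))) :
  bond (sub_bond p hl) h x = bond (sub_bond p hn) (increasing_mono hk h) x.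
Proof.
have h' := increasing_mono hn (increasing_mono hk h).
by rewrite (sub_bondE p hl h h') (sub_bondE p hn (increasing_mono hk h) h').
Qed.

Lemma sub_xtel_map_pt j (x : X (n (k j))) (s : R) : s <= j%:R ->
  sub_xtel_map R p hn hk (@pt R _ (sub_bond p hl) j x s) =
  @pt R _ (sub_bond p hn) (k j) x s.
Proof.
move=> sj; rewrite /sub_xtel_map /pt xtel_map_emb tel_map_track; last first.
  move=> i y; rewrite /sub_bond.
  by rewrite !(bond_comp _ _ _ (leq_trans (increasing_leS hn i) (increasing_le hn hk i.+1))).
rewrite -/(pt _ _ _) -/(pt _ _ _) (pt_bond (sub_bond p hn) (increasing_geid hk j) x sj).
by rewrite (sub_bondE p hn _ (increasing_le hn hk j)).
Qed.

Lemma sub_xtel_map_lim (x : invlim p) :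
  sub_xtel_map R p hn hk (sub_xtel_lim R hl x) = sub_xtel_lim R hn x.
Proof.
apply: xtel_map_lim => m; symmetry.
exact: (invlim_bond (increasing_le hn hk m) x).
Qed.

End subsequence_maps.

Section cuts.
Variables (R : realType) (B : nat -> uniformType).
Variable b : forall i, B i.+1 -> B i.

Lemma xtel_fin_pt (z : xtel R b) (s : R) : xtel_level z = s%:E ->
  exists j (y : B j), 0 <= s <= j%:R /\ z = pt b y s.
Proof.
move=> zs; have [[m [v zv]]|[x zx]] := xtel_cases z; last first.
  by move: zs; rewrite zx xtel_level_lim.
have [j [y [s' [sj vE]]]] := emb_pt v; exists j, y.
suff -> : s = s' by rewrite zv.
have /andP[s0 s1] := sj.
by move: zs; rewrite zv vE xtel_level_pt // min_l // => -[].
Qed.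

Variable rho : xtel R b * R -> xtel R b.
Hypothesis rhoE : forall j (y : B j) s c, s <= j%:R ->
  rho (pt b y s, c) = pt b y (Num.min s c).

Lemma cut_level z s c : xtel_level z = s%:E -> 0 <= c ->
  xtel_level (rho (z, c)) = (Num.min s c)%:E.
Proof.
move=> /xtel_fin_pt[j [y [/andP[s0 sj] ->]]] c0.
by rewrite rhoE // xtel_level_pt ?le_min ?s0 // (min_l (_ : _ <= j%:R)) // ge_min sj.
Qed.

Lemma cut_id z s : xtel_level z = s%:E -> rho (z, s) = z.
Proof.
by move=> /xtel_fin_pt[j [y [/andP[s0 sj] ->]]]; rewrite rhoE // minxx.
Qed.

Lemma cut_top m z s c (y : B m) : xtel_level z = s%:E -> c <= m%:R ->
  invlim_proj m z = tel_incl R b y -> rho (z, c) = pt b y c.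
Proof.
move=> zs cm zy; have := xtel_level_proj m zs.
rewrite zy tel_level_incl => ms; have {}ms : m%:R <= s by rewrite ms ge_min lexx.
have [j [y' [/andP[s0 sj] zE]]] := xtel_fin_pt zs.
have mj : (m <= j)%N by rewrite -(ler_nat R) (le_trans ms).
move: zy; rewrite zE (proj_pt_hi b _ mj ms) => /tel_incl_inj <-.
by rewrite rhoE // min_r ?(le_trans cm) // (pt_bond b mj).
Qed.

Lemma emb_cyl m (y : B m.+1) (t : unitI R) : emb (cyl b y t) = pt b y (m.+1%:R - set_val t).
Proof.
have t1 := unitI_le1 t.
rewrite /pt track_hi; last by rewrite -natr1; lra.
by rewrite opprB addrC subrK clipK.
Qed.

Lemma emb_cases m (v : tel R b m) : (exists y : B 0%N, emb v = @emb R B b 0 y) \/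
  (exists j (y : B j.+1) t, emb v = emb (cyl b y t)).
Proof.
elim: m v => [|m ih] v; first by left; exists v.
elim/tel_cyl_ind: v => [v|y t]; first by rewrite emb_inl.
by right; exists m, y, t.
Qed.

Lemma xtel_eq_fun (S : Type) (G G' : xtel R b -> S) :
  (forall y : B 0%N, G (@emb R B b 0 y) = G' (@emb R B b 0 y)) ->
  (forall j (y : B j.+1) t, G (emb (cyl b y t)) = G' (emb (cyl b y t))) ->
  (forall x, G (xtel_lim R x) = G' (xtel_lim R x)) -> G =1 G'.
Proof.
move=> G0 G1 Gl w; have [[m [v ->]]|[x ->]] := xtel_cases w; last exact: Gl.
by have [[y ->]|[j [y [t ->]]]] := emb_cases v.
Qed.

End cuts.


Section pushing_up.
Variables (R : realType) (Y : nat -> uniformType) (q : forall i, Y i.+1 -> Y i).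
Hypothesis hq : forall i, unif_continuous (@q i).
Variables (X : nat -> uniformType) (p : forall i, X i.+1 -> X i).
Hypothesis hp : forall i, unif_continuous (@p i).
Variable f : invlim p -> invlim q.
Variables (n k : nat -> nat) (hn : increasing n) (hk : increasing k).
Hypothesis kS : forall j, (j.+1 <= k j)%N.
Variable F : sub_xtel R p hn -> xtel R q.
Hypothesis hF : level_extension f F.
Variable rho : xtel R q * R -> xtel R q.
Hypothesis rhoc : unif_continuous rho.
Hypothesis rhoE : forall j (y : Y j) s c, s <= j%:R ->
  rho (pt q y s, c) = pt q y (Num.min s c).
Hypothesis rho_proj : forall m w c, m%:R <= c ->
  invlim_proj m (rho (w, c)) = invlim_proj m w.

Local Notation hl := (increasing_comp hn hk).
Local Notation bn := (sub_bond p hn).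
Local Notation bl := (sub_bond p hl).

(** Points of the [j]-th term of the sequence [n \o k] are viewed in the telescope
    of [n], where their term has the greater index [k j]. *)
Definition over j (x : X (n (k j))) (s : R) : sub_xtel R p hn := @pt R _ bn (k j) x s.

(** The level to which a point of the [j]-th cylinder is pushed. It is constant in
    the upper half of the cylinder, which leaves room for a bridge there. *)
Definition target j (t : unitI R) : R :=
  (k j.+1)%:R - ((k j.+1)%:R - (k j)%:R) * Num.max 0 (2 * set_val t - 1).

Lemma target_itv j t : (k j)%:R <= target j t <= (k j.+1)%:R.
Proof.
have kk : (k j)%:R <= (k j.+1)%:R :> R by rewrite ler_nat; exact/ltnW/hk.
have t1 := unitI_le1 t; rewrite /target.
have m1 : Num.max 0 (2 * set_val t - 1) <= 1.
  by rewrite ge_max ler01 /=; lra.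
have m0 : 0 <= Num.max 0 (2 * set_val t - 1) by rewrite le_max lexx.
by apply/andP; split; nra.
Qed.

Lemma target_half j t : set_val t <= 1 / 2 -> target j t = (k j.+1)%:R.
Proof. by move=> t2; rewrite /target max_l ?mulr0 ?subr0 //; lra. Qed.

Lemma target1 j : target j (unitI1 R) = (k j)%:R.
Proof.
rewrite /target; have -> : set_val (unitI1 R) = 1 by [].
by rewrite max_r; lra.
Qed.

Lemma uc_target j : unif_continuous (target j).
Proof.
apply: uc_sub; first exact: uc_cst.
apply: uc_scale; apply: uc_max; first exact: uc_cst.
by apply: uc_sub; [apply: uc_scale; exact: uc_set_val|exact: uc_cst].
Qed.

Definition pushed j (t s : unitI R) : R :=
  (j.+1%:R - set_val t) + set_val s * (target j t - (j.+1%:R - set_val t)).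

Lemma kSR j : j.+1%:R <= (k j)%:R :> R. Proof. by rewrite ler_nat. Qed.

Lemma pushed_itv j t s : j.+1%:R - set_val t <= pushed j t s <= (k j.+1)%:R.
Proof.
have /andP[t0 t1] := target_itv j t; have := kSR j => kj.
have := unitI_ge0 t; have := unitI_ge0 s; have := unitI_le1 s => *.
by rewrite /pushed; apply/andP; split; nra.
Qed.

Lemma uc_pushed j : unif_continuous (fun z : unitI R * unitI R => pushed j z.1 z.2).
Proof.
have lc : unif_continuous (fun z : unitI R * unitI R => j.+1%:R - set_val z.1).
  apply: uc_sub; first exact: uc_cst.
  exact: (uc_comp (@uc_set_val _ _) (@uc_fst _ _)).
apply: uc_add => //; apply: (@uc_mul _ _ _ _ (k j.+1)%:R).
- move=> z; rewrite ger0_norm ?unitI_ge0 //; apply: le_trans (unitI_le1 _) _.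
  by rewrite ler1n (leq_trans _ (kS _)).
- move=> z; have /andP[t0 t1] := target_itv j z.1; have := kSR j => kj.
  have := unitI_ge0 z.1; have := unitI_le1 z.1; have := ler0n R j => *.
  rewrite -natr1 in kj *; rewrite ger0_norm; lra.
- exact: (uc_comp (@uc_set_val _ _) (@uc_snd _ _)).
- by apply: uc_sub => //; exact: (uc_comp (@uc_target j) (@uc_fst _ _)).
Qed.

Lemma bnc i : unif_continuous (@bn i). Proof. exact: (uc_bond hp). Qed.

Lemma uc_over j : unif_continuous (fun z : X (n (k j)) * R => over z.1 z.2).
Proof. exact: (@uc_pt R _ bn bnc (k j)). Qed.

Lemma over_bond j (x : X (n (k j.+1))) (s : R) : s <= (k j)%:R ->
  over x s = over (bl x) s.
Proof.
move=> sk; have kk : (k j <= k j.+1)%N by apply/ltnW/hk.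
rewrite /over (pt_bond bn kk x sk); congr pt.
by rewrite (sub_bondE p hn kk (increasing_leS hl j)).
Qed.

Lemma level_over j (x : X (n (k j))) s : 0 <= s <= (k j)%:R ->
  xtel_level (F (over x s)) = s%:E.
Proof.
move=> /andP[s0 sk]; have [_ Fl _] := hF.
by rewrite Fl /over xtel_level_pt // min_l.
Qed.

(** By uniform continuity, the [M]-th coordinate of [F] nearly depends on a single
    coordinate of the argument; that coordinate does not see the level of points
    which lie higher. *)
Lemma F_far M (V : set (tel R q M * tel R q M)) : entourage V -> exists m,
  forall i j (x : X (n (k i))) (y : X (n (k j))) (mi : (m <= k i)%N) (mj : (m <= k j)%N)
    (s r : R), m%:R <= s -> m%:R <= r ->
  bond bn mi x = bond bn mj y ->
  V (invlim_proj M (F (over x s)), invlim_proj M (F (over y r))).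
Proof.
move=> eV; have [Fc _ _] := hF.
have /ucP/(_ _ eV)[W eW WV] := uc_comp (@uc_invlim_proj _ _ M) Fc.
have [m [U [eU UW]]] := (invlim_entP (fun m => uc_tel_retr bnc (m := m)) _).1 eW.
exists m => i j x y mi mj s r ms mr xy; apply: WV; apply: UW.
rewrite /over (proj_pt_hi _ _ mi) // (proj_pt_hi _ _ mj) // xy.
exact: entourage_refl.
Qed.

Lemma F_far_lim M (V : set (tel R q M * tel R q M)) : entourage V -> exists m,
  forall i (mi : (m <= k i)%N) (y : invlim p) (s : R), m%:R <= s ->
  V (invlim_proj M (F (over (invlim_proj (n (k i)) y) s)),
     tel_incl R q (invlim_proj M (f y))).
Proof.
move=> eV; have [Fc _ Fe] := hF.
have /ucP/(_ _ eV)[W eW WV] := uc_comp (@uc_invlim_proj _ _ M) Fc.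
have [m [U [eU UW]]] := (invlim_entP (fun m => uc_tel_retr bnc (m := m)) _).1 eW.
exists m => i mi y s ms.
have -> : tel_incl R q (invlim_proj M (f y)) = invlim_proj M (F (sub_xtel_lim R hn y)).
  by rewrite Fe.
apply: WV; apply: UW.
rewrite /over (proj_pt_hi _ _ mi) //.
have -> : invlim_proj m (sub_xtel_lim R hn y) =
  tel_incl R bn (invlim_proj m (sub_lim hn y)) by [].
rewrite -(invlim_bond mi); exact: entourage_refl.
Qed.

(** Points of the telescope of [n \o k] are moved up along their paths before [F]
    is applied, and the values are retracted to the original level afterwards,
    so that the homotopy is level-preserving. There is room to move, as a point
    over [X (n (k j))] has a path up to level [k j] in the telescope of [n]. *)
Lemma push_up : exists H : sub_xtel R p hl * unitI R -> xtel R q,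
  [/\ unif_continuous H, forall s, level_extension f (fun w => H (w, s)),
    forall w, H (w, unitI0 R) = F (sub_xtel_map R p hn hk w),
    forall x : X (n (k 0)), H (@emb R _ bl 0 x, unitI1 R) = rho (F (over x (k 0)%:R), 0)
    & forall j (x : X (n (k j.+1))) t, H (emb (@cyl R _ bl j x t), unitI1 R) =
        rho (F (over x (target j t)), j.+1%:R - set_val t)].
Proof.
have [Fc Flev Fe] := hF.
pose e0 (z : X (n (k 0)) * unitI R) := rho (F (over z.1 ((k 0)%:R * set_val z.2)), 0).
pose h j (z : X (n (k j.+1)) * unitI R * unitI R) :=
  rho (F (over z.1.1 (pushed j z.1.2 z.2)), j.+1%:R - set_val z.1.2).
pose start j (s : unitI R) : R := j%:R + set_val s * ((k j)%:R - j%:R).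
have startP j s : j%:R <= start j s <= (k j)%:R.
  have := kSR j; rewrite -natr1 => kj.
  have := unitI_ge0 s; have := unitI_le1 s => *.
  by rewrite /start; apply/andP; split; nra.
have endE j (x : X (n (k j))) s :
    end_val (A := sub_seq X (n \o k)) e0 h x s = rho (F (over x (start j s)), j%:R).
  case: j x => [|j] x /=; first by rewrite /e0 /start /= subr0 add0r mulrC.
  have z0 : set_val (unitI0 R) = 0 by [].
  by rewrite /h /pushed /start /= z0 subr0 target_half // z0; lra.
have compat j (x : X (n (k j.+1))) s :
    h j (x, unitI1 R, s) = end_val (A := sub_seq X (n \o k)) e0 h (bl x) s.
  rewrite endE /h /= -(over_bond x); last by have /andP[] := startP j s.
  have z1 : set_val (unitI1 R) = 1 by [].
  by rewrite /pushed /start target1 z1 -natr1 addrK.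
have [f' f'E] := sub_lim_ext hl f.
have [|||||H [Hc HE Hl Hlev]] := @xtel_level_extension R (sub_seq X (n \o k)) Y bl q hq
    (unitI R) e0 h compat _ _ _ _ f'.
- apply: (uc_comp rhoc); apply: uc_pair; last exact: uc_cst.
  apply: (uc_comp Fc); apply: (uc_comp2 (@uc_over 0)); first exact: uc_fst.
  exact: (uc_scale _ (uc_comp (@uc_set_val _ _) (@uc_snd _ _))).
- move=> j; apply: (uc_comp rhoc); apply: uc_pair.
    apply: (uc_comp Fc); apply: (uc_comp2 (@uc_over j.+1)).
      exact: (uc_comp (@uc_fst _ _) (@uc_fst _ _)).
    apply: (uc_comp2 (@uc_pushed j)); last exact: uc_snd.
    exact: (uc_comp (@uc_snd _ _) (@uc_fst _ _)).
  apply: uc_sub; first exact: uc_cst.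
  exact: (uc_comp (@uc_set_val _ _) (uc_comp (@uc_snd _ _) (@uc_fst _ _))).
- move=> x s; have s0 := unitI_ge0 s; have s1 := unitI_le1 s; have k0 := ler0n R (k 0).
  have sk : 0 <= (k 0)%:R * set_val s <= (k 0)%:R by apply/andP; split; nra.
  rewrite /e0 /= (cut_level rhoE (level_over _ sk)) // min_r //.
  by case/andP: sk.
- move=> j x t s; have t1 := unitI_le1 t; have j0 := ler0n R j.
  have t0 : 0 <= j.+1%:R - set_val t by rewrite -natr1; lra.
  have /andP[p0 p1] := pushed_itv j t s.
  have sk : 0 <= pushed j t s <= (k j.+1)%:R by rewrite p1 andbT; lra.
  by rewrite /h /= (cut_level rhoE (level_over _ sk)) // min_r.
- move=> M V eV; have [m1 m1V] := F_far eV; have [m2 m2V] := F_far_lim eV.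
  pose m := maxn M (maxn m1 m2).
  have Mm : (M <= m)%N by rewrite leq_max leqnn.
  have m1m : (m1 <= m)%N by rewrite !leq_max leqnn orbT.
  have m2m : (m2 <= m)%N by rewrite !leq_max leqnn !orbT.
  have mk j : (m <= j)%N -> (m <= k j)%N.
    by move=> mj; rewrite (leq_trans mj) // (leq_trans (leqnSn _)).
  exists m; split=> [j mj x t s|x s].
    have mj' : m%:R <= j.+1%:R - set_val t.
      have := unitI_le1 t; have : m%:R <= j%:R :> R by rewrite ler_nat.
      by rewrite -natr1; lra.
    rewrite endE /h /= !rho_proj ?ler_nat //; last first.
      by apply: le_trans mj'; rewrite ler_nat.
    have kjk : (m1 <= k j.+1)%N by rewrite (leq_trans m1m) // mk // leqW.
    apply: (m1V m j.+1 _ _ (leq_trans m1m (mk _ (leqnn m))) kjk).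
    + by have /andP[h1 _] := startP m s; apply: le_trans h1; rewrite ler_nat.
    + have /andP[h1 _] := pushed_itv j t s; apply: le_trans h1.
      by apply: le_trans mj'; rewrite ler_nat.
    + rewrite sub_bond_comp; have kk := increasing_mono hk (leqW mj).
      by rewrite (eq_irrelevance (increasing_mono hk (leqW mj)) kk) (bond_comp _ _ _ kjk).
  have [y <-] := sub_lim_surj x.
  rewrite endE f'E rho_proj ?ler_nat //.
  apply: m2V; first by rewrite (leq_trans m2m) // mk.
  by have /andP[h1 _] := startP m s; apply: le_trans h1; rewrite ler_nat.
exists H; split=> //.
- move=> s; split; [exact: uc_slice|exact: Hlev|].
  by move=> x; rewrite /sub_xtel_lim Hl f'E.
- have z0 : set_val (unitI0 R) = 0 by [].
  apply: xtel_eq_fun => [x|j x t|x].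
  + have -> : @emb R _ bl 0 x = @pt R _ bl 0 x 0 by [].
    rewrite (sub_xtel_map_pt p hn hk x (lexx 0)) HE /= /e0 /= z0 mulr0.
    by apply: (cut_id rhoE); apply: level_over; rewrite lexx ler0n.
  + have t1 := unitI_le1 t; have t0 := unitI_ge0 t; have j0 := ler0n R j.
    have jt : j.+1%:R - set_val t <= j.+1%:R by lra.
    rewrite [in RHS]emb_cyl (sub_xtel_map_pt p hn hk x jt) HE tel_rec_cyl // /h /=.
    rewrite /pushed z0 mul0r addr0; apply: (cut_id rhoE); apply: level_over.
    by have := kSR j.+1; rewrite -!natr1 => kj; apply/andP; split; lra.
  + have [y <-] := sub_lim_surj x; rewrite Hl f'E.
    by rewrite -/(sub_xtel_lim R hl y) sub_xtel_map_lim Fe.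
- move=> x; rewrite HE /= /e0 /=.
  by have -> : set_val (unitI1 R) = 1 by []; rewrite mulr1.
- move=> j x t; rewrite HE tel_rec_cyl // /h /= /pushed.
  have -> : set_val (unitI1 R) = 1 by [].
  by rewrite mul1r addrC subrK.
Qed.

End pushing_up.


(** * Uniqueness up to homotopy *)

Section uniqueness.
Variables (R : realType) (Y : nat -> uniformType) (q : forall i, Y i.+1 -> Y i).
Hypothesis hY : forall i, uniform_ANR R (Y i).
Hypothesis hq : forall i, unif_continuous (@q i).
Variables (X : nat -> uniformType) (p : forall i, X i.+1 -> X i).
Hypothesis hp : forall i, unif_continuous (@p i).
Hypothesis hconv : convergent p.
Variable f : invlim p -> invlim q.
Variables (n : nat -> nat) (hn : increasing n).

Local Notation bn := (sub_bond p hn).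

(** Both extensions are uniformly continuous and restrict to [f] on the limit.
    The closeness is expressed in a term of the target, where the coordinates are
    recovered from telescope points because the top end is embedded. *)
Lemma extensions_near F F' : level_extension f F -> level_extension f F' ->
  forall M (V : set (Y M * Y M)), entourage V ->
  exists m (D : set (X (n m) * X (n m))), entourage D /\
    forall (x : invlim p) (w : sub_xtel R p hn) (z : X (n m)) (u : Y M),
      D (invlim_proj (n m) x, z) ->
      invlim_proj m w = tel_incl R bn (z : sub_seq X n m) ->
      tel_incl R q u = invlim_proj M (F w) \/ tel_incl R q u = invlim_proj M (F' w) ->
      V (invlim_proj M (f x), u).
Proof.
move=> [Fc _ Fe] [Fc' _ Fe'] M V eV.
have [W eW WV] := tel_incl_embedding q (hY M).1 eV.
have [A eA AW] := (ucP _).1 (uc_comp (@uc_invlim_proj _ _ M) Fc) _ eW.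
have [A' eA' AW'] := (ucP _).1 (uc_comp (@uc_invlim_proj _ _ M) Fc') _ eW.
have bnc i : unif_continuous (@bn i) by exact: (uc_bond hp).
have [m [U [eU UA]]] :=
  (invlim_entP (fun m => uc_tel_retr bnc (m := m)) _).1 (filterI eA eA').
have [D eD DU] := (ucP _).1 (@uc_tel_incl R _ bn m) _ eU.
exists m, D; split=> // x w z u xz wz.
have /UA[xw xw'] : U (invlim_proj m (sub_xtel_lim R hn x), invlim_proj m w).
  by rewrite wz; exact: DU.
move=> uF; apply: WV.
have E : tel_incl R q (invlim_proj M (f x)) = invlim_proj M (xtel_lim R (f x)) by [].
by case: uF => ->; rewrite E; [rewrite -Fe; exact: AW|rewrite -Fe'; exact: AW'].
Qed.

(** A point at level at least [i] is mapped to such a point, whose [i]-th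
    coordinate lies in the top end [Y i]. *)
Lemma extension_coordinate (k : nat -> nat) F (T : uniformType) i j
    (x : T -> X (n (k j))) (s : T -> R) : level_extension f F ->
  unif_continuous x -> unif_continuous s ->
  (forall z, i%:R <= s z <= (k j)%:R) ->
  {u : T -> Y i | unif_continuous u &
    forall z, tel_incl R q (u z) = invlim_proj i (F (over p hn (x z) (s z)))}.
Proof.
move=> hF xc sc sP.
have top z : exists y, invlim_proj i (F (over p hn (x z) (s z))) = tel_incl R q y.
  apply: tel_level_top; rewrite -xtel_level_ge.
  have /andP[s0 s1] := sP z.
  by rewrite (level_over hF) ?lee_fin // s1 andbT (le_trans _ s0).
exists (fun z => projT1 (cid (top z))) => [|z]; last by case: (cid _).
apply/ucP => V eV; have [W eW WV] := tel_incl_embedding q (hY i).1 eV.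
have [Fc _ _] := hF.
have Fic : unif_continuous (fun z => invlim_proj i (F (over p hn (x z) (s z)))).
  apply: (uc_comp (@uc_invlim_proj _ _ i)); apply: (uc_comp Fc).
  exact: (uc_comp2 (@uc_over R X p hp n k hn j) xc sc).
have [A eA AW] := (ucP _).1 Fic _ eW; exists A => // z z' /AW zz; apply: WV.
by case: (cid (top z)) => y /= <-; case: (cid (top z')) => y' /= <-.
Qed.

(** Low in the telescope the two extensions need not be close, but high up they
    are. So both are first pushed up to levels where they are close; there they are
    joined by short paths in [Y j.+1], assembled by a bridge. *)
Lemma level_extensions_homotopic F F' : level_extension f F -> level_extension f F' ->
  exists (k : nat -> nat) (hk : increasing k), homotopic_through_level_extensions f
    (F \o sub_xtel_map R p hn hk) (F' \o sub_xtel_map R p hn hk).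
Proof.
move=> hF hF'.
have [d [E0 [lam [P [T [[dm paths] [eT Psh] TP Tq]]]]]] := ANR_tolerances hY hq.
have lamxx i (y : Y i) s : lam i y y s = y by have [_ _ h _ _] := paths i.
have dat j : {m : nat & {D : set (X (n m) * X (n m)) | entourage D /\
    forall (x : invlim p) (w : sub_xtel R p hn) (z : X (n m)) (u : Y j.+1),
      D (invlim_proj (n m) x, z) ->
      invlim_proj m w = tel_incl R bn (z : sub_seq X n m) ->
      tel_incl R q u = invlim_proj j.+1 (F w) \/
        tel_incl R q u = invlim_proj j.+1 (F' w) ->
      T j (invlim_proj j.+1 (f x), u)}}.
  by have /cid[m /cid[D DP]] := extensions_near hF hF' (eT j); exists m, D.
pose ix j := projT1 (dat j); pose D j := projT1 (projT2 (dat j)).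
have eD j : entourage (D j) by have [] := projT2 (projT2 (dat j)).
have /choice[N NP] := convergent_shadows hp hconv (i := fun j => n (ix j)) eD.
have [k hk kN] := increasing_above (fun j => N j + ix j + j.+1)%N.
have kS j : (j.+1 <= k j)%N by apply: leq_trans (kN j); exact: leq_addl.
have kix i j : (i <= j)%N -> (ix i <= k j)%N.
  move=> ij; apply: leq_trans (increasing_mono hk ij); apply: leq_trans (kN i).
  by rewrite -addnA addnCA leq_addr.
have kNj j : (N j <= n (k j))%N.
  apply: leq_trans (increasing_geid hn _); apply: leq_trans (kN j).
  by rewrite -addnA leq_addr.
pose hl := increasing_comp hn hk.
have near i j (x : X (n (k j))) (h : (n (ix i) <= n (k j))%N) (s : R) (y : invlim p) u :
    (i <= j)%N -> D i (invlim_proj (n (ix i)) y, bond p h x) -> (ix i)%:R <= s ->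
    tel_incl R q u = invlim_proj i.+1 (F (over p hn x s)) \/
    tel_incl R q u = invlim_proj i.+1 (F' (over p hn x s)) ->
    T i (invlim_proj i.+1 (f y), u).
  move=> ij yx is_ uF; have [_ DT] := projT2 (projT2 (dat i)).
  apply: (DT y (over p hn x s) _ u yx _ uF).
  by rewrite /over (proj_pt_hi _ _ (kix i j ij)) // (sub_bondE p hn _ h).
have alphaP G i : level_extension f G -> {u : X (n (k i)) -> Y i.+1 | unif_continuous u &
    forall x, tel_incl R q (u x) = invlim_proj i.+1 (G (over p hn x (k i)%:R))}.
  move=> hG; apply: (extension_coordinate (k := k) hG (@uc_id _)).
    exact: uc_cst.
  by move=> _; rewrite ler_nat kS lexx.
have aP G j : level_extension f G ->
    {u : X (n (k j.+1)) * unitI R -> Y j.+1 | unif_continuous u &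
    forall z, tel_incl R q (u z) =
      invlim_proj j.+1 (G (over p hn z.1 (target k j z.2)))}.
  move=> hG; apply: (extension_coordinate (k := k)
    (s := fun z => target k j z.2) hG (@uc_fst _ _)) => [|z].
    exact: (uc_comp (@uc_target R k j) (@uc_snd _ _)).
  have /andP[t0 ->] := target_itv hk j z.2.
  by rewrite andbT (le_trans _ t0) // ler_nat.
(* [al] gives the coordinates of the pushed-up values over the ends, and [a] those
   along the cylinders; the former lie one term higher, to be used as [psi] *)
pose al G (hG : level_extension f G) i := s2val (alphaP G i hG).
pose a G (hG : level_extension f G) j := s2val (aP G j hG).
have alc G hG i : unif_continuous (@al G hG i) by exact: s2valP (alphaP G i hG).
have ac G hG j : unif_continuous (@a G hG j) by exact: s2valP (aP G j hG).
have alE G hG i x : tel_incl R q (@al G hG i x) =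
    invlim_proj i.+1 (G (over p hn x (k i)%:R)) by exact: s2valP' (alphaP G i hG) x.
have aE G hG j z : tel_incl R q (@a G hG j z) =
    invlim_proj j.+1 (G (over p hn z.1 (target k j z.2))).
  by exact: s2valP' (aP G j hG) z.
have a_half G hG j x t : set_val t <= 1 / 2 ->
    @a G hG j (x, t) = q (@al G hG j.+1 x).
  move=> t2; apply: (@tel_incl_inj R _ q); rewrite aE /= target_half //.
  by rewrite -tel_retr_incl alE invlim_projP.
have a_1 G hG j (x : X (n (k j.+1))) :
    @a G hG j (x, unitI1 R) = @al G hG j (@sub_bond X p _ hl j x).
  apply: (@tel_incl_inj R _ q); rewrite aE alE /= target1 //.
  by rewrite (over_bond p hn hk x (lexx _)).
have [rho [rhoc rhoE rho_proj]] := xtel_cut R hq.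
have [H1 [H1c H1l H10 H1e H1h]] := push_up hq hp hk kS hF rhoc rhoE rho_proj.
have [H2 [H2c H2l H20 H2e H2h]] := push_up hq hp hk kS hF' rhoc rhoE rho_proj.
pose psi j (z : X (n (k j)) * unitI R) : Y j.+1 :=
  lam j.+1 (al F hF j z.1) (al F' hF' j z.1) z.2.
pose theta j (z : X (n (k j.+1)) * unitI R * unitI R) : Y j.+1 :=
  lam j.+1 (a F hF j z.1) (a F' hF' j z.1) z.2.
have TPP j y u : T j (y, u) -> P j (y, u).
  by move=> yu; have [_ /(_ (unitI0 R))] := TP _ _ _ _ yu yu; rewrite lamxx.
have [f' f'E] := sub_lim_ext hl f.
have nk i j : (i <= j)%N -> (n (ix i) <= n (k j))%N.
  by move=> ij; apply: increasing_mono hn _ _ _; exact: kix.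
(* the same point of the limit serves all [i], as the bridge requires *)
have T_near j (x : X (n (k j))) : exists y : invlim p,
    (forall i (ij : (i <= j)%N), let x' := bond (@sub_bond X p _ hl) ij x in
      T i (invlim_proj i.+1 (f y), al F hF i x') /\
      T i (invlim_proj i.+1 (f y), al F' hF' i x')) /\
    (forall i (e : j = i.+1) t, let x' := ecast j (X (n (k j))) e x in
      T i (invlim_proj i.+1 (f y), a F hF i (x', t)) /\
      T i (invlim_proj i.+1 (f y), a F' hF' i (x', t))).
  have [y yx] := NP j (n (k j)) (kNj j) x; exists y.
  have kixR i : (ix i)%:R <= (k i)%:R :> R by rewrite ler_nat kix.
  split=> [i ij|i e t].
    have xE : bond p (nk i i (leqnn i)) (bond (@sub_bond X p _ hl) ij x) =
        bond p (nk i j ij) x.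
      rewrite (sub_bondE p hl ij (increasing_mono hl ij)).
      by rewrite (bond_comp p _ _ (nk i j ij)).
    have Dx := yx i ij (nk i j ij); rewrite -xE in Dx.
    by split; apply: (near i i _ _ _ _ _ (leqnn i) Dx (kixR i)); rewrite alE; [left|right].
  subst j; have Dx := yx i (leqnSn i) (nk i i.+1 (leqnSn i)).
  have tk : (ix i)%:R <= target k i t.
    by have /andP[h _] := target_itv hk i t; exact: le_trans (kixR i) h.
  by split; apply: (near i i.+1 _ _ _ _ _ (leqnSn i) Dx tk); rewrite aE; [left|right].
have E0psi j (x : X (n (k j))) : E0 j.+1 (al F hF j x, al F' hF' j x).
  have [y [/(_ j (leqnn j)) + _]] := T_near j x; rewrite bond_refl => -[h1 h2].
  by have [] := TP _ _ _ _ h1 h2.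
have E0theta j (x : X (n (k j.+1))) t : E0 j.+1 (a F hF j (x, t), a F' hF' j (x, t)).
  have [y [_ /(_ j erefl t)[h1 h2]]] := T_near j.+1 x.
  by have [] := TP _ _ _ _ h1 h2.
have [|||||H [Hc Hh He Hl Hlev]] := @xtel_bridge R Y q hq d dm E0 lam paths P Psh
  (sub_seq X (n \o k)) (@sub_bond X p _ hl) (unitI R) psi theta _ _ _ f'.
- move=> j; have [_ _ _ luc _] := paths j.+1; apply: luc => //.
  + exact: (uc_comp (alc F hF j) (@uc_fst _ _)).
  + exact: (uc_comp (alc F' hF' j) (@uc_fst _ _)).
  + exact: uc_snd.
- move=> j; have [_ _ _ luc _] := paths j.+1; apply: luc => //.
  + exact: (uc_comp (ac F hF j) (@uc_fst _ _)).
  + exact: (uc_comp (ac F' hF' j) (@uc_fst _ _)).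
  + exact: uc_snd.
  + by move=> [[x t] s]; exact: E0theta.
- by move=> j x s; rewrite /theta /psi /= !a_1.
- move=> j x; have [y [yal ya]] := T_near j.+1 x; exists (f y); split.
  + move=> i ij s; have [h1 h2] := yal i ij.
    by have [_ lP] := TP _ _ _ _ h1 h2; exact: lP.
  + move=> t s; have [h1 h2] := ya j erefl t.
    by have [_ lP] := TP _ _ _ _ h1 h2; exact: lP.
  + move=> s; have [h1 h2] := yal j.+1 (leqnn _).
    by have := Tq _ _ _ _ h1 h2 s; rewrite !bond_refl invlim_projP.
- move=> x i s; have [y <-] := sub_lim_surj x; rewrite f'E.
  have Dy : D i (invlim_proj (n (ix i)) y,
      bond p (nk i i (leqnn i)) (invlim_proj (n (k i)) y)).
    by rewrite invlim_bond; exact: (entourage_refl _ (eD i)).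
  have kixR : (ix i)%:R <= (k i)%:R :> R by rewrite ler_nat kix.
  have h1 : T i (invlim_proj i.+1 (f y), al F hF i (invlim_proj (n (k i)) y)).
    by apply: (near i i _ _ _ _ _ (leqnn i) Dy kixR); rewrite alE; left.
  have h2 : T i (invlim_proj i.+1 (f y), al F' hF' i (invlim_proj (n (k i)) y)).
    by apply: (near i i _ _ _ _ _ (leqnn i) Dy kixR); rewrite alE; right.
  by have [_ lP] := TP _ _ _ _ h1 h2; exact: lP.
exists k, hk.
have push_h G (hG : level_extension f G) j x t :
    rho (G (over p hn x (target k j t)), j.+1%:R - set_val t) =
    pt q (a G hG j (x, t)) (j.+1%:R - set_val t).
  have /andP[t0 t1] := target_itv hk j t.
  have tk : 0 <= target k j t <= (k j.+1)%:R by rewrite t1 (le_trans _ t0).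
  have jt : j.+1%:R - set_val t <= j.+1%:R by have := unitI_ge0 t; lra.
  exact: (cut_top rhoE (level_over (k := k) hG x tk) jt (esym (aE G hG j (x, t)))).
have push_e G (hG : level_extension f G) (x : X (n (k 0))) :
    rho (G (over p hn x (k 0)%:R), 0) = pt q (q (al G hG 0%N x)) 0.
  have kk : (0 : R) <= ((k 0%N)%:R : R) <= (k 0%N)%:R by rewrite ler0n lexx.
  have le01 : (0 : R) <= 1%N%:R by rewrite ler01.
  rewrite (cut_top rhoE (level_over (k := k) hG x kk) le01 (esym (alE G hG 0%N x))).
  exact: ptS.
apply: (@homotopic_trans _ _ _ _ _ _ _ _ _ (fun w => H1 (w, unitI1 R))).
  by exists H1.
apply: (@homotopic_trans _ _ _ _ _ _ _ _ _ (fun w => H2 (w, unitI1 R))); last first.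
  by apply: homotopic_sym; exists H2.
have l0 i y y' : lam i y y' (unitI0 R) = y by have [h _ _ _ _] := paths i.
have l1 i y y' : E0 i (y, y') -> lam i y y' (unitI1 R) = y'.
  by have [_ h _ _ _] := paths i; exact: h.
have bridgeE j x t s (G : sub_xtel R p hn -> xtel R q) (hG : level_extension f G) :
    theta j (x, t, s) = a G hG j (x, t) -> psi j.+1 (x, s) = al G hG j.+1 x ->
    bridge q lam psi theta (x, t, s) = a G hG j (x, t).
  move=> tE pE; rewrite /bridge /= tE pE.
  have [t2|/ltW t2] := leP (set_val t) (1 / 2); first by rewrite a_half // lamxx.
  by rewrite /bridge_time clip_le0 ?l0 //; lra.
exists H; split=> //.
- apply: xtel_eq_fun => [x|j x t|x].
  + by rewrite He H1e push_e /psi l0.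
  + by rewrite Hh H1h push_h (bridgeE _ _ _ _ F hF) // /theta /psi l0.
  + have [y <-] := sub_lim_surj x; rewrite Hl f'E.
    by have [_ _ H1x] := H1l (unitI1 R); rewrite -/(sub_xtel_lim R hl y) H1x.
- apply: xtel_eq_fun => [x|j x t|x].
  + by rewrite He H2e push_e /psi l1.
  + by rewrite Hh H2h push_h (bridgeE _ _ _ _ F' hF') // /theta /psi l1 //; exact: E0theta.
  + have [y <-] := sub_lim_surj x; rewrite Hl f'E.
    by have [_ _ H2x] := H2l (unitI1 R); rewrite -/(sub_xtel_lim R hl y) H2x.
- move=> s; split; [exact: uc_slice|exact: Hlev|].
  by move=> x; rewrite /sub_xtel_lim Hl f'E.
Qed.

End uniqueness.

Theorem theorem16p7 (R : realType)
  (Y : nat -> uniformType) (q : forall i, Y i.+1 -> Y i)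
  (hY : forall i, uniform_ANR R (Y i))
  (hq : forall i, unif_continuous (q i))
  (X : nat -> uniformType) (p : forall i, X i.+1 -> X i)
  (hX : forall i, metrizable R (X i))
  (hp : forall i, unif_continuous (p i))
  (hconv : convergent p)
  (f : invlim p -> invlim q) (hf : unif_continuous f) :
  exists (n : nat -> nat) (hn : increasing n) (fn : sub_xtel R p hn -> xtel R q),
    level_extension f fn /\
    forall fn' : sub_xtel R p hn -> xtel R q, level_extension f fn' ->
      exists (k : nat -> nat) (hk : increasing k),
        homotopic_through_level_extensions f
          (fn \o sub_xtel_map R p hn hk) (fn' \o sub_xtel_map R p hn hk).
Proof.
have [n [hn [fn hfn]]] := level_extension_exists hY hq hX hp hconv hf.
exists n, hn, fn; split=> // fn' hfn'.
exact: (level_extensions_homotopic hY hq hp hconv hfn hfn').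
Qed.
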